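(* Let $X$ be a complex Banach space, $1<\alpha<2$, $r>0$, $\omega>0$, $p\in[1,\infty)$, $\mathcal{C}=C([-r,0],X)$, $\varphi\in\mathcal{C}$, and let $A:D(A)\subseteq X\to X$ be a densely defined linear operator that is sectorial of type $\mu<0$ with angle $\theta$ satisfying $0<\theta\le\pi(1-\frac{\alpha}{2})$, with constants $M,C>0$ as in the context. Assume that: (i) $f,g\in PSAP_{\omega,r}(\mathcal{C},X)$ and $f(\cdot,0),g(\cdot,0)\in C_b([0,\infty),X)$; (ii) there exist $L_g\in C_b([0,\infty),\mathbb{R}^+)$ and $L_f\in BS^p(\mathbb{R}^+,\mathbb{R}^+)\cap L^1_{loc}([0,\infty),\mathbb{R}^+)$ such that for all $\psi,\phi\in\mathcal{C}$ and all $t\in[0,\infty)$, $$\|g(t,\psi)-g(t,\phi)\|\le L_g(t)\|\psi-\phi\|_{\mathcal{C}},\qquad \|f(t,\psi)-f(t,\phi)\|\le L_f(t)\|\psi-\phi\|_{\mathcal{C}};$$ (iii) $$\|L_g\|_{C_b([0,\infty),\mathbb{R}^+)}+CM\left(1+\frac{|\mu|^{-1/\alpha}\pi}{\alpha\sin(\pi/\alpha)}\right)\|L_f\|_{S^p}<1.$$ Then the system $$\frac{d}{dt}D(t,u_t)=\int_0^t\frac{(t-s)^{\alpha-2}}{\Gamma(\alpha-1)}A D(s,u_s)\,ds+f(t,u_t),\quad t\ge0,\qquad u_0=\varphi,$$ where $D(t,\psi)=\psi(0)-g(t,\psi)$, has a unique mild solution $u$ with $u|_{[0,\infty)}\in 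PSAP_{\omega,r}(X)$.
   Context: Function spaces. $\mathbb{R}^+=[0,\infty)$. $C_b([a,\infty),X)$ and $C_b([0,\infty),\mathbb{R}^+)$ denote the bounded continuous functions with the sup norm; $\mathcal{C}=C([-r,0],X)$ carries the sup norm $\|\cdot\|_{\mathcal{C}}$. For $u:[-r,\infty)\to X$ and $t\ge0$, the history $u_t:[-r,0]\to X$ is $u_t(\theta)=u(t+\theta)$. $BS^p(\mathbb{R}^+,\mathbb{R}^+)$ is the space of Stepanov bounded functions with exponent $p$: measurable $h:\mathbb{R}^+\to\mathbb{R}^+$ with $$\|h\|_{S^p}=\sup_{t\in\mathbb{R}^+}\left(\int_t^{t+1}|h(\tau)|^p\,d\tau\right)^{1/p}<\infty .$$ Pseudo $S$-asymptotic periodicity. $PSAP_\omega(X)$ is the set of $u\in C_b([0,\infty),X)$ with $\lim_{t\to\infty}\frac1t\int_0^t\|u(s+\omega)-u(s)\|ds=0$. $PSAP_{\omega,r}(X)$ is the set of $u\in PSAP_\omega(X)$ with $$\lim_{T\to\infty}\frac1T\int_r^T\sup_{\tau\in[s-r,s]}\|u(\tau+\omega)-u(\tau)\|ds=0.$$ $PSAP_{\omega,r}(\mathcal{C},X)$ is the set of $F\in C([0,\infty)\times\mathcal{C},X)$ such that for all $L>0$, $$\lim_{T\to\infty}\frac1T\int_r^T\sup_{\tau\in[s-r,s]}\ \sup_{\|x\|_{\mathcal{C}}\le L}\|F(\tau+\omega,x)-F(\tau,x)\|ds=0.$$ Sectorial operators and solution operator. A closed linear operator $A$ is sectorial of type $\mu\in\mathbb{R}$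 with angle $\theta$, $0<\theta<\frac\pi2$, and constant $M>0$ if its spectrum is contained in $\mu+S_\theta=\{\mu+\lambda:\lambda\in\mathbb{C}\setminus\{0\},|\arg(-\lambda)|<\theta\}$ and $\|(\lambda I-A)^{-1}\|\le\frac{M}{|\lambda-\mu|}$ for all $\lambda\notin\mu+S_\theta$, $\lambda\ne\mu$. A closed linear operator $A$ generates a solution operator if there are $\nu\in\mathbb{R}$ and a strongly continuous $S_\alpha:\mathbb{R}^+\to\mathcal{B}(X)$ with $\{\lambda^\alpha:\mathrm{Re}\,\lambda>\nu\}\subseteq\rho(A)$ and $\lambda^{\alpha-1}(\lambda^\alpha I-A)^{-1}x=\int_0^\infty e^{-\lambda t}S_\alpha(t)x\,dt$ for all $\mathrm{Re}\,\lambda>\nu$, $x\in X$; here $\lambda^\alpha=|\lambda|^\alpha e^{\alpha i\arg\lambda}$, $-\pi<\arg\lambda<\pi$. Then $S_\alpha(0)=I$. It is known (Cuesta) that an operator $A$ sectorial of type $\mu<0$ with $0<\theta\le\pi(1-\frac\alpha2)$ generates a solution operator $S_\alpha$, and that there is a constant $C>0$ with $$\|S_\alpha(t)\|\le\frac{CM}{1+|\mu|t^\alpha},\qquad t\ge0.$$ $M$ and $C$ denote these constants. Mild solution. A function $u\in C_b([-r,\infty),X)$ is a mild solution of the system if $u_0=\varphi$ and for all $t\ge0$ $$u(t)=S_\alpha(t)[\varphi(0)-g(0,\varphi)]+g(t,u_t)+\int_0^tS_\alpha(t-s)f(s,u_s)\,ds.$$ *)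

(* Defs.v *)
From HB Require Import structures.
From mathcomp Require Import all_boot all_order all_algebra.
From mathcomp Require Import all_classical all_reals all_analysis.
From mathcomp Require Import complex.

Set Implicit Arguments.
Unset Strict Implicit.
Unset Printing Implicit Defensive.

Import Order.TTheory GRing.Theory Num.Theory numFieldNormedType.Exports.

Local Open Scope classical_set_scope.
Local Open Scope ring_scope.
Local Open Scope complex_scope.

(* In a normed space over R[i] the library norm takes its values in R[i]; it is
   a nonnegative real there, so that taking the real part loses nothing. *)
Definition rnorm {R : realType} {V : normedZmodType R[i]} (x : V) : R :=
  complex.Re `|x|.

Section ComplexFunctions.
Context {R : realType}.
Implicit Types z : R[i].

(* The principal argument, in ]-pi, pi] for z != 0. *)
Definition carg z : R :=
  let a := acos (complex.Re z / rnorm z) in if 0 <= complex.Im z then a else - a.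

Definition cexp z : R[i] :=
  (expR (complex.Re z) * cos (complex.Im z)) +i* (expR (complex.Re z) * sin (complex.Im z)).

Definition cpow z (a : R) : R[i] :=
  (rnorm z `^ a * cos (a * carg z)) +i* (rnorm z `^ a * sin (a * carg z)).

End ComplexFunctions.

Section Bochner.
Context {d : measure_display} {T : measurableType d} {R : realType}.
Context {X : normedModType R[i]}.

(* The X-valued simple function \sum_c 1_(c.1) c.2. *)
Definition simple_eval (s : seq (set T * X)) (t : T) : X :=
  \sum_(c <- s) (\1_(c.1) t : R)%:C *: c.2.

Definition simple_integral (mu : {measure set T -> \bar R})
    (s : seq (set T * X)) : X :=
  \sum_(c <- s) (fine (mu c.1))%:C *: c.2.

(* f is Bochner integrable on D and v is its integral. *)
Definition bochner_integral (mu : {measure set T -> \bar R}) (D : set T)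
    (f : T -> X) (v : X) : Prop :=
  exists s : nat -> seq (set T * X),
  [/\ forall n c, c \in s n ->
        [/\ measurable c.1, c.1 `<=` D & (mu c.1 < +oo)%E],
      forall n, measurable_fun D (fun t => rnorm (f t - simple_eval (s n) t)),
      (\int[mu]_(t in D) (rnorm (f t - simple_eval (s n) t))%:E)%E
        @[n --> \oo] --> 0%E
    & simple_integral mu (s n) @[n --> \oo] --> v].

End Bochner.

Section Operators.
Context {R : realType} {X : normedModType R[i]}.

Definition opnorm (B : X -> X) : \bar R :=
  ereal_sup [set (rnorm (B x))%:E | x in [set x | rnorm x <= 1]].

(* The values of op_fun outside op_dom are irrelevant. *)
Record operator := Operator {
  op_dom : set X ;
  op_fun :> X -> X ;
  op_dom0 : op_dom 0 ;
  op_domP : forall (a : R[i]) (x y : X), op_dom x -> op_dom y ->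
    op_dom (a *: x + y) ;
  op_funP : forall (a : R[i]) (x y : X), op_dom x -> op_dom y ->
    op_fun (a *: x + y) = a *: op_fun x + op_fun y }.

Definition closed_operator (A : operator) : Prop :=
  closed [set xy : X * X | op_dom A xy.1 /\ xy.2 = A xy.1].

(* B is the bounded inverse of (lam I - A) : op_dom A -> X. *)
Definition is_resolvent (A : operator) (lam : R[i]) (B : {linear X -> X}) :
    Prop :=
  [/\ continuous B,
      forall x, op_dom A (B x) /\ lam *: B x - A (B x) = x
    & forall x, op_dom A x -> B (lam *: x - A x) = x].

Definition resolvent_set (A : operator) : set R[i] :=
  [set lam | exists B, is_resolvent A lam B].

Definition spectrum (A : operator) : set R[i] := ~` resolvent_set A.

Definition sector (theta : R) : set R[i] :=
  [set lam | lam != 0 /\ `|carg (- lam)| < theta].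

Definition sectorial (A : operator) (mu theta M : R) : Prop :=
  let mu_sector := [set mu%:C + lam | lam in sector theta] in
  [/\ closed_operator A, 0 < theta < pi / 2, 0 < M,
      spectrum A `<=` mu_sector
    & forall lam B, ~ mu_sector lam -> lam != mu%:C -> is_resolvent A lam B ->
        (opnorm B <= (M / rnorm (lam - mu%:C))%:E)%E].

(* Since nu may always be increased, the values of cpow on the half-line
   ]-oo, 0] play no role. *)
Definition solution_operator (alpha : R) (A : operator)
    (S : R -> {linear X -> X}) : Prop :=
  [/\ closed_operator A,
      forall t, 0 <= t -> continuous (S t),
      forall x, {within `[0, +oo[, continuous (fun t => S t x)}
    & exists nu : R, forall lam : R[i], nu < complex.Re lam ->
        exists B, is_resolvent A (cpow lam alpha) B /\
          forall x, bochner_integral lebesgue_measure `[0, +oo[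
            (fun t => cexp (- (lam * t%:C)) *: S t x)
            (cpow lam (alpha - 1) *: B x)].

End Operators.
Arguments operator {R} X.

Definition vanishing_mean {R : realType} (a : R) (w : R -> \bar R) : Prop :=
  ((T^-1)%:E * \int[lebesgue_measure]_(s in `[a, T]) w s)%E
    @[T --> +oo] --> 0%E.

Section FunctionSpaces.
Context {R : realType} {X : normedModType R[i]}.

(* A function on an interval is represented by a function on R whose values
   outside of the interval are irrelevant. *)
Definition Cb (a : R) (u : R -> X) : Prop :=
  {within `[a, +oo[, continuous u} /\
  exists K : R, forall t, a <= t -> rnorm (u t) <= K.

(* The space C([-r, 0], X). Two elements of it are the same history when they
   agree on [-r, 0]. *)
Definition hist_space (r : R) : set (R -> X) :=
  [set psi | {within `[- r, 0], continuous psi}].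

Definition hist_norm (r : R) (psi : R -> X) : R :=
  sup [set rnorm (psi th) | th in `[- r, 0]].

Definition history (u : R -> X) (t : R) : R -> X := fun th => u (t + th).

(* F belongs to C([0, +oo[ x C([-r, 0], X), X), where C([-r, 0], X) carries the
   topology of uniform convergence on [-r, 0]. As this topology does not
   separate functions that agree on [-r, 0], and X is Hausdorff, such an F t psi
   depends only on the restriction of psi to [-r, 0]. *)
Definition hist_continuous (r : R) (F : R -> (R -> X) -> X) : Prop :=
  {within [set q : R * {uniform` `[- r, 0] -> X} |
             0 <= q.1 /\ hist_space r q.2],
    continuous (fun q : R * {uniform` `[- r, 0] -> X} => F q.1 q.2)}.

Definition PSAP (omega : R) (u : R -> X) : Prop :=
  Cb 0 u /\
  vanishing_mean 0 (fun s => (rnorm (u (s + omega) - u s))%:E).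

Definition PSAPr (omega r : R) (u : R -> X) : Prop :=
  PSAP omega u /\
  vanishing_mean r (fun s =>
    ereal_sup [set (rnorm (u (tau + omega) - u tau))%:E
              | tau in `[s - r, s]]).

Definition PSAPr_hist (omega r : R) (F : R -> (R -> X) -> X) : Prop :=
  hist_continuous r F /\
  forall L : R, 0 < L ->
    vanishing_mean r (fun s =>
      ereal_sup [set
        ereal_sup [set (rnorm (F (tau + omega) x - F tau x))%:E
                  | x in [set x | hist_space r x /\ hist_norm r x <= L]]
      | tau in `[s - r, s]]).

End FunctionSpaces.

Section ScalarSpaces.
Context {R : realType}.
Implicit Type h : R -> R.

(* R with the sigma-algebra of Lebesgue measurable sets, the one on which
   completed_lebesgue_measure is defined. *)
Definition lebesgueType : measurableType _ :=
  caratheodory_type ((wlength (@idfun R))^*)%mu.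

Definition Cb_pos h : Prop :=
  [/\ {within `[0, +oo[, continuous h},
      forall t, 0 <= t -> 0 <= h t
    & exists K : R, forall t, 0 <= t -> h t <= K].

Definition Cb_pos_norm h : R := sup [set `|h t| | t in `[0, +oo[].

Definition stepanov_norm (p : R) h : \bar R :=
  ereal_sup [set ((\int[completed_lebesgue_measure]_(tau in `[t, (t + 1)%R])
                     (`|h tau| `^ p)%:E) `^ p^-1)%E | t in `[0, +oo[].

Definition BS_pos (p : R) h : Prop :=
  [/\ measurable_fun (`[0, +oo[ : set lebesgueType) h,
      forall t, 0 <= t -> 0 <= h t
    & (stepanov_norm p h < +oo)%E].

Definition L1loc_pos h : Prop :=
  (forall t, 0 <= t -> 0 <= h t) /\
  forall K : set R, compact K -> K `<=` `[0, +oo[ ->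
    completed_lebesgue_measure.-integrable K (EFin \o h).

End ScalarSpaces.

Section MildSolution.
Context {R : realType} {X : normedModType R[i]}.

Definition mild_solution (r : R) (S : R -> {linear X -> X})
    (f g : R -> (R -> X) -> X) (phi : R -> X) (u : R -> X) : Prop :=
  [/\ Cb (- r) u,
      forall th, - r <= th <= 0 -> history u 0 th = phi th
    & forall t, 0 <= t -> exists v,
        bochner_integral lebesgue_measure `[0, t]
          (fun s => S (t - s) (f s (history u s))) v /\
        u t = S t (phi 0 - g 0 phi) + g t (history u t) + v].

End MildSolution.

(* Main.v *)
Require Import Defs.
From HB Require Import structures.
From mathcomp Require Import all_boot all_order all_algebra.
From mathcomp Require Import all_classical all_reals all_analysis.
From mathcomp Require Import complex measurable_realfun.
From mathcomp Require Import ring lra zify.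

Set Implicit Arguments.
Unset Strict Implicit.
Unset Printing Implicit Defensive.

Import Order.TTheory GRing.Theory Num.Theory numFieldNormedType.Exports.

Local Open Scope classical_set_scope.
Local Open Scope ring_scope.
Local Open Scope complex_scope.

(** A mild solution is a fixed point of the map [mild_map], which sends [u] to
    [phi] on the negative half-line and, for [t >= 0], to
      [S t (phi 0 - g 0 phi) + g t u_t + \int_0^t S (t - s) (f s u_s) ds].
    This map acts on the bounded continuous functions that extend [phi], and
    the smallness hypothesis on [Lg] and [Lf] makes it contract the uniform
    distance there. So it has one fixed point, the uniform limit of the
    Picard iterates ([mild_solution_exists_unique]). Three points carry the
    proof.

    The contraction constant. The norm of [S t] is at most the decreasing
    [kernel] [K / (1 + m t^alpha)]. Cutting [[0, t]] into unit intervals counted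
    backwards from [t] bounds the convolution with [Lf] by the sum over [j] of
    the kernel at [j] times an integral of [Lf] over a unit interval, which
    Hoelder's inequality bounds by the Stepanov norm ([kernel_integral_le]). The
    term [j = 0] is the summand [1] of the constant, and the other terms form a
    lower Riemann sum of the integral of [1 / (1 + m x^alpha)] over the
    half-line, whose value is [m^(-1/alpha) (pi / alpha) / sin (pi / alpha)]. No
    improper integral is evaluated: the geometric series of the integrand on
    either side of [1] bounds every lower sum by the odd partial sums of the
    expansion of [pi / sin (pi a)] into simple fractions at [a = 1 / alpha]
    ([kernel_riemann_sum_le]). These partial sums converge along the powers of
    three, because they and the cosecant obey the same tripling identity
    ([csc_psum_exp3]); this is Herglotz's method for the cotangent.

    The initial value. The image of [u] is continuous at [0] only if [S 0] is
    the identity, which has to be drawn from the Laplace transform. As [l] grows,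
    [l^alpha] times the resolvent of [A] at [l^alpha], applied to [x], tends to
    [S 0 x] by the initial value theorem, and to [x] for [x] in the domain of
    [A] by the resolvent estimate; the domain is dense
    ([solution_operator_at0]).

    Asymptotic periodicity. Let [h <= 1] divide [r]. Vanishing means of the
    suprema over windows of length [r] translate into bounds [D n] on the blocks
    [[n h, (n + 1) h]], where the averages of [D] tend to zero
    ([vanishing_mean_blocks], [blocks_vanishing_mean]). Such sequences are stable
    under sums and under convolution with summable weights. Passing from [u] to
    its history costs a convolution with the indicator of a window of blocks,
    and integrating against [S (t - s)] costs a convolution with the summable
    sequence [kernel (n h)] ([block_small_mild_conv]). So every Picard iterate
    has such block bounds for [u (t + omega) - u t], and the uniform limit keeps
    vanishing means.

    The integral in the definition of a mild solution is a Bochner integral: it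
    exists since its integrand is continuous ([bochner_exists]), and everything
    used about it follows from the single estimate [bochner_dist_le]. *)

(** * Simple fractions of the cosecant *)

Section Cosecant.
Context {R : realType}.
Implicit Types (a b x y : R) (n : nat).

Lemma sin_le_id x : 0 <= x -> sin x <= x.
Proof.
move=> x0.
have [c _ E] : exists2 c, c \in `[0, x]%R & sin x - sin 0 = cos c * (x - 0).
  apply: MVT_segment => // y; exact: continuous_subspaceT (@continuous_sin R) y.
move: E; rewrite sin0 !subr0 => ->; rewrite -[leRHS]mul1r ler_wpM2r//.
Qed.

Lemma onem_cos_le x : 0 <= x -> 1 - cos x <= x ^+ 2 / 2.
Proof.
move=> x0.
have -> : cos x = 1 - 2 * sin (x / 2) ^+ 2.
  have E : x = (x / 2) *+ 2 by rewrite -mulr_natr; field.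
  rewrite {1}E cos_mulr2n -mulr_natr.
  by have := cos2Dsin2 (x / 2); set c := cos _; set s := sin _; lra.
have h0 : 0 <= x / 2 by lra.
have h1 := sin_le_id h0.
have h2 : - (x / 2) <= sin (x / 2).
  case: (leP x 2) => x2; last by have := sin_geN1 (x / 2); lra.
  have : 0 <= sin (x / 2).
    by apply: sin_ge0_pi; have := @pi_ge2 R => pi2; lra.
  lra.
have : sin (x / 2) ^+ 2 <= (x / 2) ^+ 2 by nra.
lra.
Qed.

Lemma subr_sin_le x : 0 <= x -> x - sin x <= x ^+ 3 / 2.
Proof.
move=> x0.
have [c] : exists2 c, c \in `[0, x]%R & sin x - sin 0 = cos c * (x - 0).
  apply: MVT_segment => // y; exact: continuous_subspaceT (@continuous_sin R) y.
rewrite in_itv/= => /andP[c0 cx]; rewrite sin0 !subr0 => ->.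
have := onem_cos_le c0 => h.
have : c ^+ 2 <= x ^+ 2 by rewrite ler_sqr ?nnegrE.
nra.
Qed.

Lemma sin_ge_quarter x : 0 < x -> x <= pi / 2 -> x / 4 <= sin x.
Proof.
move=> x0 xpi; have p2 := @pihalf_lt2 R.
case: (leP x 1) => x1.
  by have := subr_sin_le (ltW x0); nra.
have : sin 1 <= sin x.
  rewrite ltW// ltr_sin ?in_itv//=; first by lra.
  by apply/andP; split; have := @pihalf_ge1 R; lra.
by have := subr_sin_le (@ler01 R); lra.
Qed.

(** The derivative is [(sin^2 - c^2 cos) / (c^2 sin^2)], where numerator and
    denominator are both of the order of [c^4]; the constant is [16 = 4^2]
    because [sin c >= c / 4]. *)
Lemma csc_sub_inv_lip x y : 0 < x -> x <= y -> y <= pi / 2 ->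
  `|((sin x)^-1 - x^-1) - ((sin y)^-1 - y^-1)| <= 16 * (y - x).
Proof.
move=> x0 xy ypi.
have sgt0 (z : R) : 0 < z -> z <= pi / 2 -> 0 < sin z.
  by move=> z0 zp; have := sin_ge_quarter z0 zp; lra.
pose df z : R := - (sin z) ^- 2 * cos z + z ^- 2.
have D (z : R) : 0 < z -> z <= pi / 2 ->
    is_derive z 1 (fun z => (sin z)^-1 - z^-1) (df z).
  move=> z0 zp; have s0 := sgt0 _ z0 zp.
  have sn0 : sin z != 0 by rewrite gt_eqF.
  have zn0 : z != 0 by rewrite gt_eqF.
  have D1 : is_derive z 1 (fun z => (sin z)^-1) (- (sin z) ^- 2 * cos z).
    exact: is_deriveV.
  have D2 : is_derive z 1 (fun z : R => z^-1) (- z ^- 2 * 1).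
    exact: is_deriveV.
  have := is_deriveB D1 D2; congr is_derive.
  by rewrite /df mulr1 opprK.
have [c] : exists2 c, c \in `[x, y]%R & 
   ((sin y)^-1 - y^-1) - ((sin x)^-1 - x^-1) = df c * (y - x).
  apply: (@MVT_segment R (fun z => (sin z)^-1 - z^-1)) => //.
    move=> t; rewrite in_itv/= => /andP[xz zy].
    by apply: D; [exact: lt_trans xz|lra].
  apply: derivable_within_continuous => t; rewrite in_itv/= => /andP[xz zy].
  by apply: ex_derive; apply: D; [exact: lt_le_trans xz|lra].
rewrite in_itv/= => /andP[xc cy]; rewrite distrC => ->.
have c0 : 0 < c by lra.
have cp : c <= pi / 2 by lra.
rewrite normrM (ger0_norm (_ : 0 <= y - x)) ?subr_ge0// ler_wpM2r ?subr_ge0//.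
have s0 := sgt0 _ c0 cp.
have -> : df c = (sin c ^+ 2 - c ^+ 2 * cos c) / (c ^+ 2 * sin c ^+ 2).
  by rewrite /df; field; rewrite !gt_eqF.
have p0 : 0 < c ^+ 2 * sin c ^+ 2 by rewrite mulr_gt0// exprn_gt0.
rewrite normrM normfV (gtr0_norm p0) ler_pdivrMr//.
have := sin_ge_quarter c0 cp; have := sin_le_id (ltW c0).
have := subr_sin_le (ltW c0); have := onem_cos_le (ltW c0); have := cos_le1 c.
set s := sin c in s0 p0 *; set co := cos c => h1 h2 h3 h4 h5.
have q1 : c ^+ 2 * c ^+ 2 <= 16 * (c ^+ 2 * s ^+ 2).
  have : c ^+ 2 / 16 <= s ^+ 2.
    have -> : c ^+ 2 / 16 = (c / 4) ^+ 2 by field.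
    by rewrite ler_sqr ?nnegrE//; lra.
  have : 0 <= c ^+ 2 by exact: sqr_ge0.
  nra.
apply: le_trans q1.
have q2 : s ^+ 2 <= c ^+ 2 by rewrite ler_sqr ?nnegrE//; lra.
have q3 : c ^+ 2 - s ^+ 2 <= c ^+ 2 * c ^+ 2.
  have -> : c ^+ 2 - s ^+ 2 = (c - s) * (c + s) by ring.
  apply: (@le_trans _ _ (c ^+ 3 / 2 * (2 * c))); last by lra.
  by apply: ler_pM; lra.
have q4 : 0 <= c ^+ 2 by exact: sqr_ge0.
rewrite ler_norml; apply/andP; split; first by nra.
nra.
Qed.

(** With [c := cos (pi / 3)], the equation [cos (3 * (pi / 3)) = -1] reads
    [(c + 1) * (2 c - 1)^2 = 0]. *)
Lemma cos_pi3 : cos (pi / 3) = 1 / 2 :> R.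
Proof.
have p0 := @pi_gt0 R.
have c0 : 0 < cos (pi / 3) :> R by apply: cos_gt0_pihalf; lra.
have E : (pi : R) = (pi / 3) *+ 2 + pi / 3 by rewrite -mulr_natr; field.
have := @cospi R; move=> h; rewrite E cosD cos_mulr2n sin_mulr2n in h.
move: h.
have := cos2Dsin2 (pi / 3 : R).
set c := cos _ in c0 *; set s := sin _ => h1 h2.
have h3 : (c + 1) * (2 * c - 1) ^+ 2 = 0.
  transitivity (4 * c ^+ 3 - 3 * c + 1); first by ring.
  have -> : 4 * c ^+ 3 - 3 * c + 1 =
    (c ^+ 2 *+ 2 - 1) * c - (c * s) *+ 2 * s + 1 + 2 * c * (c ^+ 2 + s ^+ 2 - 1).
    by rewrite !mulr2n; ring.
  by rewrite h2 h1; ring.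
move/eqP: h3; rewrite mulf_eq0 sqrf_eq0 => /orP[|] /eqP => h3; lra.
Qed.

(** From [sin (3 x) = 4 sin x sin (x + pi / 3) sin (x + 2 pi / 3)], the product
    of the last two factors also being the denominator of the difference of
    their inverses. *)
Lemma csc_triple a : 0 < a < 1 ->
  pi / sin (pi * (a / 3)) - pi / sin (pi * ((a + 1) / 3))
    + pi / sin (pi * ((a + 2) / 3)) = 3 * (pi / sin (pi * a)).
Proof.
move=> /andP[a0 a1]; have p0 := @pi_gt0 R.
have sg (z : R) : 0 < z < 1 -> sin (pi * z) != 0.
  by move=> /andP[z0 z1]; rewrite gt_eqF// sin_gt0_pi//; apply/andP; split; nra.
have n1 : sin (pi * (a / 3)) != 0 by apply: sg; lra.
have n2 : sin (pi * ((a + 1) / 3)) != 0 by apply: sg; lra.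
have n3 : sin (pi * ((a + 2) / 3)) != 0 by apply: sg; lra.
have n4 : sin (pi * a) != 0 by apply: sg; lra.
pose x := pi * (a / 3).
have E2 : pi * ((a + 1) / 3) = x + pi / 3 by rewrite /x; field.
have E3 : pi * ((a + 2) / 3) = x + (pi / 3) *+ 2.
  by rewrite /x -mulr_natr; field.
have E4 : pi * a = x *+ 2 + x by rewrite /x -mulr_natr; field.
move: n1 n2 n3 n4; rewrite -/x E2 E3 E4 (sinD x (pi / 3)) (sinD x (pi / 3 *+ 2)) (sinD (x *+ 2)).
rewrite !sin_mulr2n !cos_mulr2n cos_pi3.
have := cos2Dsin2 (pi / 3 : R); rewrite cos_pi3; have := cos2Dsin2 x.
set s := sin x; set c := cos x; set q := sin (pi / 3) => h1 h2.
have h2' : q ^+ 2 = 3 / 4 by lra.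
have h1' : c ^+ 2 = 1 - s ^+ 2 by lra.
have -> : s * (1 / 2) + c * q = s / 2 + c * q by field.
have -> : s * ((1 / 2) ^+ 2 *+ 2 - 1) + c * ((1 / 2 * q) *+ 2) = c * q - s / 2.
  by rewrite !mulr2n; field.
have -> : (c * s) *+ 2 * c + (c ^+ 2 *+ 2 - 1) * s = s * (3 - 4 * s ^+ 2).
  rewrite !mulr2n.
  transitivity (s * (4 * c ^+ 2 - 1)); first by ring.
  by rewrite h1'; ring.
move=> n1 n2 n3 n4.
have n5 : 3 - 4 * s ^+ 2 != 0 by move: n4; rewrite mulf_eq0 negb_or => /andP[].
have E : (s / 2 + c * q) * (c * q - s / 2) = (3 - 4 * s ^+ 2) / 4.
  transitivity (c ^+ 2 * q ^+ 2 - s ^+ 2 / 4); first by field.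
  by rewrite h1' h2'; field.
have -> : pi / s - pi / (s / 2 + c * q) + pi / (c * q - s / 2) =
   pi / s + pi * s / ((s / 2 + c * q) * (c * q - s / 2)).
  field; rewrite n1 /=.
  have -> : c * q * 2 - s != 0.
    by apply: contra n3 => /eqP e; apply/eqP; lra.
  have -> : s + c * q * 2 != 0 => //.
    by apply: contra n2 => /eqP e; apply/eqP; lra.
by rewrite E; field; rewrite n1 n5.
Qed.

(** Partial sums of the expansion of [pi / sin (pi * a)] into simple fractions,
    with the poles [- k] and [k + 1] paired: this pairing makes the tripling
    identity exact for partial sums. *)
Definition csc_psum n a : R :=
  \sum_(k < n) (-1) ^+ k * ((k%:R + a)^-1 + (k%:R + 1 - a)^-1).

(** Up to the factor [3], the poles seen from [a / 3], [(a + 1) / 3] and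
    [(a + 2) / 3] are those seen from [a], sorted by residue modulo three. *)
Lemma csc_psum_triple n a : 0 < a < 1 ->
  csc_psum n (a / 3) - csc_psum n ((a + 1) / 3) + csc_psum n ((a + 2) / 3)
    = 3 * csc_psum (3 * n) a.
Proof.
move=> /andP[a0 a1]; rewrite /csc_psum; elim: n => [|n IH].
  by rewrite muln0 !big_ord0; ring.
have -> : (3 * n.+1 = (3 * n).+3)%N by lia.
rewrite !big_ord_recr/= !exprS !mulrDr -IH.
rewrite -(natr1 (3 * n).+1) -(natr1 (3 * n)) natrM.
have -> : (-1) ^+ (3 * n) = (-1) ^+ n :> R.
  by rewrite exprM; congr (_ ^+ _); rewrite !exprS expr0; ring.
have n0 : 0 <= n%:R :> R by rewrite ler0n.
set N : R := n%:R in n0 *; set e := (-1) ^+ n.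
by field; rewrite !gt_eqF//=; lra.
Qed.

End Cosecant.

Section CosecantLimit.
Context {R : realType}.
Implicit Types (a b x y : R) (n : nat).

Definition csc_err n a : R := csc_psum n a - pi / sin (pi * a).

(** The first pair of fractions removes the poles of the cosecant at both ends of
    the unit interval; the reflection [a |-> 1 - a] leaves only the end [0]. *)
Lemma csc_err1_lip : exists2 L : R, 0 <= L &
  forall a b, 0 < a < 1 -> 0 < b < 1 ->
    `|csc_err 1 a - csc_err 1 b| <= L * `|a - b|.
Proof.
have p0 := @pi_gt0 R.
have p4 : (pi : R) < 4 by have := @pihalf_lt2 R; lra.
have E a : csc_err 1 a = a^-1 + (1 - a)^-1 - pi / sin (pi * a).
  by rewrite /csc_err /csc_psum big_ord_recr/= big_ord0 expr0 mul1r !add0r.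
have sym a : csc_err 1 (1 - a) = csc_err 1 a.
  rewrite !E; have -> : pi * (1 - a) = pi - pi * a by ring.
  by rewrite sinB sinpi cospi; rewrite opprB addrCA subrr addr0; 
     rewrite mul0r sub0r mulN1r opprK (addrC (1 - a)^-1).
have L1 a b : 0 < a -> a <= b -> b <= 1 / 2 ->
    `|csc_err 1 a - csc_err 1 b| <= 260 * (b - a).
  move=> a0 ab b1.
  have -> : csc_err 1 a - csc_err 1 b = ((1 - a)^-1 - (1 - b)^-1)
     - pi * (((sin (pi * a))^-1 - (pi * a)^-1)
              - ((sin (pi * b))^-1 - (pi * b)^-1)).
    have sg (z : R) : 0 < z -> z <= 1 / 2 -> sin (pi * z) != 0.
      by move=> z0 z1; rewrite gt_eqF// sin_gt0_pi//; apply/andP; split; nra.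
    have s1 : sin (pi * a) != 0 by apply: sg; lra.
    have s2 : sin (pi * b) != 0 by apply: sg; lra.
    rewrite !E.
    move: (sin (pi * a)) (sin (pi * b)) s1 s2 => sa sb s1 s2.
    move: (pi : R) p0 => P P0.
    by field; rewrite s1 s2 !gt_eqF//=; lra.
  apply: le_trans (ler_normB _ _) _.
  (* [256 = 4 * 16 * 4], since [pi < 4] *)
  have h1 : `|pi * (((sin (pi * a))^-1 - (pi * a)^-1)
              - ((sin (pi * b))^-1 - (pi * b)^-1))| <= 256 * (b - a).
    rewrite normrM gtr0_norm//.
    have : `|((sin (pi * a))^-1 - (pi * a)^-1)
              - ((sin (pi * b))^-1 - (pi * b)^-1)| <= 16 * (pi * b - pi * a).
      by apply: csc_sub_inv_lip; nra.
    set w := `|_| => h.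
    have w0 : 0 <= w by exact: normr_ge0.
    apply: (@le_trans _ _ (4 * (16 * (pi * b - pi * a)))); first by nra.
    nra.
  have h2 : `|(1 - a)^-1 - (1 - b)^-1| <= 4 * (b - a).
    have -> : (1 - a)^-1 - (1 - b)^-1 = (a - b) / ((1 - a) * (1 - b)).
      by field; rewrite !gt_eqF//=; lra.
    have d0 : 0 < (1 - a) * (1 - b) by rewrite mulr_gt0//; lra.
    rewrite normrM normfV (gtr0_norm d0) ler_pdivrMr// distrC ger0_norm; last by lra.
    have : 1 / 4 <= (1 - a) * (1 - b) by nra.
    by have : 0 <= b - a; [lra|nra].
  lra.
have L2 a b : 0 < a -> a <= b -> b < 1 ->
    `|csc_err 1 a - csc_err 1 b| <= 260 * (b - a).
  move=> a0 ab b1.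
  case: (leP b (1 / 2)) => b2; first exact: L1.
  case: (leP (1 / 2) a) => a2.
    rewrite -(sym a) -(sym b) distrC.
    have -> : b - a = (1 - a) - (1 - b) by ring.
    apply: L1; lra.
  have -> : csc_err 1 a - csc_err 1 b =
    (csc_err 1 a - csc_err 1 (1 / 2)) + (csc_err 1 (1 / 2) - csc_err 1 b) by ring.
  apply: le_trans (ler_normD _ _) _.
  have h1 : `|csc_err 1 a - csc_err 1 (1 / 2)| <= 260 * (1 / 2 - a).
    by apply: L1; lra.
  have h2 : `|csc_err 1 (1 / 2) - csc_err 1 b| <= 260 * (b - 1 / 2).
    rewrite -(sym b) -(sym (1 / 2)) distrC.
    have -> : b - 1 / 2 = (1 - 1 / 2) - (1 - b) by field.
    apply: L1; lra.
  lra.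
exists 260 => // a b /andP[a0 a1] /andP[b0 b1].
case: (leP a b) => ab.
  have -> : `|a - b| = b - a by rewrite distrC ger0_norm// subr_ge0.
  exact: L2.
have -> : `|a - b| = a - b by rewrite ger0_norm// subr_ge0 ltW.
by rewrite distrC; apply: L2 => //; exact: ltW.
Qed.

Lemma csc_err_triple n a : 0 < a < 1 ->
  3 * csc_err (3 * n) a =
    csc_err n (a / 3) - csc_err n ((a + 1) / 3) + csc_err n ((a + 2) / 3).
Proof.
move=> a01; rewrite /csc_err mulrBr -csc_psum_triple// -csc_triple//.
by ring.
Qed.

(** The difference between the partial sum and the cosecant inherits the
    tripling identity. Its Lipschitz constant is divided by [3] at each step, as
    the three terms on the right each contribute a third of it. The first two
    of these terms then nearly cancel, and the last one is divided by [3], so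
    that the bound for the difference is at least halved. *)
Lemma csc_psum_exp3 a (e : R) : 0 < a < 1 -> 0 < e ->
  exists j, csc_psum (3 ^ j) a <= pi / sin (pi * a) + e.
Proof.
move=> a01 e0.
have [L L0 lipL] := csc_err1_lip.
have lip j : forall a b, 0 < a < 1 -> 0 < b < 1 ->
    `|csc_err (3 ^ j) a - csc_err (3 ^ j) b| <= L / 3 ^+ j * `|a - b|.
  elim: j => [|j IH] x y x01 y01.
    by rewrite expn0 expr0 divr1; exact: lipL.
  have x01' := x01; have y01' := y01; move/andP: x01' => [x0 x1].
  move/andP: y01' => [y0 y1].
  rewrite expnS; have := csc_err_triple (3 ^ j) x01.
  have := csc_err_triple (3 ^ j) y01.
  have := IH (x / 3) (y / 3); have := IH ((x + 1) / 3) ((y + 1) / 3).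
  have := IH ((x + 2) / 3) ((y + 2) / 3).
  have -> : x / 3 - y / 3 = (x - y) / 3 by ring.
  have -> : (x + 1) / 3 - (y + 1) / 3 = (x - y) / 3 by ring.
  have -> : (x + 2) / 3 - (y + 2) / 3 = (x - y) / 3 by ring.
  have -> : `|(x - y) / 3| = `|x - y| / 3.
    by rewrite normrM normfV (ger0_norm (_ : 0 <= 3)).
  have -> : L / 3 ^+ j.+1 = L / 3 ^+ j / 3.
    by rewrite exprS; field; rewrite expf_neq0.
  set l := L / 3 ^+ j; set d := `|x - y|.
  move=> A1 A2 A3 Ey Ex.
  have B1 : `|csc_err (3 ^ j) ((x + 2) / 3) - csc_err (3 ^ j) ((y + 2) / 3)|
    <= l * (d / 3) by apply: A1; lra.
  have B2 : `|csc_err (3 ^ j) ((x + 1) / 3) - csc_err (3 ^ j) ((y + 1) / 3)|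
    <= l * (d / 3) by apply: A2; lra.
  have B3 : `|csc_err (3 ^ j) (x / 3) - csc_err (3 ^ j) (y / 3)|
    <= l * (d / 3) by apply: A3; lra.
  move: B1 B2 B3; rewrite !ler_norml => /andP[? ?] /andP[? ?] /andP[? ?].
  by apply/andP; split; lra.
pose B := L + `|csc_err 1 (1 / 2)|.
have B0 : L <= B by rewrite lerDl.
have bnd j : forall a, 0 < a < 1 -> `|csc_err (3 ^ j) a| <= B / 2 ^+ j.
  elim: j => [|j IH] x x01.
    rewrite expn0 expr0 divr1.
    have : `|csc_err 1 x - csc_err 1 (1 / 2)| <= L * `|x - 1 / 2|.
      by apply: lipL => //; lra.
    move=> h.
    have -> : csc_err 1 x = (csc_err 1 x - csc_err 1 (1 / 2)) + csc_err 1 (1 / 2).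
      by ring.
    apply: le_trans (ler_normD _ _) _; rewrite lerD2r.
    rewrite (le_trans h)// ler_piMr//.
    by rewrite ler_norml; move/andP: x01 => [? ?]; apply/andP; split; lra.
  have x01' := x01; move/andP: x01' => [x0 x1].
  rewrite expnS; have := csc_err_triple (3 ^ j) x01.
  have h1 : `|csc_err (3 ^ j) (x / 3) - csc_err (3 ^ j) ((x + 1) / 3)|
      <= L / 3 ^+ j * `|x / 3 - (x + 1) / 3| by apply: lip; lra.
  have h2 : `|csc_err (3 ^ j) ((x + 2) / 3)| <= B / 2 ^+ j by apply: IH; lra.
  have E : `|x / 3 - (x + 1) / 3| = 1 / 3.
    have -> : x / 3 - (x + 1) / 3 = - (1 / 3) by field.
    by rewrite normrN ger0_norm; lra.
  have h3 : L / 3 ^+ j <= B / 2 ^+ j.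
    apply: ler_pM; [exact: L0|by rewrite invr_ge0 exprn_ge0|exact: B0|].
    rewrite lef_pV2 ?posrE ?exprn_gt0// lerXn2r ?nnegrE//; lra.
  rewrite {}E in h1.
  have -> : B / 2 ^+ j.+1 = B / 2 ^+ j / 2.
    by rewrite exprS; field; rewrite expf_neq0.
  move: h1 h2; rewrite !ler_norml => /andP[? ?] /andP[? ?] ?.
  by apply/andP; split; lra.
have [j hj] : exists j, B / 2 ^+ j <= e.
  have Bp : 0 <= B by exact: le_trans L0 B0.
  have Be : 0 <= B / e by rewrite divr_ge0 ?(ltW e0).
  exists (Num.bound (B / e)).
  have := archi_boundP Be; set j := Num.bound _ => hj.
  have h : B / e < 2 ^+ j.
    apply: lt_le_trans hj _; rewrite -natrX ler_nat ltnW//; exact: ltn_expl.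
  by rewrite ler_pdivrMr ?exprn_gt0// mulrC -ler_pdivrMr// ltW.
exists j; have := bnd j a a01; rewrite /csc_err ler_norml => /andP[_]; lra.
Qed.

End CosecantLimit.

(** * Riemann sums of the kernel *)
Section KernelSum.
Context {R : realType}.
Implicit Types (a b x y : R) (n : nat).

Lemma alternating_sum_ge (c : nat -> R) m :
  (forall k, 0 <= c k) -> (forall k, c k.+1 <= c k) ->
  0 <= \sum_(k < m.*2.+1) (-1) ^+ k * c k.
Proof.
move=> c0 cd; suff : c m.*2 <= \sum_(k < m.*2.+1) (-1) ^+ k * c k.
  exact: le_trans.
elim: m => [|m IH]; first by rewrite big_ord_recr big_ord0/= expr0 mul1r add0r.
rewrite doubleS 2!big_ord_recr/= !exprS -signr_odd odd_double expr0.
have := cd m.*2; have := cd m.*2.+1; lra.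
Qed.

(** With an odd number of terms, the remainder [y^(2 m + 1) / (1 + y)] of the
    geometric series is counted with a positive sign. *)
Lemma inv1D_le_alternating y m : 0 <= y ->
  (1 + y)^-1 <= \sum_(k < m.*2.+1) (-1) ^+ k * y ^+ k.
Proof.
move=> y0; have y1 : 0 < 1 + y by rewrite ltr_wpDr.
rewrite -[leLHS]mul1r ler_pdivrMr//.
under eq_bigr do rewrite -exprMn mulN1r.
have := subrX1 (- y) m.*2.+1; set s := \sum_(i < _) _ => E.
have -> : s * (1 + y) = - ((- y - 1) * s) by ring.
rewrite -E exprS exprNn -signr_odd odd_double expr0 mul1r.
have : 0 <= y ^+ m.*2 by rewrite exprn_ge0.
nra.
Qed.

(** The antiderivative of [\sum_k (-1)^k x^(c k - 1)]. *)
Definition pow_antideriv (c : nat -> R) n x : R :=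
  \sum_(k < n) (-1) ^+ k * (x `^ c k / c k).

Lemma is_derive_pow_antideriv (c : nat -> R) n x : (forall k, c k != 0) ->
  0 < x -> is_derive x 1 (pow_antideriv c n)
    (\sum_(k < n) (-1) ^+ k * x `^ (c k - 1)).
Proof.
move=> c0 x0.
have -> : pow_antideriv c n =
    \sum_(k < n) (fun z : R => ((-1) ^+ k / c k) * z `^ c k).
  apply/funext => z; rewrite /pow_antideriv fct_sumE.
  by apply: eq_bigr => k _; ring.
apply: is_derive_sum => k.
have h := @is_deriveZ R R R (fun z : R => z `^ c k) ((-1) ^+ k / c k) x 1 _
  (@is_derive1_powR R (c k) x x0).
apply: (is_derive_eq h).
rewrite [LHS]/GRing.scale/=.
by field; rewrite c0.
Qed.

Lemma pow_antideriv_incr (q : R -> R) (c : nat -> R) n a b :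
  (forall k, c k != 0) -> 0 < a -> a <= b ->
  (forall x y, a <= x -> x <= y -> q y <= q x) ->
  (forall x, a <= x -> q x <= \sum_(k < n) (-1) ^+ k * x `^ (c k - 1)) ->
  q b * (b - a) <= pow_antideriv c n b - pow_antideriv c n a.
Proof.
move=> c0 a0 ab qd qle.
have [x] : exists2 x, x \in `[a, b]%R &
    pow_antideriv c n b - pow_antideriv c n a =
    (\sum_(k < n) (-1) ^+ k * x `^ (c k - 1)) * (b - a).
  apply: (@MVT_segment R (pow_antideriv c n)
    (fun x => \sum_(k < n) (-1) ^+ k * x `^ (c k - 1))) => //.
    move=> z; rewrite in_itv/= => /andP[az _].
    by apply: is_derive_pow_antideriv => //; exact: lt_trans az.
  apply: derivable_within_continuous => z; rewrite in_itv/= => /andP[az _].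
  apply: ex_derive; apply: is_derive_pow_antideriv => //.
  exact: lt_le_trans az.
rewrite in_itv/= => /andP[ax xb] ->.
apply: ler_wpM2r; first by rewrite subr_ge0.
by apply: le_trans (qle _ ax); exact: qd.
Qed.

Variable alpha : R.
Hypothesis alpha_gt1 : 1 < alpha.

Let q x : R := (1 + x `^ alpha)^-1.

Let q_ge0 x : 0 <= q x.
Proof. by rewrite invr_ge0 addr_ge0// powR_ge0. Qed.

Let q_decr x y : 0 <= x -> x <= y -> q y <= q x.
Proof.
move=> x0 xy; rewrite lef_pV2 ?posrE ?ltr_wpDr ?powR_ge0// lerD2l.
apply: ge0_ler_powR => //; first by have := alpha_gt1; lra.
by rewrite nnegrE (le_trans x0).
Qed.

Variable m : nat.
Let n := m.*2.+1.

(* [G] integrates the expansion in powers of [x^alpha], used below [1], and [H]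
   the one in powers of [x^(-alpha)], used above [1]. *)
Let cG (k : nat) : R := alpha * k%:R + 1.
Let cH (k : nat) : R := 1 - alpha * k.+1%:R.
Let G := pow_antideriv cG n.
Let H := pow_antideriv cH n.

Let cG_gt0 k : 0 < cG k.
Proof. by rewrite ltr_wpDl// mulr_ge0// ltW// (lt_trans _ alpha_gt1). Qed.

Let cH_lt0 k : cH k < 0.
Proof.
have : 0 <= k%:R :> R by [].
rewrite /cH -natr1; have := alpha_gt1; nra.
Qed.

Let G_incr a b : 0 < a -> a <= b -> q b * (b - a) <= G b - G a.
Proof.
move=> a0 ab; apply: pow_antideriv_incr => //.
- by move=> k; rewrite gt_eqF.
- by move=> x y ax; apply: q_decr; lra.
move=> x ax; apply: le_trans (inv1D_le_alternating m (powR_ge0 x alpha)) _.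
rewrite le_eqVlt; apply/orP; left; apply/eqP; apply: eq_bigr => k _.
by rewrite -powR_mulrn ?powR_ge0// -powRrM /cG addrK.
Qed.

Let H_incr a b : 1 <= a -> a <= b -> q b * (b - a) <= H b - H a.
Proof.
move=> a1 ab; apply: pow_antideriv_incr => //.
- by move=> k; rewrite lt_eqF.
- by rewrite (lt_le_trans _ a1).
- by move=> x y ax; apply: q_decr; lra.
move=> x ax; have x0 : 0 < x by lra.
have xa : 0 < x `^ alpha by rewrite powR_gt0.
have -> : q x = (x `^ alpha)^-1 * (1 + (x `^ alpha)^-1)^-1.
  by rewrite /q; field; rewrite !gt_eqF//=; lra.
have xi : 0 <= (x `^ alpha)^-1 by rewrite invr_ge0 ltW.
apply: le_trans (ler_wpM2l xi (inv1D_le_alternating m xi)) _.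
rewrite mulr_sumr.
rewrite le_eqVlt; apply/orP; left; apply/eqP; apply: eq_bigr => k _.
rewrite mulrCA -exprS; congr (_ * _).
by rewrite -powRN -powR_mulrn ?powR_ge0// -powRrM /cH; congr (_ `^ _); ring.
Qed.

Let G_ge0 x : 0 <= x <= 1 -> 0 <= G x.
Proof.
move=> /andP[x0 x1]; rewrite /G /pow_antideriv.
apply: (@alternating_sum_ge (fun k => x `^ cG k / cG k)) => k.
  by rewrite divr_ge0 ?powR_ge0// ltW.
apply: ler_pM; rewrite ?powR_ge0 ?invr_ge0 ?(ltW (cG_gt0 _))//.
  case: (eqVneq x 0) => [->|xn0].
    by rewrite !powR0 ?gt_eqF.
  apply: ger_powR; first by rewrite lt_def xn0 x0.
  by rewrite /cG -natr1; have := alpha_gt1; lra.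
rewrite lef_pV2 ?posrE//; by rewrite /cG -natr1; have := alpha_gt1; lra.
Qed.

Let H_le0 x : 1 <= x -> H x <= 0.
Proof.
move=> x1; rewrite -oppr_ge0 /H /pow_antideriv -sumrN.
under eq_bigr do rewrite -mulrN -mulrN -invrN.
apply: (@alternating_sum_ge (fun k => x `^ cH k / - cH k)) => k.
  by rewrite mulr_ge0 ?powR_ge0// invr_ge0 oppr_ge0 ltW.
apply: ler_pM; rewrite ?powR_ge0 ?invr_ge0 ?oppr_ge0 ?(ltW (cH_lt0 _))//.
  by apply: ler_powR => //; rewrite /cH -(natr1 k.+1); have := alpha_gt1; lra.
by rewrite lef_pV2 ?posrE ?oppr_gt0// /cH -(natr1 k.+1); have := alpha_gt1; lra.
Qed.

Let G_incr0 b : 0 < b <= 1 -> q b * b <= G b.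
Proof.
move=> /andP[b0 b1]; apply/ler_addgt0Pr => e e0.
pose a := Num.min b e.
have a0 : 0 < a by rewrite lt_min b0 e0.
have ab : a <= b by rewrite ge_min lexx.
have ae : a <= e by rewrite ge_min lexx orbT.
have := G_incr a0 ab; have : 0 <= G a by apply: G_ge0; rewrite ltW//=; lra.
have : q b <= 1 by rewrite invf_le1 ?lerDl ?powR_ge0// ltr_wpDr ?powR_ge0.
have := q_ge0 b; nra.
Qed.

(* The bound for the integral of [q] over [[0, x]], glued at [1]; the case
   [x <= 0] reads off the limit of [G] at [0]. *)
Let Q x : R := if x <= 1 then (if x <= 0 then 0 else G x) else G 1 + (H x - H 1).

Let Q_incr a b : 0 <= a -> a <= b -> 0 < b -> q b * (b - a) <= Q b - Q a.
Proof.
move=> a0 ab b0; rewrite /Q.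
have A x : 0 <= a -> a <= x -> 0 < x -> x <= 1 ->
    q x * (x - a) <= G x - (if a <= 0 then 0 else G a).
  move=> _ ax x0 x1; case: (leP a 0) => a0'.
    have -> : a = 0 by apply/eqP; rewrite eq_le a0'.
    by rewrite !subr0; apply: G_incr0; rewrite x0.
  exact: G_incr.
rewrite [b <= 0]leNgt b0/=.
case: (leP b 1) => b1.
  have -> : a <= 1 by exact: le_trans b1.
  exact: A.
case: (leP a 1) => a1; last first.
  have := H_incr (ltW a1) ab; lra.
have := A 1 a0 a1 ltr01 (lexx _); have := H_incr (lexx 1) (ltW b1).
have : q b * (1 - a) <= q 1 * (1 - a).
  by apply: ler_wpM2r; [rewrite subr_ge0|exact: (q_decr ler01 (ltW b1))].
set qb := q b; set q1 := q 1; set g := if _ then _ else _; lra.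
Qed.

(** The lower sum is at most [G 1 - H 1], the term [k] of which is
    [(-1)^k (1 / (alpha k + 1) + 1 / (alpha (k + 1) - 1))]: the pair of simple
    fractions at [1 / alpha], up to the factor [1 / alpha]. *)
Lemma kernel_riemann_sum_le (e : R) (J : nat) : 0 < e ->
  \sum_(k < J) (1 + (e * k.+1%:R) `^ alpha)^-1 * e
    <= alpha^-1 * csc_psum n alpha^-1.
Proof.
move=> e0.
have -> : alpha^-1 * csc_psum n alpha^-1 = G 1 - H 1.
  rewrite /G /H /pow_antideriv /csc_psum mulr_sumr -sumrB.
  apply: eq_bigr => k _; rewrite powR1 /cG /cH -natr1.
  have k0 : 0 <= k%:R :> R by [].
  have h1 := alpha_gt1.
  field; apply/and4P; split.
  - by rewrite lt_eqF//; nra.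
  - by rewrite gt_eqF//; nra.
  - by rewrite gt_eqF//; lra.
  - by rewrite gt_eqF//; nra.
have -> : \sum_(k < J) (1 + (e * k.+1%:R) `^ alpha)^-1 * e
    = \sum_(k < J) q (e * k.+1%:R) * (e * k.+1%:R - e * k%:R).
  by apply: eq_bigr => k _; rewrite /q -natr1; ring.
have h : \sum_(k < J) q (e * k.+1%:R) * (e * k.+1%:R - e * k%:R) <= Q (e * J%:R).
  elim: J => [|J IH].
    by rewrite big_ord0 mulr0 /Q ler01 lexx.
  rewrite big_ord_recr/=.
  have : q (e * J.+1%:R) * (e * J.+1%:R - e * J%:R)
      <= Q (e * J.+1%:R) - Q (e * J%:R).
    apply: Q_incr; rewrite ?mulr_ge0 ?mulr_gt0 ?(ltW e0)//.
    by apply: ler_wpM2l; [exact: ltW|rewrite ler_nat].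
  move: IH; lra.
apply: le_trans h _.
have h1 := H_le0 (lexx 1).
have h2 : 0 <= G 1 by apply: G_ge0; rewrite ler01 lexx.
rewrite /Q; case: (leP _ 1) => x1; last first.
  by have := H_le0 (ltW x1); lra.
case: (leP _ 0) => x0; first by lra.
have := G_incr x0 x1; have := q_ge0 1; nra.
Qed.

End KernelSum.

(** The substitution of [m^(1 / alpha) x] for [x] makes the sum a lower Riemann
    sum of [1 / (1 + x^alpha)] with step [m^(1 / alpha)]. *)
Lemma kernel_sum_le (R : realType) (alpha m : R) (J : nat) :
  1 < alpha -> 0 < m ->
  \sum_(k < J) (1 + m * k.+1%:R `^ alpha)^-1
    <= m `^ (- alpha^-1) * pi / (alpha * sin (pi / alpha)).
Proof.
move=> al1 m0; have al0 : 0 < alpha by lra.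
pose e := m `^ alpha^-1.
have e0 : 0 < e by rewrite powR_gt0.
have E (k : nat) : m * k%:R `^ alpha = (e * k%:R) `^ alpha.
  by rewrite powRM ?(ltW e0)// /e -powRrM mulVf ?gt_eqF// powRr1// ltW.
under eq_bigr do rewrite E.
rewrite powRN -/e.
have -> : e^-1 * pi / (alpha * sin (pi / alpha)) =
   (alpha^-1 * (pi / sin (pi * alpha^-1))) / e.
  by rewrite invfM; ring.
rewrite ler_pdivlMr// mulr_suml.
have a01 : 0 < alpha^-1 < 1 by rewrite invr_gt0 al0 invf_lt1.
apply/ler_addgt0Pr => d d0.
have [j] := csc_psum_exp3 a01 (mulr_gt0 al0 d0).
have -> : (3 ^ j = ((3 ^ j)./2).*2.+1)%N.
  by rewrite -[LHS]odd_double_half oddX/= orbT.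
move=> hj; apply: le_trans (kernel_riemann_sum_le al1 _ _ e0) _.
have ai : 0 <= alpha^-1 by rewrite invr_ge0 ltW.
apply: le_trans (ler_wpM2l ai hj) _.
by rewrite mulrDr mulKf ?gt_eqF.
Qed.

(** * Vectors over the complex numbers with a real norm *)

Section RealNorm.
Context {R : realType} {X : normedModType R[i]}.
Implicit Types (x y : X) (a e : R).

Lemma rnormE x : `|x| = (rnorm x)%:C.
Proof.
have := normr_ge0 x; rewrite /rnorm lecE => /andP[/= /eqP].
by case: `|x| => re im /= ->.
Qed.

Lemma rnorm_ge0 x : 0 <= rnorm x.
Proof. by have := normr_ge0 x; rewrite rnormE lecR. Qed.

Lemma rnorm0 : rnorm (0 : X) = 0.
Proof. by rewrite /rnorm normr0. Qed.

Lemma rnorm_eq0 x : rnorm x = 0 -> x = 0.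
Proof. by move=> h; apply/eqP; rewrite -normr_eq0 rnormE h. Qed.

Lemma rnormN x : rnorm (- x) = rnorm x.
Proof. by rewrite /rnorm normrN. Qed.

Lemma rnormBC x y : rnorm (x - y) = rnorm (y - x).
Proof. by rewrite /rnorm distrC. Qed.

Lemma rnormD x y : rnorm (x + y) <= rnorm x + rnorm y.
Proof. by rewrite -lecR rmorphD/= -!rnormE ler_normD. Qed.

Lemma rnormB x y : rnorm (x - y) <= rnorm x + rnorm y.
Proof. by rewrite -(rnormN y) rnormD. Qed.

Lemma rnormBD x y z : rnorm (x - z) <= rnorm (x - y) + rnorm (y - z).
Proof. by apply: le_trans (rnormD _ _); rewrite addrA subrK. Qed.

Lemma rnormZ a x : rnorm (a%:C *: x) = `|a| * rnorm x.
Proof.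
apply: complexI; rewrite -rnormE normrZ rnormE rmorphM/=; congr (_ * _).
by rewrite normc_def/= expr0n addr0 sqrtr_sqr.
Qed.

Lemma ler_rnorm_dist x y : `|rnorm x - rnorm y| <= rnorm (x - y).
Proof.
rewrite ler_norml; apply/andP; split.
  have := rnormD (y - x) x; rewrite subrK (rnormBC y x); lra.
have := rnormD (x - y) y; rewrite subrK; lra.
Qed.

Lemma cvg_rnormP (T : Type) (F : set_system T) (f : T -> X) (l : X) :
  Filter F ->
  f @ F --> l <-> forall e, 0 < e -> \forall t \near F, rnorm (l - f t) < e.
Proof.
move=> FF; split.
  move=> /cvgrPdist_lt h e e0; have := h e%:C; rewrite ltcR => /(_ e0).
  by apply: filterS => t; rewrite rnormE ltcR.
move=> h; apply/cvgrPdist_lt => e; rewrite ltcE => /andP[/= /eqP ei er].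
have -> : e = (complex.Re e)%:C by move: ei; case: (e) => ? ? /= ->.
have := h _ er; apply: filterS => t.
by rewrite rnormE ltcR.
Qed.

End RealNorm.

Section Continuity.
Context {R : realType} {X : normedModType R[i]}.
Implicit Types (D : set R) (u : R -> X) (f : R -> R) (a b t s e : R).

Lemma within_continuousP D u : {within D, continuous u} <->
  forall t, D t -> forall e, 0 < e -> exists2 d, 0 < d &
    forall s, D s -> `|s - t| < d -> rnorm (u s - u t) < e.
Proof.
rewrite subspace_continuousP; split=> [h t Dt e e0|h t Dt].
  have /cvg_rnormP/(_ _ e0) := h t Dt.
  rewrite near_withinE => /nbhs_ballP[d /= d0 H]; exists d => // s Ds st.
  by rewrite rnormBC; apply: H => //=; rewrite /ball/= distrC.
apply/cvg_rnormP => e e0; have [d d0 H] := h t Dt e e0.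
rewrite near_withinE; apply/nbhs_ballP; exists d => //= s.
by rewrite /ball/= => st Ds; rewrite rnormBC; apply: H; rewrite // distrC.
Qed.

Lemma within_continuousRP D f : {within D, continuous f} <->
  forall t, D t -> forall e, 0 < e -> exists2 d, 0 < d &
    forall s, D s -> `|s - t| < d -> `|f s - f t| < e.
Proof.
rewrite subspace_continuousP; split=> [h t Dt e e0|h t Dt].
  have /cvgrPdist_lt/(_ _ e0) := h t Dt.
  rewrite near_withinE => /nbhs_ballP[d /= d0 H]; exists d => // s Ds st.
  by rewrite distrC; apply: H => //=; rewrite /ball/= distrC.
apply/cvgrPdist_lt => e e0; have [d d0 H] := h t Dt e e0.
rewrite near_withinE; apply/nbhs_ballP; exists d => //= s.
by rewrite /ball/= => st Ds; rewrite distrC; apply: H; rewrite // distrC.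
Qed.

Lemma within_continuous_rnorm D u : {within D, continuous u} ->
  {within D, continuous (fun t => rnorm (u t))}.
Proof.
move=> /within_continuousP h; apply/within_continuousRP => t Dt e e0.
have [d d0 H] := h t Dt e e0; exists d => // s Ds st.
by apply: le_lt_trans (ler_rnorm_dist _ _) _; exact: H.
Qed.

Lemma uniformly_continuous_itv a b u : {within `[a, b], continuous u} ->
  forall e, 0 < e -> exists2 d, 0 < d & forall s t, a <= s <= b -> a <= t <= b ->
    `|s - t| < d -> rnorm (u s - u t) < e.
Proof.
move=> /within_continuousP cu e e0.
have /compact_near_coveringP := @segment_compact R a b.
move=> /(_ R 0^'+ (fun d t => a <= t <= b -> forall s, a <= s <= b ->
  `|s - t| < d -> rnorm (u s - u t) < e)) h.
have : \forall d \near 0^'+, `[a, b] `<=` (fun t => a <= t <= b ->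
    forall s, a <= s <= b -> `|s - t| < d -> rnorm (u s - u t) < e).
  apply: h => t abt.
  have e2 : 0 < e / 2 by lra.
  have [d d0 H] := cu t abt _ e2.
  exists ([set s | `|s - t| < d / 2], [set d' | d' < d / 2]) => /=.
    split.
      apply/nbhs_ballP; exists (d / 2) => /=; first by lra.
      by move=> s; rewrite /ball/= distrC.
    by apply: nbhs_right_lt; lra.
  move=> [s d']/= [st dd'] sab s' s'ab s's.
  have h1 : rnorm (u s - u t) < e / 2.
    by apply: H; [rewrite /= in_itv|lra].
  have h2 : rnorm (u s' - u t) < e / 2.
    apply: H; first by rewrite /= in_itv.
    have := ler_distD s s' t; lra.
  by have := rnormBD (u s') (u t) (u s); rewrite (rnormBC (u t)); lra.
move=> /(filterI (nbhs_right_gt 0))/filter_ex[d [d0 H]].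
exists d => // s t sab tab st.
by apply: (H t) => //; rewrite /= in_itv.
Qed.

Lemma bounded_on_itv a b u : {within `[a, b], continuous u} ->
  exists2 K, 0 <= K & forall t, a <= t <= b -> rnorm (u t) <= K.
Proof.
move=> cu; case: (leP a b) => ab; last first.
  exists 0 => // t /andP[at_ tb]; have := le_trans at_ tb.
  by rewrite leNgt ab.
have [c _ hc] := EVT_max ab (within_continuous_rnorm cu).
exists (rnorm (u c)); first exact: rnorm_ge0.
by move=> t tab; apply: hc; rewrite in_itv.
Qed.

End Continuity.

(** * The Bochner integral *)

Section ExtendedReals.
Context {R : realType}.
Local Open Scope ereal_scope.

Lemma cvge0P (T : Type) (F : set_system T) (u : T -> \bar R) : Filter F ->
  (\forall t \near F, 0 <= u t) ->
  u @ F --> 0 <-> forall e : R, (0 < e)%R -> \forall t \near F, u t <= e%:E.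
Proof.
move=> FF u0; split=> [h e e0|h].
  have : nbhs (0 : \bar R) [set y | y < e%:E].
    by apply: open_ereal_lt'; rewrite lte_fin.
  move=> /h; rewrite /= nbhs_filterE/=; apply: filterS => t; exact: ltW.
apply: cvg_EFin.
  near=> t; rewrite ge0_fin_numE; last by near: t.
  by apply: (@le_lt_trans _ _ 1%:E); [near: t; exact: h|rewrite ltry].
apply/cvgrPdist_le => e e0; near=> t.
rewrite sub0r normrN /=.
have ut0 : 0 <= u t by near: t.
have ute : u t <= e%:E by near: t; exact: h.
rewrite ger0_norm ?fine_ge0// -lee_fin fineK//.
by rewrite ge0_fin_numE// (le_lt_trans ute) ?ltry.
Unshelve. all: by end_near. Qed.

(** The integral of a nonnegative function is a supremum over the simple
    functions below it, so that it is monotone on all functions, measurable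
    or not. *)
Lemma ge0_le_integral_any d (T : measurableType d)
    (mu : {measure set T -> \bar R}) (D : set T) (f h : T -> \bar R) :
  (forall x, D x -> 0 <= f x) -> (forall x, D x -> f x <= h x) ->
  \int[mu]_(x in D) f x <= \int[mu]_(x in D) h x.
Proof.
move=> f0 fh; have h0 x : D x -> 0 <= h x.
  by move=> Dx; exact: le_trans (f0 x Dx) (fh x Dx).
rewrite !ge0_integralE//; apply: ub_ereal_sup => _ [k /= kf <-].
apply: ereal_sup_ubound; exists k => // x; apply: le_trans (kf x) _.
rewrite /patch; case: ifPn => // xD; apply: fh; exact: set_mem.
Qed.

End ExtendedReals.

Section SimpleFunctions.
Context {d : measure_display} {T : measurableType d} {R : realType}.
Context {X : normedModType R[i]} (mu : {measure set T -> \bar R}).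
Implicit Types (s : seq (set T * X)) (D B : set T) (w : T -> X) (y : X) (t : T).

Definition measurable_pieces D s := forall c, c \in s ->
  [/\ measurable c.1, c.1 `<=` D & (mu c.1 < +oo)%E].

Lemma measurable_pieces_cons D c s : measurable_pieces D (c :: s) ->
  [/\ measurable c.1, c.1 `<=` D & (mu c.1 < +oo)%E] /\ measurable_pieces D s.
Proof.
by move=> h; split=> [|c' c's]; apply: h; rewrite inE ?eqxx// c's orbT.
Qed.

Lemma simple_eval_nil t : simple_eval ([::] : seq (set T * X)) t = 0.
Proof. by rewrite /simple_eval big_nil. Qed.

Lemma simple_eval_cons c s t : simple_eval (c :: s) t =
  (if t \in c.1 then c.2 else 0) + simple_eval s t :> X.
Proof.
rewrite /simple_eval big_cons indicE; case: ifP => _; congr (_ + _).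
  by rewrite scale1r.
by rewrite scale0r.
Qed.

Lemma simple_eval_out D s t : measurable_pieces D s -> ~ D t ->
  simple_eval s t = 0.
Proof.
elim: s => [|c s IH]; first by rewrite simple_eval_nil.
move=> /measurable_pieces_cons[[_ cD _] hs] Dt; rewrite simple_eval_cons IH// addr0.
by case: ifPn => // /set_mem/cD.
Qed.

(** As [X] need not be separable, the measurability of a vector valued function is
    carried by its distances to fixed vectors; each piece of the simple function
    shifts the fixed vector on that piece. *)
Lemma measurable_rnorm_sub_simple D w s : measurable D ->
  (forall y, measurable_fun D (fun t => rnorm (w t - y))) ->
  (forall c, c \in s -> measurable c.1) ->
  forall y, measurable_fun D (fun t => rnorm (w t - y - simple_eval s t)).
Proof.
move=> mD mw; elim: s => [|c s IH] ms y.
  under eq_fun do rewrite simple_eval_nil subr0.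
  exact: mw.
have mc : measurable c.1 by apply: ms; rewrite inE eqxx.
have {}IH : forall y, measurable_fun D (fun t => rnorm (w t - y - simple_eval s t)).
  by apply: IH => c' c's; apply: ms; rewrite inE c's orbT.
rewrite (_ : (fun t => _) = (fun t => \1_(c.1) t * rnorm (w t - (y + c.2) - simple_eval s t)
  + \1_(~` c.1) t * rnorm (w t - y - simple_eval s t))); last first.
  apply/funext => t; rewrite simple_eval_cons !indicE in_setC.
  case: (t \in c.1); rewrite /= ?mul1r ?mul0r ?add0r ?addr0//.
  by congr rnorm; rewrite !opprD !addrA.
apply: measurable_funD; apply: measurable_funM; try exact: IH.
  exact: measurable_indic.
by apply: measurable_indic; exact: measurableC.
Qed.

Lemma measurable_rnorm_simple D s : measurable D ->
  (forall c, c \in s -> measurable c.1) ->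
  forall y, measurable_fun D (fun t => rnorm (y + simple_eval s t)).
Proof.
move=> mD ms y.
rewrite (_ : (fun t => _) = (fun t => rnorm ((0 : X) - y - simple_eval s t))).
  by apply: (@measurable_rnorm_sub_simple D (cst 0)) => // z;
    exact: (@measurable_cst _ _ T _ D (rnorm ((0 : X) - z))).
by apply/funext => t; rewrite sub0r -opprD rnormN.
Qed.

Lemma fine_measureID A B : measurable A -> measurable B -> (mu B < +oo)%E ->
  fine (mu B) = fine (mu (B `&` A)) + fine (mu (B `\` A)).
Proof.
move=> mA mB Boo.
have fI : (mu (B `&` A) < +oo)%E.
  by apply: le_lt_trans Boo; apply: le_measure; rewrite ?inE//; exact: measurableI.
have fD : (mu (B `\` A) < +oo)%E.
  by apply: le_lt_trans Boo; apply: le_measure; rewrite ?inE//; exact: measurableD.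
rewrite -fineD ?ge0_fin_numE//; congr fine.
rewrite -measureU; first by rewrite setUIDK.
- exact: measurableI.
- exact: measurableD.
- by apply/seteqP; split=> // t [[_ ?] [_ ?]].
Qed.

(** Splitting [B] along the first piece reduces the number of overlapping
    pieces; [y] is the constant value that has been collected on [B]. *)
Lemma simple_integral_cap_le s : (forall c, c \in s -> measurable c.1) ->
  forall B y, measurable B -> (mu B < +oo)%E ->
  ((rnorm ((fine (mu B))%:C *: y
     + \sum_(c <- s) (fine (mu (B `&` c.1)))%:C *: c.2))%:E
   <= \int[mu]_(t in B) (rnorm (y + simple_eval s t))%:E)%E.
Proof.
elim: s => [|c s IH] ms B y mB Boo.
  rewrite big_nil addr0 rnormZ ger0_norm ?fine_ge0//.
  rewrite (eq_integral (cst (rnorm y)%:E)); last first.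
    by move=> t _; rewrite simple_eval_nil addr0.
  by rewrite integral_cst// EFinM fineK ?ge0_fin_numE// muleC.
have mc : measurable c.1 by apply: ms; rewrite inE eqxx.
have ms' c' : c' \in s -> measurable c'.1.
  by move=> c's; apply: ms; rewrite inE c's orbT.
have {}IH := IH ms'.
have mI := measurableI _ _ mB mc.
have mDf := measurableD mB mc.
have fI : (mu (B `&` c.1) < +oo)%E.
  by apply: le_lt_trans Boo; apply: le_measure; rewrite ?inE.
have fD : (mu (B `\` c.1) < +oo)%E.
  by apply: le_lt_trans Boo; apply: le_measure; rewrite ?inE.
rewrite -{3}(setUIDK B c.1) ge0_integral_setU//; last 3 first.
- rewrite setUIDK; apply/measurable_EFinP.
  exact: measurable_rnorm_simple.
- by move=> t _; rewrite lee_fin rnorm_ge0.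
- apply/disj_setPS => t [[_ ?] [_ ?]]; contradiction.
have -> : (\int[mu]_(t in B `&` c.1) (rnorm (y + simple_eval (c :: s) t))%:E =
    \int[mu]_(t in B `&` c.1) (rnorm ((y + c.2) + simple_eval s t))%:E)%E.
  apply: eq_integral => t; rewrite inE => -[_ ct].
  by rewrite simple_eval_cons mem_set// addrA.
have -> : (\int[mu]_(t in B `\` c.1) (rnorm (y + simple_eval (c :: s) t))%:E =
    \int[mu]_(t in B `\` c.1) (rnorm (y + simple_eval s t))%:E)%E.
  apply: eq_integral => t; rewrite inE => -[_ ct].
  by rewrite simple_eval_cons memNset// add0r.
apply: le_trans (leeD (IH _ _ mI fI) (IH _ _ mDf fD)).
rewrite -EFinD lee_fin; apply: le_trans (rnormD _ _).
rewrite le_eqVlt; apply/orP; left; apply/eqP; congr rnorm.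
rewrite big_cons (fine_measureID mc mB Boo) rmorphD/= scalerDl.
have -> : \sum_(j <- s) (fine (mu (B `&` j.1)))%:C *: j.2 =
    \sum_(j <- s) (fine (mu (B `&` c.1 `&` j.1)))%:C *: j.2 +
    \sum_(j <- s) (fine (mu ((B `\` c.1) `&` j.1)))%:C *: j.2.
  rewrite -big_split/= [LHS]big_seq [RHS]big_seq; apply: eq_bigr => j js.
  have mj := ms' _ js.
  rewrite (@fine_measureID c.1 (B `&` j.1))//.
  - by rewrite rmorphD/= scalerDl !setDE (setIAC B j.1 c.1) (setIAC B j.1).
  - exact: measurableI.
  - apply: le_lt_trans Boo; apply: le_measure; rewrite ?inE//; exact: measurableI.
by rewrite scalerDr addrACA -[RHS]addrA; congr (_ + _); rewrite addrCA.
Qed.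

Lemma simple_integral_le D s : measurable D -> measurable_pieces D s ->
  ((rnorm (simple_integral mu s))%:E
    <= \int[mu]_(t in D) (rnorm (simple_eval s t))%:E)%E.
Proof.
move=> mD hs.
have [B [mB BD Boo sB]] : exists B, [/\ measurable B, B `<=` D, (mu B < +oo)%E &
    forall c, c \in s -> c.1 `<=` B].
  elim: s hs => [|c s IH] /=.
    by exists set0; split=> //; rewrite measure0.
  move=> /measurable_pieces_cons[[mc cD coo] /IH[B [mB BD Boo sB]]].
  exists (c.1 `|` B); split.
  - exact: measurableU.
  - by rewrite subUset.
  - apply: le_lt_trans (measureU2 _ mc mB) _; exact: lte_add_pinfty.
  - move=> c'; rewrite inE => /orP[/eqP ->|c's]; first exact: subsetUl.
    exact: subset_trans (sB _ c's) (@subsetUr _ _ _).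
have ms c : c \in s -> measurable c.1 by move=> /hs[].
have := simple_integral_cap_le ms (0 : X) mB Boo.
rewrite scaler0 add0r; under eq_integral do rewrite add0r.
have -> : \sum_(c <- s) (fine (mu (B `&` c.1)))%:C *: c.2 = simple_integral mu s.
  rewrite /simple_integral big_seq [RHS]big_seq; apply: eq_bigr => c cs.
  by rewrite (setIidr (sB _ cs)).
move=> /le_trans; apply; apply: ge0_subset_integral => //.
- apply/measurable_EFinP; under eq_fun do rewrite -[simple_eval _ _]add0r.
  exact: measurable_rnorm_simple.
- by move=> t _; rewrite lee_fin rnorm_ge0.
Qed.

Let opp_pieces s : seq (set T * X) := [seq (c.1, - c.2) | c <- s].

Lemma simple_integral_dist_le D s s' : measurable D ->
  measurable_pieces D s -> measurable_pieces D s' ->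
  ((rnorm (simple_integral mu s - simple_integral mu s'))%:E
    <= \int[mu]_(t in D) (rnorm (simple_eval s t - simple_eval s' t))%:E)%E.
Proof.
move=> mD hs hs'.
have h : measurable_pieces D (s ++ opp_pieces s').
  by move=> c; rewrite mem_cat => /orP[/hs//|/mapP[c' /hs' ? ->]].
have := simple_integral_le mD h.
rewrite /simple_integral /simple_eval big_cat/= big_map/=.
under [X in rnorm (_ + X)]eq_bigr do rewrite scalerN.
rewrite sumrN; congr (_ <= _)%E; apply: eq_integral => t _.
rewrite big_cat/= big_map/=.
under [X in rnorm (_ + X)]eq_bigr do rewrite scalerN.
by rewrite sumrN.
Qed.

End SimpleFunctions.

Section Completeness.
Context {R : realType} {X : completeNormedModType R[i]}.

Lemma rnorm_cauchy_cvg (x : nat -> X) :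
  (forall e : R, 0 < e -> exists N, forall m n, (N <= m)%N -> (N <= n)%N ->
    rnorm (x m - x n) < e) ->
  exists l : X, x @ \oo --> l.
Proof.
move=> h; suff /cvg_ex[l xl] : [cvg x @ \oo in X] by exists l.
apply/cauchy_cvgP/cauchy_exP => e; rewrite ltcE => /andP[/= /eqP ei er].
have -> : e = (complex.Re e)%:C by move: ei; case: (e) => ? ? /= ->.
have [N hN] := h _ er; exists (x N).
near=> n; rewrite -ball_normE/= rnormE ltcR; apply: hN => //.
by near: n; exact: nbhs_infty_ge.
Unshelve. all: by end_near.
Qed.

End Completeness.

Section Bochner.
Context {d : measure_display} {T : measurableType d} {R : realType}.
Context {X : normedModType R[i]} (mu : {measure set T -> \bar R}).
Implicit Types (D : set T) (f g : T -> X) (v w : X).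

Lemma ge0_integral_triangle D (a b c : T -> R) : measurable D ->
  measurable_fun D b -> measurable_fun D c ->
  (forall t, D t -> 0 <= a t) ->
  (forall t, D t -> 0 <= b t) -> (forall t, D t -> 0 <= c t) ->
  (forall t, D t -> a t <= b t + c t) ->
  (\int[mu]_(t in D) (a t)%:E
     <= \int[mu]_(t in D) (b t)%:E + \int[mu]_(t in D) (c t)%:E)%E.
Proof.
move=> mD mb mc a0 b0 c0 abc; rewrite -ge0_integralD//.
- by apply: ge0_le_integral_any => t Dt; rewrite -?EFinD lee_fin; [exact: a0|exact: abc].
- exact/measurable_EFinP.
- exact/measurable_EFinP.
Qed.

(** Comparing two integrals directly makes their uniqueness a special case, and
    spares the linearity of the integral. *)
Lemma bochner_dist_le D f g v w : measurable D ->
  measurable_fun D (fun t => rnorm (f t - g t)) ->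
  bochner_integral mu D f v -> bochner_integral mu D g w ->
  ((rnorm (v - w))%:E <= \int[mu]_(t in D) (rnorm (f t - g t))%:E)%E.
Proof.
move=> mD mfg [s [hs ms is_ cs]] [s' [hs' ms' is' cs']].
apply/lee_addgt0Pr => e e0.
have e4 : 0 < e / 4 by lra.
have ge0 (h : T -> X) : (0 <= \int[mu]_(t in D) (rnorm (h t))%:E)%E.
  by apply: integral_ge0 => t _; rewrite lee_fin rnorm_ge0.
have small (a : nat -> \bar R) : (forall n, 0 <= a n)%E ->
    a @ \oo --> 0%E -> \forall n \near \oo, (a n <= (e / 4)%:E)%E.
  by move=> a0 /cvge0P; apply => //; exact: nearW.
have h1 := small _ (fun n => ge0 _) is_.
have h2 := small _ (fun n => ge0 _) is'.
have /cvg_rnormP/(_ _ e4) h3 := cs.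
have /cvg_rnormP/(_ _ e4) h4 := cs'.
have [n [[n1 n2] [n3 n4]]] := filter_ex (filterI (filterI h1 h2) (filterI h3 h4)).
apply: (@le_trans _ _ ((e / 4 + e / 4)%:E
    + (rnorm (simple_integral mu (s n) - simple_integral mu (s' n)))%:E)%E).
  rewrite -EFinD lee_fin.
  have := rnormBD v (simple_integral mu (s n)) w.
  have := rnormBD (simple_integral mu (s n)) (simple_integral mu (s' n)) w.
  by rewrite rnormBC in n4; lra.
rewrite (_ : e%:E = (e / 4 + e / 4)%:E + (e / 4 + e / 4)%:E)%E; last first.
  by rewrite -EFinD; congr (_%:E); field.
rewrite [leRHS]addeCA; apply: (@leeD2l R).
apply: le_trans (simple_integral_dist_le mD (hs n) (hs' n)) _.
apply: (@le_trans _ _ (\int[mu]_(t in D) (rnorm (f t - simple_eval (s n) t))%:E +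
    (\int[mu]_(t in D) (rnorm (f t - g t))%:E +
     \int[mu]_(t in D) (rnorm (g t - simple_eval (s' n) t))%:E))%E); last first.
  rewrite addeCA; apply: leeD2l; rewrite EFinD; exact: leeD.
rewrite -(@ge0_integralD _ _ _ _ D mD (fun t => (rnorm (f t - g t))%:E)); last 4 first.
- by move=> t _; rewrite lee_fin rnorm_ge0.
- exact/measurable_EFinP.
- by move=> t _; rewrite lee_fin rnorm_ge0.
- exact/measurable_EFinP.
under [X in (_ <= _ + X)%E]eq_integral do rewrite -EFinD.
apply: ge0_integral_triangle => //.
- exact: measurable_funD.
- by move=> t _; exact: rnorm_ge0.
- by move=> t _; exact: rnorm_ge0.
- by move=> t _; rewrite addr_ge0 ?rnorm_ge0.
move=> t _; have := rnormBD (simple_eval (s n) t) (f t) (simple_eval (s' n) t).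
have := rnormBD (f t) (g t) (simple_eval (s' n) t).
by rewrite (rnormBC (f t) (simple_eval (s n) t)); lra.
Qed.

Lemma bochner_integral0 D : measurable D ->
  bochner_integral mu D (cst 0 : T -> X) 0.
Proof.
move=> mD; exists (fun=> [::]); split=> //.
- move=> n; rewrite (_ : (fun t => _) = cst 0); first exact: measurable_cst.
  by apply/funext => t; rewrite simple_eval_nil subr0 rnorm0.
- rewrite (_ : (fun n => _) = cst 0%E); first exact: cvg_cst.
  apply/funext => n; rewrite /= integral0_eq// => t _.
  by rewrite simple_eval_nil subr0 rnorm0.
- by rewrite /simple_integral big_nil; exact: cvg_cst.
Qed.

Lemma bochner_rnorm_le D f v : measurable D ->
  measurable_fun D (fun t => rnorm (f t)) -> bochner_integral mu D f v ->
  ((rnorm v)%:E <= \int[mu]_(t in D) (rnorm (f t))%:E)%E.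
Proof.
move=> mD mf hf; have := bochner_dist_le mD _ hf (bochner_integral0 mD).
rewrite subr0; under eq_fun do rewrite subr0.
by under eq_integral do rewrite subr0; apply.
Qed.

Lemma eq_bochner_integral D f g v : (forall t, D t -> f t = g t) ->
  bochner_integral mu D f v -> bochner_integral mu D g v.
Proof.
move=> fg [s [h1 h2 h3 h4]]; exists s; split=> //.
  move=> n; apply: eq_measurable_fun (h2 n) => t /set_mem Dt.
  by rewrite fg.
rewrite (_ : (fun n => _) = (fun n => \int[mu]_(t in D)
  (rnorm (f t - simple_eval (s n) t))%:E)%E)//.
by apply/funext => n; apply: eq_integral => t /set_mem Dt; rewrite fg.
Qed.

Lemma bochner_extend D D' f v : measurable D -> measurable D' -> D `<=` D' ->
  bochner_integral mu D f v ->
  bochner_integral mu D' (fun t => if t \in D then f t else 0) v.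
Proof.
move=> mD mD' DD' [s [h1 h2 h3 h4]]; exists s.
have E n : (fun t => rnorm ((if t \in D then f t else 0) - simple_eval (s n) t))
    = (fun t => rnorm (f t - simple_eval (s n) t)) \_ D.
  apply/funext => t; rewrite patchE; case: ifPn => // /negP tD.
  rewrite (simple_eval_out (h1 n)) ?subr0 ?rnorm0//.
  by move=> Dt; apply: tD; exact: mem_set.
split=> //.
- by move=> n c /h1[? ? ?]; split=> //; apply: subset_trans DD'.
- by move=> n; rewrite E; apply/measurable_restrict => //; rewrite (setIidr DD').
- rewrite (_ : (fun n => _) = (fun n => \int[mu]_(t in D)
    (rnorm (f t - simple_eval (s n) t))%:E)%E)//.
  apply/funext => n; rewrite [RHS](integral_mkcond D) [LHS]integral_mkcond.
  apply: eq_integral => t _; rewrite !patchE.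
  have := congr1 (fun h => h t) (E n); rewrite /= patchE => ->.
  case: ifPn => // tD'; case: ifPn => // tD; move/negP: tD'.
  by case; apply/mem_set/DD'/set_mem.
Qed.

(** Change of variables along a measure preserving map. *)
Lemma bochner_preimage (tau : T -> T) D f v :
  measurable_fun setT tau ->
  (forall A, measurable A -> mu (tau @^-1` A) = mu A) -> measurable D ->
  bochner_integral mu D f v ->
  bochner_integral mu (tau @^-1` D) (f \o tau) v.
Proof.
move=> mtau htau mD [s [h1 h2 h3 h4]].
have mpre A : measurable A -> measurable (tau @^-1` A).
  by move=> mA; rewrite -[X in measurable X]setTI; exact: mtau.
pose s' n := [seq (tau @^-1` c.1, c.2) | c <- s n].
have E n t : simple_eval (s' n) t = simple_eval (s n) (tau t).
  rewrite /simple_eval /s' big_map; apply: eq_bigr => c _ /=.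
  by rewrite !indicE; congr ((_)%:R%:C *: _); rewrite /in_mem/= /in_set/=.
exists s'; split.
- move=> n _ /mapP[c /h1[mc cD coo] ->] /=; split; first exact: mpre.
    exact: preimage_subset.
  by rewrite htau.
- move=> n; under eq_fun do rewrite E.
  apply: (@measurable_comp _ _ _ _ _ _ D (fun t => rnorm (f t - simple_eval (s n) t)) _ tau) => //.
    exact: image_preimage_subset.
  by apply: measurable_funTS.
- rewrite (_ : (fun n => _) = (fun n => \int[mu]_(t in D)
    (rnorm (f t - simple_eval (s n) t))%:E)%E)//.
  apply/funext => n; under eq_integral do rewrite E.
  rewrite [RHS](@eq_measure_integral _ _ _ D (pushforward mu tau)); last first.
    by move=> A mA _; rewrite -[LHS](htau _ mA).
  rewrite [RHS]ge0_integral_pushforward//.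
  - exact/measurable_EFinP.
  - by move=> t _; rewrite lee_fin rnorm_ge0.
- rewrite (_ : (fun n => _) = (fun n => simple_integral mu (s n)))//.
  apply/funext => n; rewrite /simple_integral big_map big_seq [RHS]big_seq.
  by apply: eq_bigr => c /h1[mc _ _]/=; rewrite htau.
Qed.

End Bochner.

Section Blocks.
Context {R : realType}.
Implicit Types (x h : R) (i j : nat).

Lemma block_exists x h : 0 < h -> 0 <= x ->
  exists j, j%:R * h <= x < j.+1%:R * h.
Proof.
move=> h0 x0; exists (Num.truncn (x / h)).
by rewrite -ler_pdivlMr// -ltr_pdivrMr// truncn_itv// divr_ge0// ltW.
Qed.

Lemma block_le x h i j : 0 < h -> i%:R * h <= x -> x < j.+1%:R * h -> (i <= j)%N.
Proof.
move=> h0 ix xj; rewrite -ltnS -(ltr_nat R) -(ltr_pM2r h0).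
exact: le_lt_trans xj.
Qed.

Lemma block_uniq x h i j : 0 < h -> i%:R * h <= x < i.+1%:R * h ->
  j%:R * h <= x < j.+1%:R * h -> i = j.
Proof.
move=> h0 /andP[ix xi] /andP[jx xj]; apply/eqP; rewrite eqn_leq.
by rewrite (block_le h0 ix xj) (block_le h0 jx xi).
Qed.

End Blocks.

Section ScalarMultiple.
Import HBNNSimple.
Context {d : measure_display} {T : measurableType d} {R : realType}.
Context {X : normedModType R[i]} (mu : {measure set T -> \bar R}).

(** The simple functions increasing to [c], multiplied by [y]. Their value [0] is
    dropped, since the corresponding level set may have infinite measure. *)
Lemma bochner_scalar (D : set T) (c : T -> R) (I : R) (y : X) : measurable D ->
  measurable_fun D c -> (forall t, D t -> 0 <= c t) ->
  (\int[mu]_(t in D) (c t)%:E)%E = I%:E ->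
  bochner_integral mu D (fun t => (c t)%:C *: y) (I%:C *: y).
Proof.
move=> mD mc c0 cI.
have mce : measurable_fun D (EFin \o c) by exact/measurable_EFinP.
pose h := nnsfun_approx mD mce.
have hle n t : D t -> h n t <= c t.
  move=> Dt; rewrite -lee_fin nnsfun_approxE.
  by apply: le_approx => // x Dx; rewrite lee_fin c0.
pose rs n := [seq a <- finmap.enum_fset (fset_set (range (h n))) | a != 0].
have urs n : uniq (rs n) by rewrite filter_uniq// finmap.fset_uniq.
have rs0 n a : a \in rs n -> 0 < a.
  rewrite mem_filter => /andP[an]; rewrite in_fset_set// inE => -[t _ ta].
  by rewrite lt_def an -ta/= fun_ge0.
pose A n a := D `&` (h n @^-1` [set a]).
have mA n a : measurable (A n a) by apply: measurableI.
have hE n t (V : nmodType) (F : R -> V) : D t -> F 0 = 0 ->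
    \sum_(a <- rs n) (if t \in A n a then F a else 0) = F (h n t).
  move=> Dt F0; have [e|e] := eqVneq (h n t) 0.
    rewrite big1_seq ?e// => a /andP[_ /rs0 a0].
    rewrite memNset// => -[_ /= hta].
    by move: a0; rewrite -hta e ltxx.
  have hrs : h n t \in rs n.
    by rewrite mem_filter e in_fset_set// inE; exists t.
  rewrite (bigD1_seq (h n t))//= big1 ?addr0; last first.
    move=> a an; rewrite memNset// => -[_ /= hta].
    by move: an; rewrite -hta eqxx.
  by rewrite mem_set.
have Afin n a : a \in rs n -> (mu (A n a) < +oo)%E.
  move=> /rs0 a0.
  have : (a%:E * mu (A n a) <= I%:E)%E.
    rewrite -cI -integral_cst//; apply: (@le_trans _ _ (\int[mu]_(t in A n a) (c t)%:E)%E).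
      apply: ge0_le_integral_any; first by move=> t _; rewrite /= lee_fin ltW.
      by move=> t [Dt /= hta]; rewrite lee_fin -hta hle.
    by apply: ge0_subset_integral => // t [].
  case: (mu (A n a)) => [x|/=|]; rewrite ?ltry//.
  by rewrite gt0_muley ?lte_fin.
pose s n : seq (set T * X) := [seq (A n a, a%:C *: y) | a <- rs n].
have sE n t : D t -> simple_eval (s n) t = (h n t)%:C *: y.
  move=> Dt; rewrite /simple_eval big_map/=.
  rewrite -(hE n t X (fun a => a%:C *: y) Dt) ?scale0r//.
  by apply: eq_bigr => a _; rewrite indicE; case: ifP; rewrite ?scale1r ?scale0r.
have mh n : measurable_fun D (h n) by apply: measurable_funTS.
pose In n := fine (\int[mu]_(t in D) (h n t)%:E)%E.
have h0 n t : 0 <= h n t by exact: fun_ge0.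
have Inoo n : (\int[mu]_(t in D) (h n t)%:E = (In n)%:E)%E.
  rewrite fineK// ge0_fin_numE.
    apply: (@le_lt_trans _ _ I%:E); last by rewrite ltry.
    rewrite -cI; apply: ge0_le_integral_any => t Dt; rewrite lee_fin ?h0//.
    exact: hle.
  by apply: integral_ge0 => t _; rewrite lee_fin.
have SI n : simple_integral mu (s n) = (In n)%:C *: y.
  rewrite /simple_integral big_map/=.
  under eq_bigr do rewrite scalerA -rmorphM/=.
  rewrite -scaler_suml -rmorph_sum/=; congr (_%:C *: _).
  apply: EFin_inj; rewrite -Inoo -sumEFin.
  transitivity (\int[mu]_(t in D) \sum_(a <- rs n) (`|a| * \1_(A n a) t)%:E)%E.
    rewrite ge0_integral_sum//; last first.
      move=> a; apply/measurable_EFinP; apply: measurable_funM.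
        exact: measurable_cst.
      exact: measurable_indic.
    rewrite [LHS]big_seq [RHS]big_seq; apply: eq_bigr => a ars.
    under eq_integral do rewrite EFinM.
    rewrite ge0_integralZl_EFin//; last first.
      by apply/measurable_EFinP; exact: measurable_indic.
    rewrite integral_indic// (setIidl (@subIsetl _ _ _)) (gtr0_norm (rs0 _ _ ars)).
    have /fineK <- : mu (A n a) \is a fin_num.
      by rewrite ge0_fin_numE// (Afin _ _ ars).
    by rewrite /= -EFinM mulrC.
  apply: eq_integral => t /set_mem Dt; rewrite sumEFin; congr _%:E.
  rewrite -(hE n t R id Dt)//; rewrite [LHS]big_seq [RHS]big_seq.
  apply: eq_bigr => a ars; rewrite (gtr0_norm (rs0 _ _ ars)) indicE.
  by case: ifP; rewrite ?mulr1 ?mulr0.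
have cvgI : In @ \oo --> I.
  have : (\int[mu]_(t in D) (h n t)%:E)%E @[n --> \oo] --> I%:E.
    rewrite -cI (eq_integral (fun t => limn (fun n => (h n t)%:E))).
      apply: cvg_monotone_convergence => //.
      - by move=> n; apply/measurable_EFinP.
      - by move=> n t _; rewrite lee_fin.
      - move=> t _ m n mn; rewrite lee_fin.
        exact: (lefP _ _ (nd_nnsfun_approx mD mce mn)).
    move=> t /set_mem Dt; apply/esym/cvg_lim => //.
    by apply: cvg_nnsfun_approx => // x Dx; rewrite lee_fin c0.
  by move/fine_cvg.
have J n : (\int[mu]_(t in D) (c t - h n t)%:E = (I - In n)%:E)%E.
  have : (\int[mu]_(t in D) (c t)%:E = \int[mu]_(t in D) (h n t)%:E
      + \int[mu]_(t in D) (c t - h n t)%:E)%E.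
    rewrite -ge0_integralD//.
    - by apply: eq_integral => t _; rewrite -EFinD addrC subrK.
    - by move=> t _; rewrite lee_fin.
    - by apply/measurable_EFinP.
    - by move=> t Dt; rewrite lee_fin subr_ge0 hle.
    - by apply/measurable_EFinP; exact: measurable_funB.
  rewrite cI Inoo; set j := integral _ _ _ => e.
  have : (I%:E - (In n)%:E = j)%E by rewrite e addeAC subee// add0e.
  by rewrite -EFinB => <-.
have fE n t : D t -> rnorm ((c t)%:C *: y - simple_eval (s n) t)
    = rnorm y * (c t - h n t).
  move=> Dt; rewrite sE// -scalerBl -rmorphB/= rnormZ ger0_norm 1?mulrC//.
  by rewrite subr_ge0 hle.
have small e : 0 < e -> \forall n \near \oo, `|I - In n| * rnorm y < e.
  move=> e0; have e1 : 0 < e / (rnorm y + 1).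
    by rewrite divr_gt0// ltr_wpDl// rnorm_ge0.
  have /cvgrPdist_lt/(_ _ e1) := cvgI; apply: filterS => n.
  rewrite ltr_pdivlMr ?ltr_wpDl ?rnorm_ge0//; apply: le_lt_trans.
  by apply: ler_wpM2l => //; rewrite lerDl.
exists s; split.
- by move=> n _ /mapP[a /Afin aoo ->] /=; split=> // t [].
- move=> n; apply: (@eq_measurable_fun _ _ _ _ D (fun t => rnorm y * (c t - h n t))).
    by move=> t /set_mem Dt; rewrite fE.
  by apply: measurable_funM; [exact: measurable_cst|exact: measurable_funB].
- apply/cvge0P.
    by apply: nearW => n; apply: integral_ge0 => t _; rewrite lee_fin rnorm_ge0.
  move=> e /small; apply: filterS => n ne.
  rewrite (eq_integral (fun t => (rnorm y)%:E * (c t - h n t)%:E)%E); last first.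
    by move=> t /set_mem Dt; rewrite fE// EFinM.
  rewrite ge0_integralZl_EFin ?rnorm_ge0// ?J.
  - by rewrite -EFinM lee_fin mulrC (le_trans _ (ltW ne))// ler_wpM2r ?rnorm_ge0// ler_norm.
  - by move=> t Dt; rewrite lee_fin subr_ge0 hle.
  - by apply/measurable_EFinP; exact: measurable_funB.
- apply/cvg_rnormP => e /small; apply: filterS => n.
  by rewrite SI -scalerBl -rmorphB/= rnormZ.
Qed.

End ScalarMultiple.

Section LebesgueBochner.
Context {R : realType} {X : completeNormedModType R[i]}.
Notation mu := (@lebesgue_measure R).
Implicit Types (a b c t : R) (w : R -> X).

Lemma lebesgue_measure_shift c (A : set R) : measurable A ->
  mu ((fun x => x - c) @^-1` A) = mu A.
Proof.
have mtau : measurable_fun [set: R] (fun x : R => x - c).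
  by apply: continuous_measurable_fun => x; apply: cvgB => //; exact: cvg_cst.
move=> mA.
have -> : mu A = pushforward mu ((fun x : R => x - c) : measurableTypeR R -> measurableTypeR R) A.
  apply: (@lebesgue_measure_unique R
    (pushforward mu ((fun x : R => x - c) : measurableTypeR R -> measurableTypeR R))) => //.
  move=> _ [[a b] _ <-] /=.
  transitivity (mu `]a + c, b + c]%classic); last first.
    rewrite /pushforward; congr (mu _).
    by apply/seteqP; split=> x /=; rewrite !in_itv/= ltrBrDr lerBlDr.
  rewrite !lebesgue_measure_itv/= !lte_fin ltrD2r.
  by case: ifP => // _; rewrite -!EFinB; congr (_%:E); ring.
by [].
Qed.

Lemma bochner_shift c a b (f : R -> X) v :
  bochner_integral mu `[a, b] f v ->
  bochner_integral mu `[a + c, b + c] (fun t => f (t - c)) v.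
Proof.
have -> : `[a + c, b + c]%classic = (fun x => x - c) @^-1` `[a, b]%classic.
  by apply/seteqP; split=> x /=; rewrite !in_itv/= lerBrDr lerBlDr.
move=> hf; apply: (@bochner_preimage _ _ _ _ mu (fun x : R => x - c) `[a, b]%classic f v) => //.
  by apply: continuous_measurable_fun => x; apply: cvgB => //; exact: cvg_cst.
exact: lebesgue_measure_shift.
Qed.

Lemma measurable_continuous_itv a b (f : R -> R) :
  {within `[a, b], continuous f} -> measurable_fun `[a, b] f.
Proof. by move=> cf; apply: subspace_continuous_measurable_fun. Qed.

(** The integral of a continuous function is the limit of its left Riemann
    sums; the right end point forms a piece of its own. *)
Lemma bochner_exists a b w : a <= b -> {within `[a, b], continuous w} ->
  exists v, bochner_integral mu `[a, b] w v.
Proof.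
move=> ab cw.
pose h n := (b - a) / n.+1%:R.
pose I n i := `[a + i%:R * h n, a + i.+1%:R * h n[%classic.
pose s n := ([set b], w b) ::
  [seq (I n i, w (a + i%:R * h n)) | i <- iota 0 n.+1].
have hs n : measurable_pieces mu `[a, b] (s n).
  have h0 : 0 <= h n by rewrite divr_ge0// subr_ge0.
  have hn : n.+1%:R * h n = b - a by rewrite /h mulrC divfK.
  move=> c; rewrite inE => /predU1P[->/=|/seq.mapP[i + ->]].
    by split; rewrite ?lebesgue_measure_set1// => t /= ->; rewrite /= in_itv/= lexx ab.
  rewrite mem_iota/= add0n => iln; split.
  - exact: measurable_itv.
  - move=> t; rewrite /I /= !in_itv/= => /andP[it ti].
    have i0 : 0 <= i%:R * h n by rewrite mulr_ge0.
    have i1 : i.+1%:R * h n <= n.+1%:R * h n by rewrite ler_wpM2r// ler_nat.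
    by apply/andP; split; lra.
  - rewrite /I lebesgue_measure_itv; case: ifP => _; last exact: ltry.
  by rewrite -EFinB ltry.
have approx e : 0 < e -> exists N, forall n, (N <= n)%N ->
    forall t, a <= t <= b -> rnorm (w t - simple_eval (s n) t) <= e.
  move=> e0; have [d d0 H] := uniformly_continuous_itv cw e0.
  have bd : 0 <= (b - a) / d by rewrite divr_ge0 ?subr_ge0// ltW.
  exists (Num.bound ((b - a) / d)) => n Nn t /andP[at_ tb].
  have hd : h n < d.
    rewrite ltr_pdivrMr// mulrC -ltr_pdivrMr//.
    apply: lt_le_trans (archi_boundP bd) _; rewrite ler_nat; exact: leqW.
  rewrite simple_eval_cons; have [tb'|tb'] := eqVneq t b.
    rewrite tb' mem_set// /simple_eval big_map big1_seq.
      by rewrite addr0 subrr rnorm0 ltW.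
    move=> i /andP[_]; rewrite mem_iota/= add0n => iln.
    rewrite indicE memNset ?scale0r// /I /= in_itv/= => /andP[_].
    have hn : n.+1%:R * h n = b - a by rewrite /h mulrC divfK.
    have h0 : 0 <= h n by rewrite divr_ge0// subr_ge0.
    have i1 : i.+1%:R * h n <= n.+1%:R * h n by rewrite ler_wpM2r// ler_nat.
    lra.
  have ltb : t < b by rewrite lt_neqAle tb' tb.
  have h0 : 0 < h n by rewrite divr_gt0// subr_gt0; lra.
  rewrite memNset; last by move=> /= e'; rewrite e' eqxx in tb'.
  rewrite add0r.
  have ta0 : 0 <= t - a by lra.
  have [j jt] := block_exists h0 ta0.
  have hn : n.+1%:R * h n = b - a by rewrite /h mulrC divfK.
  have jn : (j < n.+1)%N.
    by case/andP: (jt) => jt1 _; apply: (block_le h0 jt1); lra.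
  have -> : simple_eval [seq (I n i, w (a + i%:R * h n)) | i <- iota 0 n.+1] t
      = w (a + j%:R * h n).
    rewrite /simple_eval big_map (bigD1_seq j) ?mem_iota ?iota_uniq//=.
    rewrite indicE mem_set ?scale1r; last first.
      by rewrite /I /= in_itv/=; move: jt => /andP[? ?]; apply/andP; split; lra.
    rewrite big1 ?addr0// => i ij; rewrite indicE memNset ?scale0r//.
    rewrite /I /= in_itv/= => /andP[it ti]; move/eqP: ij; apply.
    by apply: (@block_uniq _ (t - a) (h n)) => //; apply/andP; split; lra.
  move/andP: jt => [jt tj]; apply/ltW/H; first by lra.
    have : 0 <= j%:R * h n by rewrite mulr_ge0// ltW.
    by move=> ?; apply/andP; split; lra.
  rewrite -natr1 mulrDl mul1r in tj.
  by rewrite ltr_norml; apply/andP; split; lra.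
have mw y : measurable_fun `[a, b] (fun t => rnorm (w t - y)).
  apply: (@measurable_continuous_itv a b (fun t => rnorm (w t - y))).
  apply: (@within_continuous_rnorm _ _ _ (fun t => w t - y)).
  apply: (@within_continuousB _ _ _ _ w (cst y)) => //.
  by apply: continuous_subspaceT => x; exact: cvg_cst.
have ms n (c' : set R * X) : c' \in s n -> measurable c'.1 by move=> /hs[].
have mws n : measurable_fun `[a, b] (fun t => rnorm (w t - simple_eval (s n) t)).
  apply: (@eq_measurable_fun _ _ _ _ _
    (fun t => rnorm (w t - 0 - simple_eval (s n) t))).
    by move=> t _; rewrite subr0.
  by apply: measurable_rnorm_sub_simple => //; exact: ms.
have Icst e : (\int[mu]_(t in `[a, b]) (cst e%:E t) = (e * (b - a))%:E)%E.
  rewrite integral_cst//= lebesgue_measure_itv/= lte_fin.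
  case: ltP => ba; first by rewrite -EFinB -EFinM.
  by rewrite mule0 (_ : b - a = 0) ?mulr0//; lra.
have int_le e : 0 < e -> exists N, forall n, (N <= n)%N ->
    (\int[mu]_(t in `[a, b]) (rnorm (w t - simple_eval (s n) t))%:E <= e%:E)%E.
  move=> e0; have e1 : 0 < e / (b - a + 1) by rewrite divr_gt0//; lra.
  have [N hN] := approx _ e1; exists N => n Nn.
  apply: (@le_trans _ _ (e / (b - a + 1) * (b - a))%:E).
    rewrite -Icst; apply: ge0_le_integral_any => t /=.
      by rewrite lee_fin rnorm_ge0.
    by rewrite in_itv/= lee_fin => tab; exact: hN.
  by rewrite lee_fin mulrAC ler_pdivrMr; nra.
have [v hv] : exists v : X, (fun n => simple_integral mu (s n)) @ \oo --> v.
  apply: rnorm_cauchy_cvg => e e0.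
  have e4 : 0 < e / 4 by lra.
  have [N hN] := int_le _ e4; exists N => m n Nm Nn.
  apply: (@le_lt_trans _ _ (e / 2)); last by lra.
  rewrite -lee_fin; apply: le_trans (simple_integral_dist_le _ (hs m) (hs n)) _ => //.
  apply: le_trans (ge0_integral_triangle mu _ (mws m) (mws n) _ _ _ _) _ => //.
  - by move=> t _; exact: rnorm_ge0.
  - by move=> t _; exact: rnorm_ge0.
  - by move=> t _; exact: rnorm_ge0.
  - move=> t _; have := rnormBD (simple_eval (s m) t) (w t) (simple_eval (s n) t).
    by rewrite (rnormBC _ (w t)).
  have -> : e / 2 = e / 4 + e / 4 by field.
  by rewrite EFinD; apply: leeD; exact: hN.
exists v; exists s; split=> //.
apply/cvge0P; first by apply: nearW => n; apply: integral_ge0 => t _; rewrite lee_fin rnorm_ge0.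
move=> e /int_le[N hN]; exists N => // n /= Nn; exact: hN.
Qed.

End LebesgueBochner.

(** * The solution operator starts at the identity *)

Section Laplace.
Context {R : realType} {X : normedModType R[i]}.
Notation mu := (@lebesgue_measure R).
Implicit Types (l t e : R) (x y : X).

Lemma measurable_expM l (D : set R) : measurable_fun D (fun t => expR (- l * t)).
Proof.
apply: measurable_funTS; apply: continuous_measurable_fun => t.
apply: continuous_comp; last exact: continuous_expR.
exact: mulrl_continuous.
Qed.

Lemma integral_expM l : 0 < l ->
  (\int[mu]_(t in `[0%R, +oo[) (expR (- l * t))%:E = (l^-1)%:E)%E.
Proof.
move=> l0; have := integral_exponential_pdf l0.
have -> : (\int[mu]_x (exponential_pdf l x)%:E
    = \int[mu]_(x in `[0%R, +oo[) (l%:E * (expR (- l * x))%:E))%E.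
  rewrite [RHS]integral_mkcond; apply: eq_integral => t _.
  by rewrite /exponential_pdf !patchE; case: ifP.
rewrite ge0_integralZl_EFin//; last 2 first.
- by apply/measurable_EFinP; exact: measurable_expM.
- exact: ltW.
set j := integral _ _ _.
have j0 : (0 <= j)%E by apply: integral_ge0 => t _; rewrite lee_fin expR_ge0.
case: j j0 => [j||]//= j0; last by rewrite gt0_muley ?lte_fin.
rewrite -EFinM => -[e]; congr _%:E.
have ln0 : l != 0 by rewrite gt_eqF.
by rewrite -[LHS](mulKf ln0) e mulr1.
Qed.

(** The densities [l * expR (- l * t)] have mass one and concentrate at [0]: up
    to [d] continuity applies, and beyond [d] the factor [expR (- l * d / 2)]
    splits off. *)
Lemma laplace_initial_value (w : R -> X) (K nu : R) (v : R -> X) :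
  {within `[0, +oo[, continuous w} -> (forall t, 0 <= t -> rnorm (w t) <= K) ->
  (forall l, nu < l -> bochner_integral mu `[0, +oo[
     (fun t => (expR (- l * t))%:C *: w t) (v l)) ->
  forall e, 0 < e -> exists L, forall l, L <= l ->
    rnorm (l%:C *: v l - w 0) <= e.
Proof.
move=> cw wK hv e e0.
have K0 : 0 <= K by apply: le_trans (rnorm_ge0 _) (wK 0 (lexx _)).
have e2 : 0 < e / 2 by lra.
have /within_continuousP/(_ 0 _ _ e2) := cw.
case; first by rewrite /= in_itv/= lexx.
move=> d d0 H.
(* the tail [4 K expR (- l d / 2)] is at most [8 K / (l d)] *)
exists (`|nu| + 1 + 16 * K / (d * e)) => l hl.
have q0 : 0 <= 16 * K / (d * e) by rewrite divr_ge0 ?mulr_ge0 ?(ltW d0) ?(ltW e0).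
have l0 : 0 < l by have := normr_ge0 nu; lra.
have nul : nu < l by have := ler_norm nu; lra.
have l20 : 0 < l / 2 by lra.
have mexp (s : R) : measurable_fun (`[0%R, +oo[%classic : set R) (fun t => expR (- s * t)).
  exact: measurable_expM.
have hw0 : bochner_integral mu `[0, +oo[
    (fun t => (expR (- l * t))%:C *: w 0) ((l^-1)%:C *: w 0).
  by apply: bochner_scalar => //; [exact: mexp|exact: integral_expM].
have dE t : rnorm ((expR (- l * t))%:C *: w t - (expR (- l * t))%:C *: w 0)
    = expR (- l * t) * rnorm (w t - w 0).
  by rewrite -scalerBr rnormZ ger0_norm// expR_ge0.
have mw : measurable_fun (`[0%R, +oo[%classic : set R) (fun t => rnorm (w t - w 0)).
  apply: subspace_continuous_measurable_fun => //.
  apply: (@within_continuous_rnorm _ _ _ (fun t => w t - w 0)).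
  apply: (@within_continuousB _ _ _ _ w (cst (w 0))) => //.
  by apply: continuous_subspaceT => x; exact: cvg_cst.
have mdiff : measurable_fun (`[0%R, +oo[%classic : set R)
    (fun t => rnorm ((expR (- l * t))%:C *: w t - (expR (- l * t))%:C *: w 0)).
  apply: (@eq_measurable_fun _ _ _ _ _ (fun t => expR (- l * t) * rnorm (w t - w 0))).
    by move=> t _; rewrite dE.
  by apply: measurable_funM => //; exact: mexp.
have m0 : measurable (`[0%R, +oo[%classic : set R) by exact: measurable_itv.
have hle : ((rnorm (v l - (l^-1)%:C *: w 0))%:E <= \int[mu]_(t in `[0%R, +oo[)
    (rnorm ((expR (- l * t))%:C *: w t - (expR (- l * t))%:C *: w 0))%:E)%E.
  by apply: bochner_dist_le (hv l nul) hw0; [exact: m0|exact: mdiff].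
have {}hle : ((rnorm (v l - (l^-1)%:C *: w 0))%:E <=
    (e / 2 * l^-1 + 2 * K * expR (- (l * d / 2)) * (l / 2)^-1)%:E)%E.
  apply: le_trans hle _.
  apply: (@le_trans _ _ (\int[mu]_(t in `[0%R, +oo[) ((e / 2 * expR (- l * t))%:E +
     (2 * K * expR (- (l * d / 2)) * expR (- (l / 2) * t))%:E))%E).
    apply: ge0_le_integral_any => t; rewrite /= in_itv/= andbT => t0.
      by rewrite lee_fin rnorm_ge0.
    rewrite dE -EFinD lee_fin; have [td|td] := ltP t d.
      have h1 : rnorm (w t - w 0) <= e / 2.
        by apply/ltW/H; rewrite /= ?in_itv/= ?t0// subr0 ger0_norm.
      have h2 : 0 <= 2 * K * expR (- (l * d / 2)) * expR (- (l / 2) * t).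
        by rewrite !mulr_ge0 ?expR_ge0.
      by have := expR_ge0 (- l * t); nra.
    have h1 : rnorm (w t - w 0) <= 2 * K.
      have := rnormB (w t) (w 0); have := wK _ t0; have := wK _ (lexx 0); lra.
    have h2 : expR (- l * t) <= expR (- (l * d / 2)) * expR (- (l / 2) * t).
      by rewrite -expRD ler_expR; nra.
    have h3 := expR_ge0 (- l * t).
    have h4 : expR (- l * t) * rnorm (w t - w 0) <= expR (- l * t) * (2 * K).
      exact: ler_wpM2l.
    have h5 : expR (- l * t) * (2 * K) <=
       expR (- (l * d / 2)) * expR (- (l / 2) * t) * (2 * K).
      by apply: ler_wpM2r => //; lra.
    have h6 : 0 <= e / 2 * expR (- l * t) by rewrite mulr_ge0//; lra.
    lra.
  rewrite ge0_integralD//; last 4 first.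
  - by move=> t _; rewrite lee_fin mulr_ge0 ?expR_ge0//; lra.
  - by apply/measurable_EFinP; apply: measurable_funM => //; exact: mexp.
  - by move=> t _; rewrite lee_fin !mulr_ge0 ?expR_ge0.
  - by apply/measurable_EFinP; apply: measurable_funM => //; exact: mexp.
  under eq_integral do rewrite EFinM.
  under [X in (_ + X)%E]eq_integral do rewrite EFinM.
  rewrite !ge0_integralZl_EFin//.
  - by rewrite !integral_expM// -!EFinM -EFinD.
  - by apply/measurable_EFinP; exact: mexp.
  - by rewrite !mulr_ge0 ?expR_ge0.
  - by apply/measurable_EFinP; exact: mexp.
  - by lra.
have -> : l%:C *: v l - w 0 = l%:C *: (v l - (l^-1)%:C *: w 0).
  by rewrite scalerBr scalerA -rmorphM/= divff ?gt_eqF// scale1r.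
rewrite rnormZ gtr0_norm//.
move: hle; rewrite lee_fin => hle.
apply: le_trans (ler_wpM2l (ltW l0) hle) _.
have ld0 : 0 < l * d / 2 by rewrite divr_gt0// mulr_gt0.
have hx : expR (- (l * d / 2)) <= (l * d / 2)^-1.
  rewrite expRN lef_pV2 ?posrE ?expR_gt0//.
  by have := expR_ge1Dx (l * d / 2); lra.
have -> : l * (e / 2 * l^-1 + 2 * K * expR (- (l * d / 2)) * (l / 2)^-1) =
   e / 2 + 4 * K * expR (- (l * d / 2)).
  by field; rewrite gt_eqF.
have K4 : 0 <= 4 * K by lra.
have := ler_wpM2l K4 hx.
have -> : 4 * K * (l * d / 2)^-1 = 8 * K / (l * d).
  by field; rewrite !gt_eqF.
have : 8 * K / (l * d) <= e / 2.
  rewrite ler_pdivrMr ?mulr_gt0//.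
  have : 16 * K / (d * e) <= l by have := normr_ge0 nu; lra.
  rewrite ler_pdivrMr ?mulr_gt0//; lra.
lra.
Qed.

End Laplace.

Section InitialValue.
Context {R : realType} {X : normedModType R[i]}.
Implicit Types (l t e : R) (x y : X).

Lemma opnorm_le (B : {linear X -> X}) (k : R) : (opnorm B <= k%:E)%E ->
  forall x, rnorm (B x) <= k * rnorm x.
Proof.
move=> hB x; have [x0|x0] := eqVneq (rnorm x) 0.
  by rewrite (rnorm_eq0 x0) linear0 rnorm0 mulr0.
have xgt0 : 0 < rnorm x by rewrite lt_def x0 rnorm_ge0.
pose a := (rnorm x)^-1.
have a0 : 0 < a by rewrite invr_gt0.
have : rnorm (B (a%:C *: x)) <= k.
  rewrite -lee_fin; apply: le_trans hB; apply: ereal_sup_ubound.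
  by exists (a%:C *: x) => //=; rewrite rnormZ gtr0_norm// /a mulVf.
by rewrite linearZ/= rnormZ gtr0_norm// /a ler_pdivrMl// mulrC.
Qed.

Lemma rnorm_realC l : 0 <= l -> rnorm (l%:C : R[i]) = l.
Proof. by move=> l0; rewrite /rnorm normc_def/= expr0n addr0 sqrtr_sqr ger0_norm. Qed.

Lemma carg_pos l : 0 < l -> carg l%:C = 0.
Proof.
by move=> l0; rewrite /carg/= lexx rnorm_realC ?ltW// divff ?gt_eqF// acos1.
Qed.

Lemma carg_neg l : 0 < l -> carg (- l%:C) = pi.
Proof.
move=> l0; rewrite /carg/= oppr0 lexx.
have -> : rnorm (- l%:C : R[i]) = l by rewrite /rnorm normrN -/(rnorm _) rnorm_realC// ltW.
by rewrite mulNr divff ?gt_eqF// acosN1.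
Qed.

Lemma cpow_pos l a : 0 < l -> cpow l%:C a = (l `^ a)%:C.
Proof.
by move=> l0; rewrite /cpow carg_pos// mulr0 cos0 sin0 mulr1 mulr0 rnorm_realC ?ltW.
Qed.

Lemma cexp_real l : cexp l%:C = (expR l)%:C.
Proof. by rewrite /cexp/= cos0 sin0 mulr1 mulr0. Qed.

(** By the initial value theorem, [l^alpha B x] tends to [S 0 x], where [B] is the
    resolvent at [l^alpha]. On the domain of [A] one has
    [l^alpha B x = x + B (A x)], and the last term is at most
    [M |A x| / l^alpha] because [mu < 0]. *)
Lemma solution_operator_at0 (alpha mu theta M K : R) (A : operator X)
    (S : R -> {linear X -> X}) :
  0 < alpha -> mu < 0 -> sectorial A mu theta M ->
  solution_operator alpha A S -> dense (op_dom A) ->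
  (forall t x, 0 <= t -> rnorm (S t x) <= K * rnorm x) ->
  forall x, S 0 x = x.
Proof.
move=> al0 mu0 [_ /andP[th0 th1] M0 _ hres] [_ _ cS [nu hnu]] dA hK.
have domA x : op_dom A x -> S 0 x = x.
  move=> Ax; apply/eqP; rewrite -subr_eq0; apply/eqP/rnorm_eq0.
  apply/eqP; rewrite eq_le rnorm_ge0 andbT; apply/ler_addgt0Pr => e e0.
  have hB l : exists B : {linear X -> X}, `|nu| < l ->
      is_resolvent A (cpow l%:C alpha) B /\ bochner_integral lebesgue_measure `[0, +oo[
            (fun t => cexp (- (l%:C * t%:C)) *: S t x) (cpow l%:C (alpha - 1) *: B x).
    case: (ltP `|nu| l) => hl; last by exists idfun.
    have /hnu[B [h1 h2]] : nu < complex.Re l%:C by apply: le_lt_trans hl; rewrite ler_norm.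
    by exists B.
  pose B l := sval (cid (hB l)).
  have hBl l : `|nu| < l -> is_resolvent A (cpow l%:C alpha) (B l) /\
      bochner_integral lebesgue_measure `[0, +oo[
            (fun t => cexp (- (l%:C * t%:C)) *: S t x) (cpow l%:C (alpha - 1) *: B l x).
    exact: svalP (cid (hB l)).
  have e2 : 0 < e / 2 by lra.
  have hSx t : 0 <= t -> rnorm (S t x) <= K * rnorm x by move=> t0; exact: hK.
  have hlap l : `|nu| < l -> bochner_integral lebesgue_measure `[0, +oo[
      (fun t => (expR (- l * t))%:C *: S t x) ((l `^ (alpha - 1))%:C *: B l x).
    move=> hl; have [_ h] := hBl l hl; have l0 : 0 < l by have := normr_ge0 nu; lra.
    rewrite -cpow_pos//; apply: eq_bochner_integral h => t _.
    by rewrite -rmorphM/= -rmorphN/= cexp_real mulNr.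
  have [L hL] := laplace_initial_value (cS x) hSx hlap e2.
  have q0 : 0 <= M * rnorm (A x) / (e / 2) by rewrite divr_ge0 ?(ltW e2) ?mulr_ge0 ?rnorm_ge0 ?(ltW M0).
  pose l := Num.max (`|nu| + 1) (Num.max L ((M * rnorm (A x) / (e / 2) + 1) `^ alpha^-1)).
  have l1 : `|nu| + 1 <= l by rewrite le_max lexx.
  have l2 : L <= l by rewrite !le_max lexx !orbT.
  have l3 : (M * rnorm (A x) / (e / 2) + 1) `^ alpha^-1 <= l by rewrite !le_max lexx !orbT.
  have l0 : 0 < l by have := normr_ge0 nu; lra.
  have la0 : 0 < l `^ alpha by exact: powR_gt0.
  have l4 : M * rnorm (A x) / (e / 2) + 1 <= l `^ alpha.
    have -> : M * rnorm (A x) / (e / 2) + 1 =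
        ((M * rnorm (A x) / (e / 2) + 1) `^ alpha^-1) `^ alpha.
      by rewrite -powRrM mulVf ?gt_eqF// powRr1//; lra.
    by apply: ge0_ler_powR => //; rewrite ?nnegrE ?powR_ge0// ltW.
  have nul : `|nu| < l by lra.
  have [hr _] := hBl l nul; rewrite cpow_pos// in hr.
  have hop : (opnorm (B l) <= (M / rnorm ((l `^ alpha)%:C - mu%:C : R[i]))%:E)%E.
    apply: hres hr.
      move=> [z [z0 hz] ez].
      have {}ez : z = (l `^ alpha)%:C - mu%:C by rewrite -ez addrAC subrr add0r.
      move: hz; rewrite ez -rmorphB/= carg_neg ?subr_gt0; last by lra.
      by rewrite ger0_norm ?pi_ge0//; have := @pi_gt0 R; lra.
    by rewrite -subr_eq0 -rmorphB/= (inj_eq (@complexI R)) gt_eqF//; lra.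
  have lmu : l `^ alpha <= rnorm ((l `^ alpha)%:C - mu%:C : R[i]).
    by rewrite -rmorphB/= rnorm_realC; lra.
  have hBA : rnorm (B l (A x)) <= e / 2.
    apply: le_trans (opnorm_le hop _) _.
    rewrite mulrAC ler_pdivrMr; last by exact: lt_le_trans lmu.
    apply: (@le_trans _ _ (e / 2 * l `^ alpha)); last by rewrite ler_wpM2l// ltW.
    by rewrite [leRHS]mulrC -ler_pdivrMr//; lra.
  have E : (l `^ alpha)%:C *: B l x = x + B l (A x).
    have [_ _ h3] := hr; have := h3 x Ax; rewrite linearB linearZ/=.
    by move/eqP; rewrite subr_eq => /eqP ->.
  have := hL l l2.
  rewrite scalerA -rmorphM/= mulr_powRB1 ?(ltW l0)// E => h.
  rewrite add0r.
  have := rnormBD (S 0 x) (x + B l (A x)) x.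
  have h1 : rnorm (S 0 x - (x + B l (A x))) <= e / 2 by rewrite rnormBC.
  have h2 : rnorm (x + B l (A x) - x) <= e / 2 by rewrite addrAC subrr add0r.
  lra.
move=> x; apply/eqP; rewrite -subr_eq0; apply/eqP/rnorm_eq0.
apply/eqP; rewrite eq_le rnorm_ge0 andbT; apply/ler_addgt0Pr => e e0.
have K1 : 0 < `|K| + 1 by rewrite ltr_wpDl.
pose d := e / (`|K| + 1).
have d0 : 0 < d by rewrite divr_gt0.
have [||y [xy Ay]] := dA (ball x d%:C).
- by exists x; apply: ballxx; rewrite ltcR.
- exact: ball_open.
have {}xy : rnorm (x - y) < d by move: xy; rewrite -ball_normE/= rnormE ltcR.
have -> : S 0 x - x = S 0 (x - y) - (x - y).
  by rewrite linearB/= (domA y Ay) opprB addrA subrK.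
apply: le_trans (rnormB _ _) _; rewrite add0r.
have h1 := hK 0 (x - y) (lexx _).
have h2 : K * rnorm (x - y) <= `|K| * rnorm (x - y).
  by apply: ler_wpM2r; [exact: rnorm_ge0|exact: ler_norm].
have : (`|K| + 1) * rnorm (x - y) <= e by rewrite mulrC -ler_pdivlMr// ltW.
lra.
Qed.

End InitialValue.

(** * Stepanov bounds *)

Section Stepanov.
Context {R : realType}.
Notation cmu := (@completed_lebesgue_measure R).
Notation LT := (@lebesgueType R).
Implicit Types (a b t c p y : R) (h w : R -> R).

(** Young's inequality for [y * 1], also valid for [p = 1]. *)
Lemma le_powR_conjugate p y : 1 <= p -> 0 <= y ->
  y <= y `^ p / p + (1 - p^-1).
Proof.
move=> p1 y0; have p0 : 0 < p by lra.
have [->|pn1] := eqVneq p 1; first by rewrite powRr1// invr1; lra.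
have q0 : 0 < 1 - p^-1 by rewrite subr_gt0 invf_lt1// lt_def pn1.
have qi : 0 < (1 - p^-1)^-1 by rewrite invr_gt0.
have := @conjugate_powR R y 1 p (1 - p^-1)^-1 y0 ler01 p0 qi.
by rewrite invrK powR1 mulr1 mul1r; apply; ring.
Qed.

Lemma lebesgueType_measurable_itv (i : interval R) : measurable ([set` i] : set LT).
Proof. by apply: sub_caratheodory; exact: measurable_itv. Qed.

Lemma completed_lebesgue_measure_itv (i : interval R) :
  cmu [set` i] = lebesgue_measure [set` i].
Proof. by []. Qed.

(** Stepanov bounded functions are only Lebesgue measurable, whereas Bochner
    integrands are measured with respect to Borel sets; this is the bridge. *)
Lemma integral_completed (D : set R) (w : R -> \bar R) : measurable D ->
  measurable_fun D w -> (forall x, D x -> (0 <= w x)%E) ->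
  (\int[lebesgue_measure]_(x in D) w x = \int[cmu]_(x in D) w x)%E.
Proof.
move=> mD mw w0.
have mid : measurable_fun [set: LT] (id : LT -> measurableTypeR R).
  by move=> _ A mA; rewrite setTI; apply: sub_caratheodory.
transitivity (\int[pushforward cmu (id : LT -> measurableTypeR R)]_(x in D) w x)%E.
  exact: eq_measure_integral.
by rewrite ge0_integral_pushforward// => x /set_mem; exact: w0.
Qed.

Lemma stepanov_norm_ge0 p h : (0 <= stepanov_norm p h)%E.
Proof.
apply: le_trans (poweR_ge0 _ p^-1) _; apply: ereal_sup_ubound.
by exists 0 => //=; rewrite in_itv/= lexx.
Qed.

Lemma BS_pos_stepanov_fin p h : BS_pos p h ->
  stepanov_norm p h = (fine (stepanov_norm p h))%:E.
Proof. by move=> [_ _ hoo]; rewrite fineK// ge0_fin_numE// stepanov_norm_ge0. Qed.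

Lemma measurable_funS_ray h a b : measurable_fun (`[0, +oo[ : set LT) h ->
  0 <= a -> measurable_fun (`[a, b] : set LT) h.
Proof.
move=> mh a0; apply: measurable_funS mh; first exact: lebesgueType_measurable_itv.
by move=> x /=; rewrite !in_itv/= andbT => /andP[/(le_trans a0)].
Qed.

Lemma integral_cst_unit t c : 0 <= c ->
  (\int[cmu]_(x in `[t, (t + 1)%R]) c%:E = c%:E)%E.
Proof.
move=> c0; rewrite (integral_cst cmu (lebesgueType_measurable_itv _) c%:E).
rewrite [X in (_ * X)%E]completed_lebesgue_measure_itv lebesgue_measure_itv/=.
by rewrite lte_fin ltrDl ltr01 -EFinB addrAC subrr add0r mule1.
Qed.

Lemma integral_powR_le_stepanov p h t : 1 <= p -> BS_pos p h -> 0 <= t ->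
  (\int[cmu]_(x in `[t, (t + 1)%R]) (h x `^ p)%:E
    <= (fine (stepanov_norm p h) `^ p)%:E)%E.
Proof.
move=> p1 hh t0; have p0 : 0 < p by lra.
have [mh h0 hoo] := hh.
have -> : (\int[cmu]_(x in `[t, (t + 1)%R]) (h x `^ p)%:E =
    \int[cmu]_(x in `[t, (t + 1)%R]) (`|h x| `^ p)%:E)%E.
  apply: eq_integral => x; rewrite inE/= in_itv/= => /andP[tx _].
  by rewrite ger0_norm// h0// (le_trans t0).
set j := (\int[cmu]_(x in _) _)%E.
have j0 : (0 <= j)%E by apply: integral_ge0 => x _; rewrite lee_fin powR_ge0.
have hj : (j `^ p^-1 <= (fine (stepanov_norm p h))%:E)%E.
  rewrite -(BS_pos_stepanov_fin hh); apply: ereal_sup_ubound.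
  by exists t => //=; rewrite in_itv/= t0.
have pi0 : p^-1 != 0 by rewrite invr_eq0 gt_eqF.
case: j j0 hj => [j j0 hj|_|//]; last first.
  by rewrite poweRyr// leye_eq.
rewrite poweR_EFin lee_fin in hj; rewrite lee_fin in j0 *.
have -> : j = (j `^ p^-1) `^ p by rewrite -powRrM mulVf ?gt_eqF// powRr1.
by apply: ge0_ler_powR; rewrite ?nnegrE ?powR_ge0 ?(ltW p0)// (le_trans _ hj)// powR_ge0.
Qed.

(** Hoelder's inequality on a unit interval, from the tangent line inequality
    for the power [p] at the height [c]; the height is taken slightly above
    the norm because the norm may vanish. *)
Lemma integral_le_stepanov_unit p h t : 1 <= p -> BS_pos p h -> 0 <= t ->
  (\int[cmu]_(x in `[t, (t + 1)%R]) (h x)%:E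
    <= (fine (stepanov_norm p h))%:E)%E.
Proof.
move=> p1 hh t0; have p0 : 0 < p by lra.
have [mh h0 hoo] := hh.
set N := fine _; have N0 : 0 <= N by rewrite fine_ge0// stepanov_norm_ge0.
apply/lee_addgt0Pr => e e0.
pose c := N + e; have c0 : 0 < c by rewrite /c; lra.
have q0 : 0 <= 1 - p^-1 by rewrite subr_ge0 invf_le1.
have cp0 : 0 < c `^ p by rewrite powR_gt0.
have mI := lebesgueType_measurable_itv `[t, (t + 1)%R].
have mhI := measurable_funS_ray (b := t + 1) mh t0.
have mhp : measurable_fun (`[t, (t + 1)%R] : set LT) (fun x => h x `^ p).
  by apply: (measurableT_comp (f := fun y : R => y `^ p)) => //; exact: measurable_powRr.
pose k := c / (c `^ p * p); have k0 : 0 <= k by rewrite divr_ge0 ?mulr_ge0 ?ltW.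
apply: (@le_trans _ _ (\int[cmu]_(x in `[t, (t + 1)%R])
    (k%:E * (h x `^ p)%:E + (c * (1 - p^-1))%:E))%E).
  apply: ge0_le_integral_any => x; rewrite /= in_itv/= => /andP[tx _].
    by rewrite lee_fin h0// (le_trans t0).
  have hx0 : 0 <= h x by rewrite h0// (le_trans t0).
  have hle := le_powR_conjugate p1 (divr_ge0 hx0 (ltW c0)).
  have ci0 : 0 <= c^-1 by rewrite invr_ge0 ltW.
  have E : (h x / c) `^ p = h x `^ p / c `^ p.
    by rewrite powRM// -powR_inv1 ?(ltW c0)// -powRrM mulN1r powRN.
  rewrite -EFinM -EFinD lee_fin.
  have := ler_wpM2r (ltW c0) hle; rewrite divfK ?gt_eqF// E => /le_trans; apply.
  rewrite le_eqVlt; apply/orP; left; apply/eqP; rewrite /k.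
  by field; rewrite !gt_eqF.
rewrite ge0_integralD; last 5 first.
- exact: mI.
- by move=> x _; rewrite -EFinM lee_fin mulr_ge0 ?powR_ge0.
- apply/measurable_EFinP; apply: measurable_funM; first exact: measurable_cst.
  exact: mhp.
- by move=> x _; rewrite lee_fin mulr_ge0// ltW.
- exact: measurable_cst.
rewrite ge0_integralZl_EFin; last 4 first.
- exact: mI.
- by move=> x _; rewrite lee_fin powR_ge0.
- by apply/measurable_EFinP; exact: mhp.
- exact: k0.
rewrite integral_cst_unit ?mulr_ge0// ?(ltW c0)//.
apply: (@le_trans _ _ (k%:E * (N `^ p)%:E + (c * (1 - p^-1))%:E)%E).
  by apply: leeD2r; apply: lee_wpmul2l => //; exact: integral_powR_le_stepanov.
rewrite -EFinM -!EFinD lee_fin -/c.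
have Nc : N `^ p <= c `^ p.
  by apply: ge0_ler_powR; rewrite ?nnegrE ?(ltW p0) ?(ltW c0)// /c; lra.
have : k * N `^ p <= k * c `^ p by exact: ler_wpM2l.
have -> : k * c `^ p = c * p^-1 by rewrite /k; field; rewrite !gt_eqF.
lra.
Qed.

Lemma integral_le_stepanov p h a b w (A c : R) : 1 <= p -> BS_pos p h ->
  0 <= a -> b <= a + 1 -> 0 <= A -> 0 <= c -> measurable_fun `[a, b] w ->
  (forall x, a <= x <= b -> 0 <= w x <= A + c * h x) ->
  (\int[lebesgue_measure]_(x in `[a, b]) (w x)%:E
    <= (A + c * fine (stepanov_norm p h))%:E)%E.
Proof.
move=> p1 hh a0 ba A0 c0 mw hw; have [mh h0 hoo] := hh.
have mI i := lebesgueType_measurable_itv i.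
have mhI := measurable_funS_ray (b := a + 1) mh a0.
have hge0 x : `[a, (a + 1)%R]%classic x -> 0 <= h x.
  by rewrite /= in_itv/= => /andP[ax _]; rewrite h0// (le_trans a0).
rewrite integral_completed//; last 2 first.
- exact/measurable_EFinP.
- by move=> x /=; rewrite in_itv/= lee_fin => /hw/andP[].
apply: (@le_trans _ _ (\int[cmu]_(x in `[a, b]) (A%:E + c%:E * (h x)%:E))%E).
  apply: ge0_le_integral_any => x /=; rewrite in_itv/= => /hw/andP[w0 wle].
    by rewrite lee_fin.
  by rewrite -EFinM -EFinD lee_fin.
have mch : measurable_fun (`[a, (a + 1)%R] : set LT) (fun x => (c%:E * (h x)%:E)%E).
  by apply/measurable_EFinP; apply: measurable_funM; [exact: measurable_cst|exact: mhI].
have mAh : measurable_fun (`[a, (a + 1)%R] : set LT)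
    (fun x => (A%:E + c%:E * (h x)%:E)%E).
  apply/measurable_EFinP; apply: measurable_funD; first exact: measurable_cst.
  by apply: measurable_funM; [exact: measurable_cst|exact: mhI].
apply: (@le_trans _ _ (\int[cmu]_(x in `[a, (a + 1)%R]) (A%:E + c%:E * (h x)%:E))%E).
  apply: ge0_subset_integral; [exact: mI|exact: mI|exact: mAh| |].
  - by move=> x /hge0 hx; rewrite -EFinM -EFinD lee_fin addr_ge0// mulr_ge0.
  - by move=> x /=; rewrite !in_itv/= => /andP[-> /le_trans->].
rewrite ge0_integralD; last 5 first.
- exact: mI.
- by move=> x _; rewrite lee_fin.
- exact: measurable_cst.
- by move=> x /hge0 hx; rewrite -EFinM lee_fin mulr_ge0.
- exact: mch.
rewrite (integral_cst_unit a A0) ge0_integralZl_EFin; last 4 first.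
- exact: mI.
- by move=> x /hge0 hx; rewrite lee_fin.
- by apply/measurable_EFinP; exact: mhI.
- exact: c0.
rewrite EFinD EFinM; apply: leeD2l; apply: lee_wpmul2l => //.
exact: integral_le_stepanov_unit.
Qed.

Lemma integral_cover_le (D : set R) (B : nat -> set R) (w : R -> R)
    (c : nat -> R) (J : nat) :
  measurable D -> (forall j, measurable (B j)) -> measurable_fun D w ->
  (forall x, D x -> 0 <= w x) ->
  (forall x, D x -> exists2 j, (j < J)%N & B j x) ->
  (forall j, (j < J)%N ->
    (\int[lebesgue_measure]_(x in D `&` B j) (w x)%:E <= (c j)%:E)%E) ->
  (\int[lebesgue_measure]_(x in D) (w x)%:E <= (\sum_(j < J) c j)%:E)%E.
Proof.
move=> mD mB mw w0 cov hc.
apply: (@le_trans _ _ (\int[lebesgue_measure]_(x in D)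
    \sum_(j < J) ((EFin \o w) \_ (B j)) x)%E).
  apply: ge0_le_integral_any => x Dx; first by rewrite lee_fin w0.
  have [j jJ Bj] := cov x Dx.
  rewrite (bigD1 (Ordinal jJ))//= patchE mem_set//; apply: leeDl.
  by apply: sume_ge0 => i _; rewrite patchE; case: ifP => // _; rewrite lee_fin w0.
rewrite ge0_integral_sum//; last 2 first.
- move=> j; apply/(measurable_restrict _ (mB j) mD).
  by apply: measurable_funS (_ : measurable_fun D _) => //; exact/measurable_EFinP.
- by move=> j x Dx; rewrite patchE; case: ifP => // _; rewrite lee_fin w0.
rewrite -sumEFin; apply: lee_sum => j _.
by rewrite -integral_mkcondr; exact: hc.
Qed.

End Stepanov.

(** * The kernel *)
Section Kernel.
Context {R : realType}.
Implicit Types (K m alpha t h : R).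

Definition kernel K m alpha t : R := K / (1 + m * t `^ alpha).

(** The bound for [\sum_j kernel j] that the theorem uses: [K * 1] for [j = 0], and
    the integral of the kernel over the half-line for the other terms. *)
Definition kernel_mass K m alpha : R :=
  K * (1 + m `^ (- alpha^-1) * pi / (alpha * sin (pi / alpha))).

Lemma kernel_den_gt0 m alpha t : 0 < m -> 0 < 1 + m * t `^ alpha.
Proof. by move=> m0; rewrite ltr_wpDr// mulr_ge0 ?powR_ge0// ltW. Qed.

Lemma kernel_ge0 K m alpha t : 0 <= K -> 0 < m -> 0 <= kernel K m alpha t.
Proof. by move=> K0 m0; rewrite divr_ge0// ltW// kernel_den_gt0. Qed.

Lemma kernel_le K m alpha t : 0 <= K -> 0 < m -> kernel K m alpha t <= K.
Proof.
move=> K0 m0; rewrite ler_pdivrMr ?kernel_den_gt0// ler_peMr// lerDl.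
by rewrite mulr_ge0 ?powR_ge0// ltW.
Qed.

Lemma kernel_decr K m alpha s t : 0 <= K -> 0 < m -> 0 <= alpha ->
  0 <= s -> s <= t -> kernel K m alpha t <= kernel K m alpha s.
Proof.
move=> K0 m0 al0 s0 st; apply: ler_wpM2l => //.
rewrite lef_pV2 ?posrE ?kernel_den_gt0// lerD2l ler_wpM2l ?(ltW m0)//.
by apply: ge0_ler_powR; rewrite ?nnegrE// (le_trans s0).
Qed.

Lemma kernel_sum_le_mass K m alpha J : 0 <= K -> 0 < m -> 1 < alpha ->
  \sum_(j < J) kernel K m alpha j%:R <= kernel_mass K m alpha.
Proof.
move=> K0 m0 al1.
have h n : \sum_(j < n) kernel K m alpha j.+1%:R
    <= K * (m `^ (- alpha^-1) * pi / (alpha * sin (pi / alpha))).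
  rewrite /kernel -mulr_sumr; apply: ler_wpM2l => //.
  exact: kernel_sum_le.
case: J => [|J].
  rewrite big_ord0 mulr_ge0// addr_ge0//.
  by have := kernel_sum_le 0 al1 m0; rewrite big_ord0.
rewrite big_ord_recl /kernel_mass mulrDr; apply: lerD; last exact: h.
by rewrite mulr1; exact: kernel_le.
Qed.

(** A step [h] amounts to replacing [m] by [m * h^alpha]. *)
Lemma kernel_step_sum_bounded K m alpha h : 0 <= K -> 0 < m -> 1 < alpha ->
  0 < h -> exists2 B, 0 <= B &
    forall J, \sum_(j < J) kernel K m alpha (j%:R * h) <= B.
Proof.
move=> K0 m0 al1 h0.
have E (j : nat) : kernel K m alpha (j%:R * h) = kernel K (m * h `^ alpha) alpha j%:R.
  by rewrite /kernel powRM ?(ltW h0)//; congr (K / (1 + _)); ring.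
have mh : 0 < m * h `^ alpha by rewrite mulr_gt0// powR_gt0.
exists (kernel_mass K (m * h `^ alpha) alpha).
  by apply: le_trans (kernel_sum_le_mass 0 K0 mh al1); rewrite big_ord0.
by move=> J; under eq_bigr do rewrite E; exact: kernel_sum_le_mass.
Qed.

(** On the unit interval of the [s] whose lag [t - s] lies between [j] and
    [j + 1], the kernel is at most its value at [j]; the last of these intervals
    is cut off at [0]. *)
Lemma kernel_integral_le K m alpha p (L w : R -> R) t (A c : R) :
  0 <= K -> 0 < m -> 1 < alpha -> 1 <= p -> BS_pos p L -> 0 <= A -> 0 <= c ->
  0 <= t -> measurable_fun `[0, t] w ->
  (forall s, 0 <= s <= t ->
    0 <= w s <= kernel K m alpha (t - s) * (A + c * L s)) ->
  (\int[lebesgue_measure]_(s in `[0%R, t]) (w s)%:E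
     <= (kernel_mass K m alpha * (A + c * fine (stepanov_norm p L)))%:E)%E.
Proof.
move=> K0 m0 al1 p1 hL A0 c0 t0 mw hw.
have [_ L0 _] := hL.
have N0 : 0 <= fine (stepanov_norm p L) by rewrite fine_ge0// stepanov_norm_ge0.
pose a (j : nat) : R := Num.max 0 (t - j.+1%:R).
pose b (j : nat) : R := t - j%:R.
pose J := (Num.truncn t).+1.
have /andP[Jt tJ] : J.-1%:R <= t < J%:R by exact: truncn_itv.
have jt (j : nat) : (j < J)%N -> j%:R <= t.
  by rewrite ltnS => jJ; apply: le_trans Jt; rewrite ler_nat.
have a0 j : 0 <= a j by rewrite le_max lexx.
have ba j : b j <= a j + 1.
  have : t - j.+1%:R <= a j by rewrite le_max lexx orbT.
  by rewrite /b -natr1; lra.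
have sub j : (j < J)%N -> `[0%R, t]%classic `&` `[a j, b j]%classic = `[a j, b j]%classic.
  move=> jJ; apply: setIidr => x /=; rewrite !in_itv/= => /andP[ax xb].
  rewrite (le_trans (a0 j) ax)/=; have : 0 <= j%:R :> R by [].
  by move: xb; rewrite /b; lra.
apply: (@le_trans _ _ (\sum_(j < J) (kernel K m alpha j%:R
    * (A + c * fine (stepanov_norm p L))))%:E); last first.
  rewrite lee_fin -mulr_suml; apply: ler_wpM2r; last exact: kernel_sum_le_mass.
  by rewrite addr_ge0// mulr_ge0.
apply: (@integral_cover_le _ _ (fun j => `[a j, b j]%classic) w
  (fun j => kernel K m alpha j%:R * (A + c * fine (stepanov_norm p L)))) => //.
- by move=> s; rewrite /= in_itv/= => /hw/andP[].
- move=> x; rewrite /= in_itv/= => /andP[x0 xt].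
  have tx0 : 0 <= t - x by lra.
  have [j /andP[jx xj]] := block_exists ltr01 tx0.
  rewrite !mulr1 in jx xj; exists j.
    by rewrite -(ltr_nat R); apply: le_lt_trans tJ; lra.
  by rewrite /= in_itv/= /a ge_max x0 /b/=; lra.
move=> j jJ; rewrite (sub j jJ).
rewrite mulrDr mulrA; apply: (integral_le_stepanov p1 hL (a0 j) (ba j)).
- by rewrite mulr_ge0// kernel_ge0.
- by rewrite mulr_ge0// kernel_ge0.
- apply: measurable_funS mw => // x.
  by rewrite -(sub j jJ) => -[].
move=> x /andP[ax xb]; have x0 := le_trans (a0 j) ax.
have xt : x <= t by have : 0 <= j%:R :> R by []; move: xb; rewrite /b; lra.
have /andP[-> wle] : 0 <= w x <= kernel K m alpha (t - x) * (A + c * L x).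
  by apply: hw; rewrite x0.
apply: (le_trans wle); rewrite -mulrA -mulrDr; apply: ler_wpM2r.
  by rewrite addr_ge0// mulr_ge0// L0.
by apply: kernel_decr => //; [lra|move: xb; rewrite /b; lra].
Qed.

End Kernel.

(** * Vanishing means through block bounds *)

Section Cesaro.
Context {R : realType}.
Implicit Types (x y k : nat -> R) (e c : R).

Definition cesaro0 x := (forall n, 0 <= x n) /\
  forall e, 0 < e -> exists N, forall n, (N <= n)%N ->
    \sum_(j < n) x j <= e * n%:R.

Lemma cesaro0D x y : cesaro0 x -> cesaro0 y -> cesaro0 (fun n => x n + y n).
Proof.
move=> [x0 hx] [y0 hy]; split=> [n|e e0]; first by rewrite addr_ge0.
have e2 : 0 < e / 2 by lra.
have [N1 h1] := hx _ e2; have [N2 h2] := hy _ e2.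
exists (maxn N1 N2) => n; rewrite geq_max => /andP[/h1 ? /h2 ?].
by rewrite big_split/=; lra.
Qed.

Lemma cesaro0Z c x : 0 <= c -> cesaro0 x -> cesaro0 (fun n => c * x n).
Proof.
move=> c0 [x0 hx]; split=> [n|e e0]; first by rewrite mulr_ge0.
have c1 : 0 < c + 1 by lra.
have e1 : 0 < e / (c + 1) by rewrite divr_gt0.
have [N hN] := hx _ e1; exists N => n /hN h.
rewrite -mulr_sumr; apply: le_trans (ler_wpM2l c0 h) _.
have n0 : 0 <= n%:R :> R by [].
rewrite mulrA ler_wpM2r// mulrA ler_pdivrMr//; nra.
Qed.

Lemma cesaro0_summable x (B : R) : (forall n, 0 <= x n) ->
  (forall n, \sum_(j < n) x j <= B) -> cesaro0 x.
Proof.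
move=> x0 hB; split=> // e e0.
have B0 : 0 <= B / e by rewrite divr_ge0 ?(ltW e0)//; have := hB 0; rewrite big_ord0.
exists (Num.bound (B / e)) => n Nn; apply: le_trans (hB n) _.
rewrite mulrC -ler_pdivrMr//; apply/ltW/(lt_le_trans (archi_boundP B0)).
by rewrite ler_nat.
Qed.

Definition conv k x n : R := \sum_(m < n.+1) k (n - m)%N * x m.

(** After exchanging the sums, each [x m] carries a total weight at most [B]. *)
Lemma cesaro0_conv k x (B : R) : (forall n, 0 <= k n) ->
  (forall n, \sum_(j < n) k j <= B) -> cesaro0 x -> cesaro0 (conv k x).
Proof.
move=> k0 hB [x0 hx].
have B0 : 0 <= B by have := hB 0; rewrite big_ord0.
split=> [n|e e0]; first by apply: sumr_ge0 => m _; rewrite mulr_ge0.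
have e1 : 0 < e / (B + 1) by rewrite divr_gt0//; lra.
have [N hN] := hx _ e1; exists N => n /hN h.
have -> : \sum_(j < n) conv k x j =
    \sum_(m < n) (\sum_(j < n | (m < j.+1)%N) k (j - m)%N) * x m.
  under eq_bigr => j _.
    rewrite /conv (big_ord_widen_cond n xpredT (fun m => k (j - m)%N * x m))//=.
    over.
  rewrite (exchange_big_dep xpredT)//=.
  by apply: eq_bigr => m _; rewrite -mulr_suml.
apply: (@le_trans _ _ (\sum_(m < n) B * x m)).
  apply: ler_sum => m _; apply: ler_wpM2r => //.
  rewrite -(big_mkord (fun j => (m < j.+1)%N) (fun j => k (j - m)%N)).
  have mn : (m <= n)%N by exact: ltnW.
  rewrite (big_cat_nat (leq0n m) mn)/= big_nat_cond big1 ?add0r; last first.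
    by move=> j /andP[/andP[_ jm]]; rewrite ltnS leqNgt jm.
  rewrite big_nat_cond (eq_bigl (fun j => (m <= j < n)%N)); last first.
    by move=> j; rewrite ltnS; case: (leqP m j); rewrite ?andbT ?andbF.
  rewrite -big_nat -{1}(add0n (m : nat)) big_addn big_mkord.
  by under eq_bigr do rewrite addnK.
rewrite -mulr_sumr; apply: le_trans (ler_wpM2l B0 h) _.
have n0 : 0 <= n%:R :> R by [].
rewrite mulrA ler_wpM2r// mulrA ler_pdivrMr; [nra|lra].
Qed.

Lemma conv_ge k x n m : (forall j, 0 <= k j) -> (forall j, 0 <= x j) ->
  (m <= n)%N -> k (n - m)%N * x m <= conv k x n.
Proof.
move=> k0 x0 mn; rewrite -ltnS in mn.
rewrite /conv (bigD1 (Ordinal mn))//= lerDl.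
by apply: sumr_ge0 => i _; rewrite mulr_ge0.
Qed.

(** Convolution with this weight dominates the maximum over [K + 1] consecutive
    blocks, see [window_ge]. *)
Definition window (K j : nat) : R := if (j <= K)%N then 1 else 0.

Lemma window_ge0 K j : 0 <= window K j.
Proof. by rewrite /window; case: ifP. Qed.

Lemma window_sum_le K n : \sum_(j < n) window K j <= K.+1%:R.
Proof.
elim: n => [|n IH]; first by rewrite big_ord0.
have [nK|Kn] := leqP n K.
  apply: (@le_trans _ _ (\sum_(j < n.+1) 1)).
    by apply: ler_sum => j _; rewrite /window; case: ifP.
  by rewrite sumr_const card_ord ler_nat ltnS.
by rewrite big_ord_recr/= /window leqNgt Kn addr0.
Qed.

Lemma cesaro0_window K x : cesaro0 x -> cesaro0 (conv (window K) x).
Proof. exact: cesaro0_conv (window_ge0 K) (window_sum_le K). Qed.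

Lemma window_ge K x n m : (forall j, 0 <= x j) -> (m <= n)%N -> (n <= m + K)%N ->
  x m <= conv (window K) x n.
Proof.
move=> x0 mn nmK; apply: le_trans (conv_ge (window_ge0 K) x0 mn).
by rewrite /window leq_subLR nmK mul1r.
Qed.

End Cesaro.

Section BlockMeans.
Context {R : realType}.
Notation mu := (@lebesgue_measure R).
Variables (h : R).
Hypothesis h0 : 0 < h.
Implicit Types (D : nat -> R) (n m : nat) (s t e a : R).

Let B m : set R := `[m%:R * h, m.+1%:R * h[%classic.

Definition block_step D n s : R := \sum_(m < n) D m * \1_(B m) s.

Let B_disj m m' s : B m s -> B m' s -> m = m'.
Proof. by rewrite /B /= !in_itv/=; exact: block_uniq. Qed.

Lemma block_step_in D n m s : (m < n)%N -> m%:R * h <= s < m.+1%:R * h ->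
  block_step D n s = D m.
Proof.
move=> mn ms; have Bm : B m s by rewrite /B /= in_itv.
rewrite /block_step (bigD1 (Ordinal mn))//= indicE mem_set// mulr1.
rewrite big1 ?addr0// => i im; rewrite indicE memNset ?mulr0// => Bi.
by move/eqP: im; apply; apply: val_inj; exact: (B_disj Bi Bm).
Qed.

Lemma block_step_out D n s : (forall m, (m < n)%N -> ~ (m%:R * h <= s < m.+1%:R * h)) ->
  block_step D n s = 0.
Proof.
move=> hs; rewrite /block_step big1// => m _; rewrite indicE memNset ?mulr0//.
by rewrite /B /= in_itv/=; exact: hs.
Qed.

Lemma block_step_ge0 D n s : (forall m, 0 <= D m) -> 0 <= block_step D n s.
Proof. by move=> D0; apply: sumr_ge0 => m _; rewrite mulr_ge0// indicE. Qed.

Let mB m : measurable (B m).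
Proof. exact: measurable_itv. Qed.

Let muB m : mu (B m) = h%:E.
Proof.
rewrite /B lebesgue_measure_itv/= lte_fin ltr_pM2r// ltr_nat ltnSn.
by rewrite -EFinB -natr1 mulrDl mul1r addrAC subrr add0r.
Qed.

Lemma integral_block_step (E : set R) D n : measurable E -> (forall m, 0 <= D m) ->
  (\int[mu]_(s in E) (block_step D n s)%:E
    = \sum_(m < n) ((D m)%:E * mu (B m `&` E)))%E.
Proof.
move=> mE D0; rewrite /block_step.
under eq_integral do rewrite -sumEFin.
rewrite ge0_integral_sum//; last 2 first.
- move=> m; apply/measurable_EFinP; apply: measurable_funM.
    exact: measurable_cst.
  by apply: measurable_indic; exact: mB.
- by move=> m s _; rewrite lee_fin mulr_ge0// indicE.
apply: eq_bigr => m _; under eq_integral do rewrite EFinM.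
rewrite ge0_integralZl_EFin//; last first.
  by apply/measurable_EFinP; apply: measurable_indic; exact: mB.
by rewrite integral_indic; [by []|exact: mE|exact: mB].
Qed.

Lemma vanishing_meanP a (w : R -> \bar R) : (forall s, a <= s -> (0 <= w s)%E) ->
  vanishing_mean a w <-> forall e, 0 < e -> exists2 T0, 0 < T0 &
    forall T, T0 <= T -> (\int[mu]_(s in `[a, T]) w s <= (e * T)%:E)%E.
Proof.
move=> w0.
have I0 T : (0 <= \int[mu]_(s in `[a, T]) w s)%E.
  by apply: integral_ge0 => s; rewrite /= in_itv/= => /andP[/w0].
rewrite /vanishing_mean; split=> hw.
  move=> e e0; have pos : \forall T \near +oo, (0 <= (T^-1)%:E *
      \int[mu]_(s in `[a, T]) w s)%E.
    near=> T; apply: mule_ge0 => //; rewrite lee_fin invr_ge0.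
    by near: T; apply: nbhs_pinfty_ge; exact: num_real.
  have [A [_ hA]] := (cvge0P _ pos).1 hw e e0.
  exists (Num.max 1 (A + 1)); first by rewrite lt_max ltr01.
  move=> T; rewrite ge_max => /andP[T1 AT]; have AT' : A < T by lra.
  have T0 : 0 < T by lra.
  have := hA T AT'; rewrite muleC lee_pdivrMr//.
apply/cvge0P.
  near=> T; apply: mule_ge0 => //; rewrite lee_fin invr_ge0.
  by near: T; apply: nbhs_pinfty_ge; exact: num_real.
move=> e /hw[T0 T00 hT]; near=> T.
have TT : T0 <= T by near: T; apply: nbhs_pinfty_ge; exact: num_real.
have Tp : 0 < T by lra.
by rewrite muleC lee_pdivrMr//; exact: hT.
Unshelve. all: by end_near. Qed.

(** The integral being monotone on all functions, [w] is compared with a step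
    function. *)
Lemma blocks_vanishing_mean a (w : R -> \bar R) : 0 <= a ->
  (forall s, a <= s -> (0 <= w s)%E) ->
  (forall e, 0 < e -> exists2 D, cesaro0 D &
     forall n s, a <= s -> n%:R * h <= s < n.+1%:R * h -> (w s <= (D n + e)%:E)%E) ->
  vanishing_mean a w.
Proof.
move=> a0 w0 hw; apply/vanishing_meanP => // e e0.
have e4 : 0 < e / 4 by lra.
have [D [D0 hD] wD] := hw _ e4; have [N hN] := hD _ e4.
exists (Num.max h (N%:R * h)); first by rewrite lt_max h0.
move=> T; rewrite ge_max => /andP[hT NT].
have T0 : 0 <= T by apply: le_trans hT; exact: ltW.
have [n /andP[nT Tn]] := block_exists h0 T0.
have Nn : (N <= n.+1)%N by apply: leqW; exact: (block_le h0 NT Tn).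
pose D' m := D m + e / 4.
have D'0 m : 0 <= D' m by rewrite addr_ge0// ltW.
apply: (@le_trans _ _ (\int[mu]_(s in `[a, T]) (block_step D' n.+1 s)%:E)%E).
  apply: ge0_le_integral_any => s; rewrite /= in_itv/= => /andP[as_ sT].
    exact: w0.
  have s0 : 0 <= s by exact: le_trans as_.
  have [m ms] := block_exists h0 s0.
  rewrite (@block_step_in _ _ m)//; first exact: wD.
  by case/andP: ms => ms _; rewrite ltnS; apply: (block_le h0 ms); apply: le_lt_trans Tn.
rewrite integral_block_step//.
apply: (@le_trans _ _ (\sum_(m < n.+1) D' m * h)%:E).
  rewrite -sumEFin; apply: lee_sum => m _; rewrite EFinM.
  apply: lee_wpmul2l; first by rewrite lee_fin; exact: D'0.
  rewrite -(muB m); apply: le_measure; rewrite ?inE//.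
    by apply: measurableI => //; exact: mB.
  exact: mB.
rewrite lee_fin -mulr_suml big_split/= sumr_const card_ord.
have := hN _ Nn; rewrite -(mulr_natr (e / 4)).
have nh : n.+1%:R * h <= T + h by rewrite -natr1 mulrDl mul1r lerD2r.
set S := \sum_(_ < _) _ => hS.
have : (S + e / 4 * n.+1%:R) * h <= (e / 4 * n.+1%:R + e / 4 * n.+1%:R) * h.
  by rewrite ler_wpM2r ?(ltW h0)// lerD2r.
have : e / 2 * (n.+1%:R * h) <= e / 2 * (T + h) by rewrite ler_wpM2l//; lra.
have : e / 2 * h <= e / 2 * T by rewrite ler_wpM2l//; lra.
lra.
Qed.

End BlockMeans.

Section WindowMeans.
Context {R : realType}.
Notation mu := (@lebesgue_measure R).
Variables (h : R) (K : nat).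
Hypotheses (h0 : 0 < h) (K2 : (2 <= K)%N).
Let r : R := K%:R * h.
Implicit Types (D : nat -> R) (n m : nat) (s t e a : R).

Definition window_sup (w : R -> \bar R) s : \bar R :=
  ereal_sup [set w tau | tau in `[s - r, s]].

Lemma window_sup_ge0 w s : (forall t, 0 <= t -> (0 <= w t)%E) -> r <= s ->
  (0 <= window_sup w s)%E.
Proof.
have r0 : 0 <= r by rewrite mulr_ge0// ltW.
move=> w0 rs; apply: (@le_trans _ _ (w s)); first by apply: w0; lra.
by apply: ereal_sup_ubound; exists s => //=; rewrite in_itv/= lexx; lra.
Qed.

(** The block [n] lies inside every window that ends in the block [n + 1]; as
    such windows only exist from [r] on, the first [K] blocks are not covered. *)
Lemma vanishing_mean_blocks (w : R -> \bar R) :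
  (forall t, 0 <= t -> (0 <= w t)%E) -> vanishing_mean r (window_sup w) ->
  exists2 D, cesaro0 D & forall n t, (K <= n)%N -> n%:R * h <= t <= n.+1%:R * h ->
    (w t <= (D n)%:E)%E.
Proof.
move=> w0 hw.
have r0 : 0 <= r by rewrite mulr_ge0// ltW.
have /vanishing_meanP := hw => /(_ (fun s => window_sup_ge0 w0)) hT.
pose Db n := ereal_sup [set w t | t in `[n%:R * h, n.+1%:R * h]].
have nh0 n : 0 <= n%:R * h by rewrite mulr_ge0// ltW.
have hS n : n.+1%:R * h = n%:R * h + h by rewrite -natr1 mulrDl mul1r.
have Db0 n : (0 <= Db n)%E.
  apply: (@le_trans _ _ (w (n%:R * h))); first exact: w0.
  by apply: ereal_sup_ubound; exists (n%:R * h) => //=; rewrite in_itv/= lexx hS; have := h0; lra.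
have DbW n s : n.+1%:R * h <= s < n.+2%:R * h -> (Db n <= window_sup w s)%E.
  move=> /andP[ns sn]; apply: ub_ereal_sup => _ [t /= + <-].
  rewrite in_itv/= => /andP[nt tn]; apply: ereal_sup_ubound; exists t => //=.
  rewrite in_itv/=; have : 2 * h <= r by rewrite ler_wpM2r ?(ltW h0)// ler_nat.
  by rewrite !hS in ns sn tn *; have := h0; lra.
have rK n : (K <= n)%N -> r <= n%:R * h.
  by move=> Kn; rewrite ler_wpM2r ?(ltW h0)// ler_nat.
have mI (i : interval R) : measurable ([set` i] : set R) by exact: measurable_itv.
have muBT n T : (K <= n)%N -> n.+2%:R * h <= T ->
    mu (`[n.+1%:R * h, n.+2%:R * h[%classic `&` `[r, T]%classic) = h%:E.
  move=> Kn nT; rewrite setIidl; last first.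
    move=> x /=; rewrite !in_itv/= => /andP[nx xn].
    by have := rK n Kn; rewrite !hS in nx xn nT *; have := h0; lra.
  rewrite lebesgue_measure_itv/= lte_fin ltr_pM2r// ltr_nat ltnSn.
  by rewrite -EFinB (hS n.+1) addrAC subrr add0r.
(* an infinite bound on one block would make the integrals infinite *)
have Dbfin n : (K <= n)%N -> (Db n < +oo)%E.
  move=> Kn; rewrite ltNge leye_eq; apply/negP => /eqP Dboo.
  have [T0 T00 hT0] := hT 1 ltr01.
  pose T := Num.max T0 (n.+2%:R * h).
  have TT : T0 <= T by rewrite le_max lexx.
  have nT : n.+2%:R * h <= T by rewrite le_max lexx orbT.
  have := hT0 T TT; rewrite mul1r leNgt => /negP; apply.
  pose c := (T + 1) / h.
  have c0 : 0 <= c by rewrite divr_ge0 ?(ltW h0)//; lra.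
  apply: (@lt_le_trans _ _ (\int[mu]_(s in `[r, T])
      (c * \1_(`[n.+1%:R * h, n.+2%:R * h[%classic) s)%:E)%E).
    under eq_integral do rewrite EFinM.
    rewrite ge0_integralZl_EFin; last 4 first.
    - exact: mI.
    - by move=> s _; rewrite lee_fin indicE.
    - by apply/measurable_EFinP; apply: measurable_indic; exact: mI.
    - exact: c0.
    rewrite integral_indic; [|exact: mI|exact: mI].
    rewrite [X in (_ * X)%E]muBT// -EFinM lte_fin /c divfK ?gt_eqF//; lra.
  apply: ge0_le_integral_any => s; rewrite /= in_itv/= => /andP[rs sT].
    by rewrite lee_fin mulr_ge0// indicE.
  rewrite indicE; case: (boolP (s \in _)) => [/set_mem/=|_]; last first.
    by rewrite mulr0; exact: window_sup_ge0.
  rewrite in_itv/= => /(DbW n); rewrite Dboo leye_eq => /eqP ->.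
  exact: leey.
pose D n := if (K <= n)%N then fine (Db n) else 0.
have D0 n : 0 <= D n by rewrite /D; case: ifP => // _; exact: fine_ge0.
have DE n : (K <= n)%N -> (D n)%:E = Db n.
  by move=> Kn; rewrite /D Kn fineK// ge0_fin_numE// Dbfin.
exists D; last first.
  move=> n t Kn nt; rewrite DE//; apply: ereal_sup_ubound.
  by exists t.
split=> // e e0.
have e2 : 0 < e * h / 2 by rewrite divr_gt0// mulr_gt0.
have e2' : 0 < e / 2 by lra.
have [T0 T00 hT0] := hT _ e2'.
have T0h : 0 <= T0 / h by rewrite divr_ge0 ?ltW.
exists (maxn 2 (Num.bound (T0 / h))) => n; rewrite geq_max => /andP[n2 nb].
pose T := n.+1%:R * h.
have TT : T0 <= T.
  rewrite -ler_pdivrMr//; apply/ltW/(lt_le_trans (archi_boundP T0h)).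
  by rewrite ler_nat leqW.
pose D' m := if m is m'.+1 then D m' else 0.
have D'0 m : 0 <= D' m by case: m => [|m]/=.
have := hT0 T TT.
have le1 : (\int[mu]_(s in `[r, T]) (block_step h D' n.+1 s)%:E <=
    \int[mu]_(s in `[r, T]) window_sup w s)%E.
  apply: ge0_le_integral_any => s; rewrite /= in_itv/= => /andP[rs sT].
    by rewrite lee_fin block_step_ge0.
  have s0 : 0 <= s by lra.
  have [m ms] := block_exists h0 s0.
  have [mn|nm] := ltnP m n.+1; last first.
    rewrite block_step_out; first exact: window_sup_ge0.
    move=> m' m'n ms'; move: nm; rewrite (block_uniq h0 ms ms').
    by rewrite leqNgt m'n.
  rewrite (@block_step_in _ _ h0 _ _ m)//; case: m ms mn => [|m] ms mn /=.
    exact: window_sup_ge0.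
  have [Km|mK] := leqP K m; first by rewrite DE//; exact: DbW.
  by rewrite /D leqNgt mK; exact: window_sup_ge0.
move=> /(le_trans le1); rewrite integral_block_step//.
pose I (m : nat) : set R := `[m%:R * h, m.+1%:R * h[%classic `&` `[r, T]%classic.
have -> : (\sum_(m < n.+1) ((D' m)%:E * mu (I m)) = (\sum_(m < n) (D m * h)%R)%:E)%E.
  rewrite big_ord_recl /= mul0e add0e -sumEFin; apply: eq_bigr => m _ /=.
  have [Km|mK] := leqP K m; last by rewrite /D leqNgt mK mul0e mul0r.
  rewrite EFinM; congr (_ * _)%E; apply: muBT => //.
  by rewrite ler_wpM2r ?(ltW h0)// ler_nat ltnS.
rewrite lee_fin -mulr_suml /T mulrA ler_pM2r// => hD.
apply: le_trans hD _; apply: (@le_trans _ _ (e / 2 * (2 * n%:R))).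
  rewrite ler_wpM2l ?(ltW e2')// -natr1.
  have : 1 <= n%:R :> R by rewrite ler1n ltnW.
  by lra.
lra.
Qed.

End WindowMeans.

(** * Histories *)

Section Histories.
Context {R : realType} {X : normedModType R[i]}.
Implicit Types (u psi : R -> X) (r t s e k : R) (F : R -> (R -> X) -> X).

Lemma hist_norm_le r psi k : 0 < r ->
  (forall th, - r <= th <= 0 -> rnorm (psi th) <= k) -> hist_norm r psi <= k.
Proof.
move=> r0 hk; apply: ge_sup.
  by exists (rnorm (psi 0)), 0 => //=; rewrite in_itv/= lexx; lra.
by move=> _ [th /= + <-]; rewrite in_itv/=; exact: hk.
Qed.

Lemma hist_norm_ge0 r psi : 0 < r -> 0 <= hist_norm r psi.
Proof.
move=> r0; rewrite /hist_norm; set A := [set _ | _ in _].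
have [hA|hA] := pselect (has_ubound A); last by rewrite sup_out// => -[].
apply: le_trans (rnorm_ge0 (psi 0)) _; apply: ub_le_sup => //.
by exists 0 => //=; rewrite in_itv/= lexx; lra.
Qed.

Lemma hist_space_history r u t : 0 <= t -> {within `[- r, +oo[, continuous u} ->
  hist_space r (history u t).
Proof.
move=> t0 /within_continuousP cu; apply/within_continuousP => th.
rewrite /= in_itv/= => /andP[th1 th2] e e0.
have [|d d0 H] := cu (t + th) _ e e0; first by rewrite /= in_itv/= andbT; lra.
exists d => // s; rewrite /= in_itv/= => /andP[s1 s2] sth; apply: H.
  by rewrite /= in_itv/= andbT; lra.
by rewrite opprD addrACA subrr add0r.
Qed.

(** Uniform continuity of [u] on compact intervals makes [t |-> u_t] continuous
    for the uniform topology on histories. *)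
Lemma continuous_along_history r F u : 0 < r -> hist_continuous r F ->
  {within `[- r, +oo[, continuous u} ->
  {within `[0, +oo[, continuous (fun t => F t (history u t))}.
Proof.
move=> r0 cF cu; apply/within_continuousP => t; rewrite /= in_itv/= andbT => t0 e e0.
pose A := [set q : R * {uniform` `[- r, 0] -> X} | 0 <= q.1 /\ hist_space r q.2].
pose q s : R * {uniform` `[- r, 0] -> X} := (s, history u s).
have Aq s : 0 <= s -> A (q s) by move=> s0; split=> //; exact: hist_space_history.
have := (subspace_continuousP A
  (fun q : R * {uniform` `[- r, 0] -> X} => F q.1 q.2)).1 cF _ (Aq t t0).
move=> /cvg_rnormP/(_ e e0).
rewrite near_withinE => -[[U V] /= [hU hV] UV].
have /nbhs_ballP[d1 /= d10 H1] := hU.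
have [E [entE HV]] := (uniform_nbhs _ _).1 hV.
move: entE; rewrite -entourage_ballE => -[e1 /= e10 HE].
have e1E : e1 = (complex.Re e1)%:C.
  by move: e10; rewrite ltcE => /andP[/= /eqP ei _]; move: ei; case: (e1) => ? ? /= ->.
have e1r : 0 < complex.Re e1 by move: e10; rewrite ltcE => /andP[].
have cu' : {within `[- r, t + 1], continuous u}.
  by apply: continuous_subspaceW cu => x; rewrite /= !in_itv/= andbT => /andP[].
have [d2 d20 H2] := uniformly_continuous_itv cu' e1r.
exists (Num.min 1 (Num.min d1 d2)); first by rewrite !lt_min ltr01 d10 d20.
move=> s; rewrite /= in_itv/= andbT => s0; rewrite !lt_min => /andP[st1 /andP[std1 std2]].
rewrite rnormBC; apply: (UV (q s)); last exact: Aq.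
split=> /=; first by apply: H1; rewrite /ball/= distrC.
apply: HV => th /=; rewrite in_itv/= => /andP[th1 th2].
apply: HE => /=; rewrite -ball_normE/= e1E rnormE ltcR /history.
have st : s <= t + 1 by move: st1; rewrite ltr_norml => /andP[]; lra.
apply: H2; [by apply/andP; split; lra|by apply/andP; split; lra|].
by rewrite opprD addrACA subrr addr0 distrC.
Qed.

Lemma within_continuous_glue a b u : a <= b -> {within `[a, b], continuous u} ->
  {within `[b, +oo[, continuous u} -> {within `[a, +oo[, continuous u}.
Proof.
move=> ab cl cr; apply: (@continuous_subspaceW _ _ _ (`[a, b] `|` `[b, +oo[)).
  move=> t; rewrite /= !in_itv/= !andbT => at_.
  by case: (leP t b) => tb; [left; rewrite at_|right; rewrite ltW].
by apply: withinU_continuous; [exact: interval_closed|exact: interval_closed| |].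
Qed.

Lemma eq_within_continuous (D : set R) u (v : R -> X) :
  (forall t, D t -> u t = v t) -> {within D, continuous u} ->
  {within D, continuous v}.
Proof. by move=> uv; apply: subspace_eq_continuous => t /set_mem /uv. Qed.

End Histories.

(** * Convolution with the solution operator *)

Section Convolution.
Context {R : realType} {X : completeNormedModType R[i]}.
Notation mu := (@lebesgue_measure R).
Variables (alpha m K : R) (S : R -> {linear X -> X}).
Hypotheses (alpha_gt1 : 1 < alpha) (m_gt0 : 0 < m) (K_ge0 : 0 <= K).
Hypothesis S_le : forall t x, 0 <= t -> rnorm (S t x) <= kernel K m alpha t * rnorm x.
Hypothesis S_cont : forall x, {within `[0, +oo[, continuous (fun t => S t x)}.
Implicit Types (F G : R -> X) (a b c s t : R).

Lemma solution_operator_le t x : 0 <= t -> rnorm (S t x) <= K * rnorm x.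
Proof.
move=> t0; apply: le_trans (S_le x t0) _; apply: ler_wpM2r; first exact: rnorm_ge0.
exact: kernel_le.
Qed.

Lemma continuous_convolution F a t : {within `[a, t], continuous F} ->
  {within `[a, t], continuous (fun s => S (t - s) (F s))}.
Proof.
move=> /within_continuousP cF; apply/within_continuousP => s0 Ds0 e e0.
have K1 : 0 < K + 1 by have := K_ge0; lra.
have e1 : 0 < e / 2 / (K + 1) by rewrite !divr_gt0.
have e2 : 0 < e / 2 by lra.
have [d1 d10 H1] := cF s0 Ds0 _ e1.
have s0t : s0 <= t by move: Ds0; rewrite /= in_itv/= => /andP[].
have [|d2 d20 H2] := (within_continuousP _ _).1 (@S_cont (F s0)) (t - s0) _ _ e2.
  by rewrite /= in_itv/= andbT subr_ge0.
exists (Num.min d1 d2); first by rewrite lt_min d10.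
move=> s Ds; rewrite lt_min => /andP[sd1 sd2].
have st : s <= t by move: Ds; rewrite /= in_itv/= => /andP[].
have h2 : rnorm (S (t - s) (F s0) - S (t - s0) (F s0)) < e / 2.
  apply: H2; first by rewrite /= in_itv/= andbT subr_ge0.
  have -> : t - s - (t - s0) = - (s - s0) by ring.
  by rewrite normrN.
have h1 : rnorm (S (t - s) (F s) - S (t - s) (F s0)) <= e / 2.
  rewrite -linearB; apply: le_trans (solution_operator_le _ _) _.
    by rewrite subr_ge0.
  have := H1 s Ds sd1; rewrite ltr_pdivlMr// => h.
  by have := rnorm_ge0 (F s - F s0); lra.
by have := rnormBD (S (t - s) (F s)) (S (t - s) (F s0)) (S (t - s0) (F s0)); lra.
Qed.

Lemma measurable_convolution F a t : {within `[a, t], continuous F} ->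
  measurable_fun `[a, t] (fun s => rnorm (S (t - s) (F s))).
Proof.
move=> cF; apply: (@measurable_continuous_itv _ a t (fun s => rnorm (S (t - s) (F s)))).
apply: (@within_continuous_rnorm _ _ _ (fun s => S (t - s) (F s))).
exact: continuous_convolution.
Qed.

Definition mild_conv F t : X :=
  xget 0 [set v | bochner_integral mu `[0, t] (fun s => S (t - s) (F s)) v].

Lemma within_ray_itv F t : {within `[0, +oo[, continuous F} ->
  {within `[0, t], continuous F}.
Proof.
move=> cF; apply: continuous_subspaceW cF => x.
by rewrite /= !in_itv/= andbT => /andP[].
Qed.

Lemma mild_convP F t : 0 <= t -> {within `[0, +oo[, continuous F} ->
  bochner_integral mu `[0, t] (fun s => S (t - s) (F s)) (mild_conv F t).
Proof.
move=> t0 cF; have [v hv] := bochner_exists t0 (continuous_convolution (within_ray_itv (t := t) cF)).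
exact: (xgetPex 0 (ex_intro _ v hv)).
Qed.

Lemma mild_conv_unique F t v : 0 <= t -> {within `[0, +oo[, continuous F} ->
  bochner_integral mu `[0, t] (fun s => S (t - s) (F s)) v -> v = mild_conv F t.
Proof.
move=> t0 cF hv; apply/eqP; rewrite -subr_eq0; apply/eqP/rnorm_eq0/eqP.
rewrite eq_le rnorm_ge0 andbT -lee_fin.
apply: le_trans (bochner_dist_le _ _ hv (mild_convP t0 cF)) _.
- exact: measurable_itv.
- rewrite (_ : (fun s => _) = cst 0); first exact: measurable_cst.
  by apply/funext => s; rewrite subrr rnorm0.
- by rewrite integral0_eq// => s _; rewrite subrr rnorm0.
Qed.

(** The growth [A + c * L] covers forcing terms that are Lipschitz in the history
    and bounded at the zero history, along a bounded function. *)
Lemma mild_conv_le p (L : R -> R) F t A c : 1 <= p -> BS_pos p L -> 0 <= A -> 0 <= c ->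
  0 <= t -> {within `[0, +oo[, continuous F} ->
  (forall s, 0 <= s <= t -> rnorm (F s) <= A + c * L s) ->
  rnorm (mild_conv F t) <= kernel_mass K m alpha * (A + c * fine (stepanov_norm p L)).
Proof.
move=> p1 hL A0 c0 t0 cF hF; rewrite -lee_fin.
have mF := measurable_convolution (within_ray_itv (t := t) cF).
apply: le_trans (bochner_rnorm_le _ _ (mild_convP t0 cF)) _.
- exact: measurable_itv.
- exact: mF.
apply: kernel_integral_le => // s /andP[s0 st]; rewrite rnorm_ge0/=.
have ts0 : 0 <= t - s by rewrite subr_ge0.
apply: le_trans (S_le _ ts0) _; apply: ler_wpM2l; first exact: kernel_ge0.
by apply: hF; rewrite s0.
Qed.

Lemma mild_conv_dist_le p (L : R -> R) F G t c : 1 <= p -> BS_pos p L -> 0 <= c ->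
  0 <= t -> {within `[0, +oo[, continuous F} -> {within `[0, +oo[, continuous G} ->
  (forall s, 0 <= s <= t -> rnorm (F s - G s) <= c * L s) ->
  rnorm (mild_conv F t - mild_conv G t)
    <= kernel_mass K m alpha * (c * fine (stepanov_norm p L)).
Proof.
move=> p1 hL c0 t0 cF cG hFG; rewrite -lee_fin.
have mFG : measurable_fun `[0, t] (fun s => rnorm (S (t - s) (F s) - S (t - s) (G s))).
  apply: (@eq_measurable_fun _ _ _ _ _ (fun s => rnorm (S (t - s) (F s - G s)))).
    by move=> s _; rewrite linearB.
  apply: (@measurable_convolution (fun s => F s - G s)).
  by apply: within_continuousB; exact: within_ray_itv.
apply: le_trans (bochner_dist_le _ _ (mild_convP t0 cF) (mild_convP t0 cG)) _.
- exact: measurable_itv.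
- exact: mFG.
rewrite -[X in kernel_mass _ _ _ * X]add0r.
apply: kernel_integral_le => // s /andP[s0 st]; rewrite rnorm_ge0/=.
have ts0 : 0 <= t - s by rewrite subr_ge0.
rewrite -linearB; apply: le_trans (S_le _ ts0) _.
apply: ler_wpM2l; first exact: kernel_ge0.
by rewrite add0r; apply: hFG; rewrite s0.
Qed.

(** Translated by [c], the convolution at [t + c] runs over [[- c, t]] with the
    same lag [t - s] as the convolution at [t]; on the additional part [[- c, 0]]
    the lag is at least [t]. *)
Lemma mild_conv_shift_le F t c M1 : 0 <= t -> 0 <= c ->
  {within `[0, +oo[, continuous F} ->
  (forall s, 0 <= s <= c -> rnorm (F s) <= M1) ->
  ((rnorm (mild_conv F (t + c) - mild_conv F t))%:E <=
    (kernel K m alpha t * M1 * c)%:E +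
    \int[mu]_(s in `[0%R, t]) (rnorm (S (t - s) (F (s + c) - F s)))%:E)%E.
Proof.
move=> t0 c0 cF hM1.
have M10 : 0 <= M1 by apply: le_trans (rnorm_ge0 _) (hM1 0 _); rewrite lexx.
have tc0 : 0 <= t + c by rewrite addr_ge0.
have := bochner_shift (- c) (mild_convP tc0 cF).
rewrite add0r addrK => hv.
have {}hv : bochner_integral mu `[- c, t] (fun s => S (t - s) (F (s + c)))
    (mild_conv F (t + c)).
  apply: eq_bochner_integral hv => s _.
  by rewrite opprK; congr (S _ _); ring.
have sub : `[0, t]%classic `<=` `[- c, t]%classic.
  by move=> x /=; rewrite !in_itv/= => /andP[x0 ->]; rewrite andbT; lra.
have hw : bochner_integral mu `[- c, t]
    (fun s => if s \in `[0, t]%classic then S (t - s) (F s) else 0) (mild_conv F t).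
  apply: bochner_extend (mild_convP t0 cF); [|  |exact: sub].
    exact: measurable_itv.
  exact: measurable_itv.
have cFc : {within `[- c, +oo[, continuous (fun s => F (s + c))}.
  apply/within_continuousP => s; rewrite /= in_itv/= andbT => cs e e0.
  have [|d d0 H] := (within_continuousP _ _).1 cF (s + c) _ e e0.
    by rewrite /= in_itv/= andbT; lra.
  exists d => // s'; rewrite /= in_itv/= andbT => cs' ss'; apply: H.
    by rewrite /= in_itv/= andbT; lra.
  by rewrite opprD addrACA subrr addr0.
have cFc' a : - c <= a -> {within `[a, t], continuous (fun s => F (s + c))}.
  move=> ca; apply: continuous_subspaceW cFc => x.
  by rewrite /= !in_itv/= andbT => /andP[/(le_trans ca)].
have E : `[- c, t]%classic = `[- c, 0[%classic `|` `[0, t]%classic :> set R.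
  apply/seteqP; split=> x /=; rewrite !in_itv/=.
    by move=> /andP[cx xt]; have [x0|x0] := ltP x 0; [left; rewrite cx|right; rewrite xt].
  by move=> [/andP[-> x0]|/andP[x0 ->]]; rewrite ?andbT; lra.
pose a s := rnorm (S (t - s) (F (s + c)) -
  (if s \in `[0, t]%classic then S (t - s) (F s) else 0)).
have aneg s : `[- c, 0[%classic s -> a s = rnorm (S (t - s) (F (s + c))).
  rewrite /= in_itv/= => /andP[_ s0]; rewrite /a memNset ?subr0//=.
  by rewrite in_itv/= leNgt s0.
have apos s : `[0, t]%classic s -> a s = rnorm (S (t - s) (F (s + c) - F s)).
  by move=> s0t; rewrite /a mem_set// linearB.
have mneg : measurable_fun `[- c, 0[ a.
  apply: (@eq_measurable_fun _ _ _ _ _ (fun s => rnorm (S (t - s) (F (s + c))))).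
    by move=> s /set_mem /aneg ->.
  apply: measurable_funS (measurable_convolution (cFc' _ (lexx _))) => //.
  by move=> x /=; rewrite !in_itv/= => /andP[-> x0]; rewrite /=; lra.
have mpos : measurable_fun `[0, t] a.
  apply: (@eq_measurable_fun _ _ _ _ _ (fun s => rnorm (S (t - s) (F (s + c) - F s)))).
    by move=> s /set_mem /apos ->.
  apply: (@measurable_convolution (fun s => F (s + c) - F s)).
  apply: within_continuousB; last exact: within_ray_itv.
  by apply: cFc'; lra.
have mE : measurable_fun `[- c, t] a by rewrite E; apply/measurable_funU.
apply: le_trans (bochner_dist_le _ _ hv hw) _.
- exact: measurable_itv.
- exact: mE.
rewrite [X in integral _ X _]E ge0_integral_setU; last 5 first.
- exact: measurable_itv.
- exact: measurable_itv.
- by apply/measurable_EFinP; rewrite -E.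
- by move=> s _; rewrite lee_fin rnorm_ge0.
- apply/disj_setPS => s [/=]; rewrite !in_itv/= => /andP[_ s0] /andP[s0' _]; lra.
apply: leeD.
  apply: (@le_trans _ _ (\int[mu]_(s in `[(- c)%R, 0%R[) (kernel K m alpha t * M1)%:E)%E).
    apply: ge0_le_integral_any => s; first by rewrite lee_fin rnorm_ge0.
    move=> hs; rewrite -/(a s) aneg//; move: hs; rewrite /= in_itv/= => /andP[cs s0].
    rewrite lee_fin; apply: le_trans (S_le _ _) _; first by lra.
    apply: ler_pM; [exact: kernel_ge0|exact: rnorm_ge0| |].
      by apply: kernel_decr => //; have := alpha_gt1; lra.
    by apply: hM1; lra.
  rewrite integral_cst//= lebesgue_measure_itv/= lte_fin oppr_lt0.
  case: ltP => c0x; first by rewrite -EFinD -EFinM lee_fin add0r opprK.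
  by rewrite mule0 lee_fin; do 2?apply: mulr_ge0 => //; exact: kernel_ge0.
rewrite le_eqVlt; apply/orP; left; apply/eqP.
by apply: eq_integral => s /set_mem hs; rewrite -apos.
Qed.

Lemma continuous_mild_conv F : {within `[0, +oo[, continuous F} ->
  {within `[0, +oo[, continuous (mild_conv F)}.
Proof.
move=> cF; apply/within_continuousP => t0; rewrite /= in_itv/= andbT => t00 e e0.
pose T := t0 + 1.
have [M1 M10 hM1] := bounded_on_itv (within_ray_itv (t := T + 1) cF).
have den : 0 < K * M1 + K * T + 1.
  by rewrite ltr_wpDl// addr_ge0// mulr_ge0 ?K_ge0// /T; lra.
pose e1 := e / (K * M1 + K * T + 1).
have e10 : 0 < e1 by rewrite divr_gt0.
have [d d0 H] := uniformly_continuous_itv (within_ray_itv (t := T + 1) cF) e10.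
have main t c : 0 <= t -> 0 <= c -> t <= T -> c <= 1 -> c < d -> c <= e1 ->
    rnorm (mild_conv F (t + c) - mild_conv F t) < e.
  move=> t1 c0 tT c1 cd ce1.
  have hM c' s : c' <= T + 1 -> 0 <= s <= c' -> rnorm (F s) <= M1.
    by move=> c'T /andP[s0 sc]; apply: hM1; rewrite s0; lra.
  have Tc : c <= T + 1 by rewrite /T; lra.
  have hle := mild_conv_shift_le t1 c0 cF (fun s => hM c s Tc).
  have hI : (\int[mu]_(s in `[0%R, t]) (rnorm (S (t - s) (F (s + c) - F s)))%:E
      <= (K * e1 * t)%:E)%E.
    apply: (@le_trans _ _ (\int[mu]_(s in `[0%R, t]) (K * e1)%:E)%E).
      apply: ge0_le_integral_any => s; first by rewrite lee_fin rnorm_ge0.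
      rewrite /= in_itv/= => /andP[s0 st]; rewrite lee_fin.
      apply: le_trans (solution_operator_le _ _) _; first by lra.
      apply: ler_wpM2l; first exact: K_ge0.
      apply/ltW/H; [by lra|by lra|].
      by rewrite addrAC subrr add0r ger0_norm.
    rewrite integral_cst//= lebesgue_measure_itv/= lte_fin.
    case: ltP => t'; first by rewrite sube0 -EFinM.
    rewrite mule0 lee_fin; apply: mulr_ge0 => //; apply: mulr_ge0 => //; exact: ltW.
  have := le_trans hle (leeD2l _ hI); rewrite -EFinD lee_fin => h.
  apply: le_lt_trans h _.
  have k1 := kernel_le alpha t K_ge0 m_gt0.
  have : kernel K m alpha t * M1 * c <= K * M1 * e1.
    apply: ler_pM => //; first by rewrite mulr_ge0// kernel_ge0.
    by apply: ler_wpM2r.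
  have : K * e1 * t <= K * e1 * T.
    by apply: ler_wpM2l => //; rewrite mulr_ge0// ltW.
  have : e1 * (K * M1 + K * T + 1) = e by rewrite /e1 divfK// gt_eqF.
  lra.
exists (Num.min (Num.min 1 d) e1); first by rewrite !lt_min ltr01 d0 e10.
move=> t; rewrite /= in_itv/= andbT => t_0; rewrite !lt_min => /andP[/andP[h1 h2] h3].
have [tt0|t0t] := leP t t0.
  rewrite ler0_norm ?subr_le0// in h1 h2 h3.
  have -> : t0 = t + (t0 - t) by rewrite addrC subrK.
  by rewrite rnormBC; apply: main; rewrite /T; lra.
rewrite ger0_norm ?subr_ge0 ?(ltW t0t)// in h1 h2 h3.
have -> : t = t0 + (t - t0) by rewrite addrC subrK.
by apply: main; rewrite /T; lra.
Qed.

End Convolution.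

(** * The fixed point operator *)

Section FixedPointOperator.
Context {R : realType} {X : completeNormedModType R[i]}.
Variables (alpha m K r p : R) (S : R -> {linear X -> X}).
Variables (phi : R -> X) (f g : R -> (R -> X) -> X) (Lf Lg : R -> R).
Hypotheses (alpha_gt1 : 1 < alpha) (m_gt0 : 0 < m) (K_ge0 : 0 <= K).
Hypothesis S_le : forall t x, 0 <= t -> rnorm (S t x) <= kernel K m alpha t * rnorm x.
Hypothesis S_cont : forall x, {within `[0, +oo[, continuous (fun t => S t x)}.
Hypothesis S_at0 : forall x, S 0 x = x.
Hypotheses (r_gt0 : 0 < r) (p_ge1 : 1 <= p).
Hypothesis phi_hist : hist_space r phi.
Hypotheses (f_cont : hist_continuous r f) (g_cont : hist_continuous r g).
Hypotheses (f_zero : Cb 0 (fun t => f t (cst 0))) (g_zero : Cb 0 (fun t => g t (cst 0))).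
Hypotheses (Lg_pos : Cb_pos Lg) (Lf_BS : BS_pos p Lf).
Hypothesis g_lip : forall psi psi' t, hist_space r psi -> hist_space r psi' ->
  0 <= t -> rnorm (g t psi - g t psi') <= Lg t * hist_norm r (psi - psi').
Hypothesis f_lip : forall psi psi' t, hist_space r psi -> hist_space r psi' ->
  0 <= t -> rnorm (f t psi - f t psi') <= Lf t * hist_norm r (psi - psi').
Implicit Types (u v : R -> X) (t s d k : R).

Let N : R := fine (stepanov_norm p Lf).
Let ng : R := Cb_pos_norm Lg.

Lemma Cb_pos_norm_ub t : 0 <= t -> 0 <= Lg t <= ng.
Proof.
have [_ Lg0 [k hk]] := Lg_pos => t0; rewrite Lg0//=.
have -> : Lg t = `|Lg t| by rewrite ger0_norm// Lg0.
apply: ub_le_sup; last by exists t => //=; rewrite in_itv/= t0.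
by exists k => _ [s /= + <-]; rewrite in_itv/= andbT => s0; rewrite ger0_norm ?Lg0// hk.
Qed.

Lemma Cb_pos_norm_ge0 : 0 <= ng.
Proof. by have /andP[] := Cb_pos_norm_ub (lexx 0); exact: le_trans. Qed.

Definition admissible u := [/\ {within `[- r, +oo[, continuous u},
  exists2 k, 0 <= k & forall t, - r <= t -> rnorm (u t) <= k &
  forall th, - r <= th <= 0 -> u th = phi th].

Lemma hist_norm_history_dist u v t d : 0 <= t ->
  (forall s, - r <= s -> rnorm (u s - v s) <= d) ->
  hist_norm r (history u t - history v t) <= d.
Proof.
move=> t0 uv; apply: hist_norm_le => // th /andP[th1 th2].
by rewrite /history; apply: uv; have := r_gt0; lra.
Qed.

Lemma hist_space_cst0 : hist_space r (cst 0 : R -> X).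
Proof. by apply: continuous_subspaceT => x; exact: cvg_cst. Qed.

Lemma forcing_growth u k : {within `[- r, +oo[, continuous u} ->
  (forall t, - r <= t -> rnorm (u t) <= k) ->
  exists2 A, 0 <= A & forall s, 0 <= s -> rnorm (f s (history u s)) <= A + k * Lf s.
Proof.
move=> cu uk; have [_ [A hA]] := f_zero.
exists A; first by apply: le_trans (rnorm_ge0 _) (hA 0 (lexx _)).
move=> s s0; have [_ Lf0 _] := Lf_BS.
have := rnormD (f s (history u s) - f s (cst 0)) (f s (cst 0)); rewrite subrK.
have := f_lip (hist_space_history s0 cu) hist_space_cst0 s0.
have : Lf s * hist_norm r (history u s - cst 0) <= k * Lf s.
  rewrite mulrC ler_wpM2r ?Lf0//.
  apply: (@hist_norm_history_dist u (cst 0) s k s0) => x rx.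
  by rewrite subr0; exact: uk.
by have := hA s s0; lra.
Qed.

Lemma g_growth u k : {within `[- r, +oo[, continuous u} ->
  (forall t, - r <= t -> rnorm (u t) <= k) -> 0 <= k ->
  exists2 A, 0 <= A & forall s, 0 <= s -> rnorm (g s (history u s)) <= A.
Proof.
move=> cu uk k0; have [_ [A hA]] := g_zero.
have A0 : 0 <= A by apply: le_trans (rnorm_ge0 _) (hA 0 (lexx _)).
exists (A + ng * k); first by rewrite addr_ge0// mulr_ge0// Cb_pos_norm_ge0.
move=> s s0.
have := rnormD (g s (history u s) - g s (cst 0)) (g s (cst 0)); rewrite subrK.
have := g_lip (hist_space_history s0 cu) hist_space_cst0 s0.
have /andP[Lg0 Lgn] := Cb_pos_norm_ub s0.
have : Lg s * hist_norm r (history u s - cst 0) <= ng * k.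
  apply: ler_pM => //; first exact: hist_norm_ge0.
  apply: (@hist_norm_history_dist u (cst 0) s k s0) => x rx.
  by rewrite subr0; exact: uk.
by have := hA s s0; lra.
Qed.

Definition forcing u s : X := f s (history u s).

Lemma continuous_forcing u : {within `[- r, +oo[, continuous u} ->
  {within `[0, +oo[, continuous (forcing u)}.
Proof. exact: continuous_along_history. Qed.

Definition mild_map u t : X :=
  if t < 0 then phi t
  else S t (phi 0 - g 0 phi) + g t (history u t) + mild_conv S (forcing u) t.

Lemma mild_mapE u t : 0 <= t -> mild_map u t =
  S t (phi 0 - g 0 phi) + g t (history u t) + mild_conv S (forcing u) t.
Proof. by rewrite /mild_map ltNge => ->. Qed.

Lemma kernel_mass_ge0 : 0 <= kernel_mass K m alpha.
Proof.
by have := kernel_sum_le_mass 0 K_ge0 m_gt0 alpha_gt1; rewrite big_ord0.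
Qed.

Lemma stepanov_ge0 : 0 <= N.
Proof. by rewrite fine_ge0// stepanov_norm_ge0. Qed.

Lemma mild_map_dist_le u v d : 0 <= d -> {within `[- r, +oo[, continuous u} ->
  {within `[- r, +oo[, continuous v} ->
  (forall t, - r <= t -> rnorm (u t - v t) <= d) ->
  forall t, - r <= t -> rnorm (mild_map u t - mild_map v t)
    <= (ng + kernel_mass K m alpha * N) * d.
Proof.
move=> d0 cu cv uv t rt; case: (ltP t 0) => t0.
  rewrite /mild_map t0 subrr rnorm0 mulr_ge0// addr_ge0 ?Cb_pos_norm_ge0//.
  by rewrite mulr_ge0 ?kernel_mass_ge0 ?stepanov_ge0.
rewrite !mild_mapE//.
have hg : rnorm (g t (history u t) - g t (history v t)) <= ng * d.
  apply: le_trans (g_lip (hist_space_history t0 cu) (hist_space_history t0 cv) t0) _.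
  have /andP[Lg0 Lgn] := Cb_pos_norm_ub t0.
  by apply: ler_pM => //; [exact: hist_norm_ge0|exact: hist_norm_history_dist].
have hf : rnorm (mild_conv S (forcing u) t - mild_conv S (forcing v) t)
    <= kernel_mass K m alpha * (d * N).
  apply: mild_conv_dist_le => //; [exact: continuous_forcing|exact: continuous_forcing|].
  move=> s /andP[s0 st]; have [_ Lf0 _] := Lf_BS.
  apply: le_trans (f_lip (hist_space_history s0 cu) (hist_space_history s0 cv) s0) _.
  by rewrite mulrC ler_wpM2r ?Lf0//; exact: hist_norm_history_dist.
set x := S t _.
have -> : x + g t (history u t) + mild_conv S (forcing u) t -
    (x + g t (history v t) + mild_conv S (forcing v) t) =
    (g t (history u t) - g t (history v t)) +
    (mild_conv S (forcing u) t - mild_conv S (forcing v) t).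
  by rewrite !opprD addrACA; congr (_ + _); rewrite addrACA subrr add0r.
by apply: le_trans (rnormD _ _) _; lra.
Qed.

(** Continuity at [0] is where [S 0 x = x] enters. *)
Lemma mild_map_admissible u : admissible u -> admissible (mild_map u).
Proof.
move=> [cu [k k0 uk] uphi].
have cF := continuous_forcing cu.
have conv0 : mild_conv S (forcing u) 0 = 0.
  apply/rnorm_eq0/eqP; rewrite eq_le rnorm_ge0 andbT.
  have [M1 M10 hM1] := bounded_on_itv (within_ray_itv (t := 0) cF).
  rewrite -lee_fin.
  have mF := measurable_convolution m_gt0 K_ge0 S_le S_cont (within_ray_itv (t := 0) cF).
  have hP := mild_convP m_gt0 K_ge0 S_le S_cont (lexx 0) cF.
  apply: le_trans (bochner_rnorm_le _ _ hP) _.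
  - exact: measurable_itv.
  - exact: mF.
  - by rewrite set_itv1 integral_set1.
have at0 : mild_map u 0 = phi 0.
  have r0 := r_gt0.
  rewrite mild_mapE// S_at0 conv0 addr0.
  have -> : g 0 (history u 0) = g 0 phi.
    apply/eqP; rewrite -subr_eq0; apply/eqP/rnorm_eq0/eqP.
    rewrite eq_le rnorm_ge0 andbT.
    apply: le_trans (g_lip (hist_space_history (lexx 0) cu) phi_hist (lexx 0)) _.
    have /andP[Lg0 _] := Cb_pos_norm_ub (lexx 0).
    apply: mulr_ge0_le0 => //; apply: hist_norm_le => // th thr.
    change (rnorm (u (0 + th) - phi th) <= 0).
    by rewrite add0r uphi// subrr rnorm0.
  by rewrite subrK.
have onphi th : - r <= th <= 0 -> mild_map u th = phi th.
  move=> /andP[_ th0]; case: (ltP th 0) => th1; first by rewrite /mild_map th1.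
  by have -> : th = 0 by apply/eqP; rewrite eq_le th0.
have cpos : {within `[0, +oo[, continuous (mild_map u)}.
  apply: (@eq_within_continuous _ _ _ (fun t =>
    (S t (phi 0 - g 0 phi) + g t (history u t)) + mild_conv S (forcing u) t)).
    by move=> t; rewrite /= in_itv/= andbT => t0; rewrite mild_mapE.
  apply: within_continuousD; last by exact: (continuous_mild_conv alpha_gt1 m_gt0 K_ge0 S_le S_cont cF).
  by apply: within_continuousD; [exact: S_cont|exact: (continuous_along_history r_gt0 g_cont cu)].
split=> //.
  apply: (@within_continuous_glue _ _ (- r) 0) => //; first by have := r_gt0; lra.
  apply: (@eq_within_continuous _ _ _ phi) => // th.
  by rewrite /= in_itv/= => /onphi.
have [Ag Ag0 hg] := g_growth cu uk k0.
have [Af Af0 hf] := forcing_growth cu uk.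
have [Mp Mp0 hphi] := bounded_on_itv phi_hist.
have pos : 0 <= K * rnorm (phi 0 - g 0 phi) + Ag +
    kernel_mass K m alpha * (Af + k * N).
  have h1 : 0 <= K * rnorm (phi 0 - g 0 phi) by rewrite mulr_ge0// rnorm_ge0.
  have h2 : 0 <= Af + k * N by rewrite addr_ge0// mulr_ge0// stepanov_ge0.
  have h3 := mulr_ge0 kernel_mass_ge0 h2.
  lra.
exists (Mp + (K * rnorm (phi 0 - g 0 phi) + Ag + kernel_mass K m alpha * (Af + k * N))).
  exact: addr_ge0.
move=> t rt.
have [t0|t0] := ltP t 0.
  have rt0 : - r <= t <= 0 by rewrite rt ltW.
  rewrite (onphi t rt0); apply: le_trans (hphi t rt0) _.
  by rewrite lerDl.
rewrite mild_mapE//; apply: le_trans (rnormD _ _) _.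
have h1 : rnorm (S t (phi 0 - g 0 phi)) <= K * rnorm (phi 0 - g 0 phi).
  exact: (solution_operator_le m_gt0 K_ge0 S_le).
have h2 := rnormD (S t (phi 0 - g 0 phi)) (g t (history u t)).
have h3 := hg t t0.
have h4 : rnorm (mild_conv S (forcing u) t) <= kernel_mass K m alpha * (Af + k * N).
  apply: (mild_conv_le alpha_gt1 m_gt0 K_ge0 S_le S_cont p_ge1 Lf_BS Af0 k0 t0 cF).
  by move=> s /andP[s0 _]; exact: hf.
lra.
Qed.

End FixedPointOperator.

(** * The fixed point operator preserves vanishing means *)

Section BlockPreservation.
Context {R : realType} {X : completeNormedModType R[i]}.
Variables (h : R) (Kn : nat).
Hypotheses (h_gt0 : 0 < h) (h_le1 : h <= 1) (Kn_ge2 : (2 <= Kn)%N).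
Let r : R := Kn%:R * h.
Variable omega : R.
Hypothesis omega_gt0 : 0 < omega.
Implicit Types (u : R -> X) (s t k : R) (D E : nat -> R) (n j : nat).

Let r_gt0 : 0 < r.
Proof. by rewrite mulr_gt0// ltr0n; case: Kn Kn_ge2. Qed.

Definition shift_diff u t : R := rnorm (u (t + omega) - u t).

(** Block bounds rather than a vanishing mean of [shift_diff]: these are what is
    stable under windows and convolutions. *)
Definition block_small u := exists2 D, cesaro0 D &
  forall n t, n%:R * h <= t <= n.+1%:R * h -> shift_diff u t <= D n.

Let hS n : n.+1%:R * h = n%:R * h + h.
Proof. by rewrite -natr1 mulrDl mul1r. Qed.

Let nh0 n : 0 <= n%:R * h.
Proof. by rewrite mulr_ge0// ltW. Qed.

Lemma closed_block_exists t n : 0 <= t -> t <= n.+1%:R * h ->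
  exists j, [/\ (j <= n)%N, j%:R * h <= t <= j.+1%:R * h & j = n \/ t < j.+1%:R * h].
Proof.
move=> t0; rewrite le_eqVlt => /orP[/eqP ->|tn].
  by exists n; split; [|rewrite lexx andbT hS lerDl ltW|left].
have [j /andP[jt tj]] := block_exists h_gt0 t0.
by exists j; split; [exact: (block_le h_gt0 jt tn)|rewrite jt ltW|right].
Qed.

Lemma cesaro0_initial (c : R) n0 : 0 <= c ->
  cesaro0 (fun n => if (n < n0)%N then c else 0).
Proof.
move=> c0; apply: (@cesaro0_summable _ _ (c * n0%:R)).
  by move=> n; case: ifP.
move=> n; apply: (@le_trans _ _ (c * (minn n n0)%:R)); last first.
  by rewrite ler_wpM2l// ler_nat geq_minr.
elim: n => [|n IH]; first by rewrite big_ord0 mulr_ge0.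
rewrite big_ord_recr/=; case: ltnP => nn.
  rewrite (minn_idPl nn) -natr1 mulrDr mulr1 lerD2r; apply: le_trans IH _.
  by rewrite ler_wpM2l// ler_nat geq_minl.
rewrite addr0; apply: le_trans IH _.
by rewrite ler_wpM2l// ler_nat leq_min geq_minr andbT (leq_trans (geq_minl _ _)).
Qed.

(** Windows of a block reach [Kn] blocks back, and into [[- r, 0]] only from
    the first [Kn] blocks. *)
Lemma block_small_history u k : 0 <= k ->
  (forall t, - r <= t -> rnorm (u t) <= k) -> block_small u ->
  exists2 E, cesaro0 E & forall n t, n%:R * h <= t <= n.+1%:R * h ->
    forall th, - r <= th <= 0 -> shift_diff u (t + th) <= E n.
Proof.
move=> k0 uk [D cD hD].
have om0 := omega_gt0; have hr0 := r_gt0; have h0 := h_gt0.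
exists (fun n => conv (window Kn) D n + (if (n < Kn)%N then 2 * k else 0)).
  apply: cesaro0D; first exact: cesaro0_window.
  by apply: cesaro0_initial; rewrite mulr_ge0.
have [D0 _] := cD.
have W0 n : 0 <= conv (window Kn) D n.
  by apply: sumr_ge0 => j _; rewrite mulr_ge0// window_ge0.
move=> n t /andP[nt tn] th /andP[th1 th2].
have [tth|tth] := leP 0 (t + th); last first.
  have -> : (n < Kn)%N.
    rewrite -(ltr_nat R) -(ltr_pM2r h_gt0) -/r; lra.
  have := rnormB (u (t + th + omega)) (u (t + th)).
  have : rnorm (u (t + th + omega)) <= k by apply: uk; have := nh0 n; lra.
  have : rnorm (u (t + th)) <= k by apply: uk; have := nh0 n; lra.
  by have := W0 n; rewrite /shift_diff; lra.
have ttn : t + th <= n.+1%:R * h by lra.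
have [j [jn hj hj']] := closed_block_exists tth ttn.
apply: le_trans (hD j _ hj) _.
have : D j <= conv (window Kn) D n.
  apply: window_ge => //; case: hj' => [->|tj]; first exact: leq_addr.
  rewrite -ltnS -(ltr_nat R) -(ltr_pM2r h_gt0) -addSn natrD mulrDl -/r; lra.
by case: ifP => _; lra.
Qed.

Section HistoryMap.
Variables (F : R -> (R -> X) -> X) (L : R -> R).
Hypothesis F_cont : hist_continuous r F.
Hypothesis F_mean : forall k, 0 < k -> vanishing_mean r (fun s =>
  ereal_sup [set
    ereal_sup [set (rnorm (F (tau + omega) x - F tau x))%:E
              | x in [set x | hist_space r x /\ hist_norm r x <= k]]
  | tau in `[s - r, s]]).
Hypothesis L_ge0 : forall t, 0 <= t -> 0 <= L t.
Hypothesis F_lip : forall psi psi' t, hist_space r psi -> hist_space r psi' ->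
  0 <= t -> rnorm (F t psi - F t psi') <= L t * hist_norm r (psi - psi').

(** The first blocks, which the mean hypothesis does not control, are bounded
    by compactness. *)
Lemma block_small_history_map u k : 0 <= k ->
  {within `[- r, +oo[, continuous u} ->
  (forall t, - r <= t -> rnorm (u t) <= k) -> block_small u ->
  exists D E, [/\ cesaro0 D, cesaro0 E & forall n t, n%:R * h <= t <= n.+1%:R * h ->
    rnorm (F (t + omega) (history u (t + omega)) - F t (history u t))
      <= D n + E n * L t].
Proof.
move=> k0 cu uk su.
have om0 := omega_gt0; have hr0 := r_gt0.
have [E cE hE] := block_small_history k0 uk su.
have k1 : 0 < k + 1 by lra.
pose w tau := ereal_sup [set (rnorm (F (tau + omega) x - F tau x))%:E
              | x in [set x | hist_space r x /\ hist_norm r x <= k + 1]].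
have hist0 t : 0 <= t -> hist_norm r (history u t) <= k + 1.
  move=> t0; apply: hist_norm_le => // th /andP[th1 th2].
  by apply: (@le_trans _ _ k); [apply: uk; rewrite -/r; lra|lra].
have w0 t : 0 <= t -> (0 <= w t)%E.
  move=> t0; apply: (@le_trans _ _
      (rnorm (F (t + omega) (history u t) - F t (history u t)))%:E).
    by rewrite lee_fin rnorm_ge0.
  apply: ereal_sup_ubound; exists (history u t) => //; split; last exact: hist0.
  exact: hist_space_history.
have [D cD hD] := vanishing_mean_blocks h_gt0 Kn_ge2 w0 (F_mean k1).
have cF := continuous_along_history r_gt0 F_cont cu.
have [B B0 hB] := bounded_on_itv (within_ray_itv (t := r + omega) cF).
exists (fun n => D n + (if (n < Kn)%N then 2 * B else 0)), E; split => //.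
  by apply: cesaro0D => //; apply: cesaro0_initial; rewrite mulr_ge0.
have [D0 _] := cD; have [E0 _] := cE.
move=> n t /andP[nt tn]; have t0 : 0 <= t by exact: le_trans nt.
have tom : 0 <= t + omega by lra.
have EL0 : 0 <= E n * L t by rewrite mulr_ge0// L_ge0.
case: ltnP => nK.
  have tr : t <= r by apply: le_trans tn _; rewrite ler_wpM2r ?(ltW h_gt0)// ler_nat.
  have := rnormB (F (t + omega) (history u (t + omega))) (F t (history u t)).
  have : rnorm (F (t + omega) (history u (t + omega))) <= B by apply: hB; lra.
  have : rnorm (F t (history u t)) <= B by apply: hB; lra.
  by have := D0 n; lra.
have h1 : rnorm (F (t + omega) (history u (t + omega)) - F t (history u (t + omega))) <= D n.
  rewrite -lee_fin; apply: le_trans (hD n t nK _); last by rewrite nt.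
  apply: ereal_sup_ubound; exists (history u (t + omega)) => //; split.
    exact: hist_space_history.
  exact: hist0.
have h2 : rnorm (F t (history u (t + omega)) - F t (history u t)) <= E n * L t.
  apply: le_trans (F_lip (hist_space_history tom cu) (hist_space_history t0 cu) t0) _.
  rewrite mulrC ler_wpM2r ?L_ge0//; apply: hist_norm_le => // th thr.
  have -> : (history u (t + omega) - history u t) th = u (t + th + omega) - u (t + th).
    by change (u (t + omega + th) - u (t + th) = u (t + th + omega) - u (t + th)); rewrite addrAC.
  by apply: hE => //; rewrite nt.
have := rnormBD (F (t + omega) (history u (t + omega)))
  (F t (history u (t + omega))) (F t (history u t)).
lra.
Qed.

End HistoryMap.

Section ConvolutionBlocks.
Variables (alpha m K p : R) (S : R -> {linear X -> X}) (L : R -> R).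
Hypotheses (alpha_gt1 : 1 < alpha) (m_gt0 : 0 < m) (K_ge0 : 0 <= K).
Hypothesis S_le : forall t x, 0 <= t -> rnorm (S t x) <= kernel K m alpha t * rnorm x.
Hypothesis S_cont : forall x, {within `[0, +oo[, continuous (fun t => S t x)}.
Hypotheses (p_ge1 : 1 <= p) (L_BS : BS_pos p L).

Let al0 : 0 <= alpha.
Proof. by have := alpha_gt1; lra. Qed.

Lemma cesaro0_kernel : cesaro0 (fun n => kernel K m alpha (n%:R * h)).
Proof.
have [B B0 hB] := kernel_step_sum_bounded K_ge0 m_gt0 alpha_gt1 h_gt0.
by apply: cesaro0_summable hB => n; exact: kernel_ge0.
Qed.

(** The lag between two points of the blocks [n] and [j] is at least
    [(n - j - 1) h], so that the convolution is dominated by a discrete one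
    with the summable weights [kernel ((i - 1) h)]. *)
Lemma block_small_mild_conv (F : R -> X) (D E : nat -> R) :
  {within `[0, +oo[, continuous F} -> cesaro0 D -> cesaro0 E ->
  (forall n t, n%:R * h <= t <= n.+1%:R * h ->
     rnorm (F (t + omega) - F t) <= D n + E n * L t) ->
  block_small (mild_conv S F).
Proof.
move=> cF cD cE hF; have om0 := omega_gt0; have h0 := h_gt0.
have [D0 _] := cD; have [E0 _] := cE.
pose N := fine (stepanov_norm p L).
have N0 : 0 <= N by rewrite fine_ge0// stepanov_norm_ge0.
have L0 t : 0 <= t -> 0 <= L t by have [_ + _] := L_BS; apply.
pose kap i := kernel K m alpha (i.-1%:R * h).
have kap0 i : 0 <= kap i by exact: kernel_ge0.
have [B B0 hB] := kernel_step_sum_bounded K_ge0 m_gt0 alpha_gt1 h_gt0.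
have skap n : \sum_(i < n) kap i <= K + B.
  case: n => [|n]; first by rewrite big_ord0 addr_ge0.
  rewrite big_ord_recl; apply: lerD; first exact: kernel_le.
  exact: hB.
have [M1 M10 hM1] := bounded_on_itv (within_ray_itv (t := omega) cF).
exists (fun n => (M1 * omega) * kernel K m alpha (n%:R * h)
    + conv kap (fun j => D j + N * E j) n).
  apply: cesaro0D; first by apply: cesaro0Z; [rewrite mulr_ge0// ltW|exact: cesaro0_kernel].
  apply: (cesaro0_conv kap0 skap); apply: cesaro0D => //.
  exact: cesaro0Z.
move=> n t /andP[nt tn]; have t0 : 0 <= t by exact: le_trans nt.
have := mild_conv_shift_le alpha_gt1 m_gt0 K_ge0 S_le S_cont t0 (ltW om0) cF hM1.
have cFs : {within `[0, t], continuous (fun s => F (s + omega) - F s)}.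
  apply: within_continuousB; last exact: within_ray_itv.
  apply/within_continuousP => s; rewrite /= in_itv/= => /andP[s0 st] e e0.
  have [|d d0 H] := (within_continuousP _ _).1 cF (s + omega) _ e e0.
    by rewrite /= in_itv/= andbT; lra.
  exists d => // s'; rewrite /= in_itv/= => /andP[s'0 _] ss'; apply: H.
    by rewrite /= in_itv/= andbT; lra.
  by rewrite opprD addrACA subrr addr0.
have mFs := measurable_convolution m_gt0 K_ge0 S_le S_cont cFs.
have key : (\int[lebesgue_measure]_(s in `[0%R, t])
      (rnorm (S (t - s) (F (s + omega) - F s)))%:E
    <= (conv kap (fun j => D j + N * E j) n)%:E)%E.
  apply: (@integral_cover_le _ _ (fun j => `[j%:R * h, j.+1%:R * h]%classic)
    (fun s => rnorm (S (t - s) (F (s + omega) - F s)))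
    (fun j => kap (n - j)%N * (D j + N * E j))) => //.
  - move=> s _; exact: rnorm_ge0.
  - move=> s; rewrite /= in_itv/= => /andP[s0 st].
    have [j [jn hj _]] := closed_block_exists s0 (le_trans st tn).
    by exists j; [rewrite ltnS|rewrite /= in_itv].
  move=> j; rewrite ltnS => jn.
  pose b := Num.min t (j.+1%:R * h).
  have -> : `[0%R, t]%classic `&` `[(j%:R * h)%R, (j.+1%:R * h)%R]%classic
      = `[(j%:R * h)%R, b]%classic :> set R.
    apply/seteqP; split=> x /=; rewrite !in_itv/= /b le_min.
      by move=> [/andP[x0 ->] /andP[-> ->]].
    by move=> /andP[jx /andP[-> ->]]; rewrite jx (le_trans (nh0 j) jx).
  have bj : b <= j%:R * h + 1.
    by apply: (@le_trans _ _ (j.+1%:R * h)); [rewrite ge_min lexx orbT|rewrite hS lerD2l].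
  have bt : b <= t by rewrite ge_min lexx.
  rewrite mulrDr (mulrC N) mulrA.
  apply: (integral_le_stepanov p_ge1 L_BS (nh0 j) bj).
  - by rewrite mulr_ge0.
  - by rewrite mulr_ge0.
  - apply: measurable_funS mFs => //.
    move=> x /=; rewrite !in_itv/= => /andP[jx xb].
    by rewrite (le_trans (nh0 j) jx)/= (le_trans xb).
  move=> s /andP[js sb]; rewrite rnorm_ge0/=.
  have s0 : 0 <= s by exact: le_trans js.
  have st : s <= t by exact: le_trans bt.
  have sj : s <= j.+1%:R * h by apply: le_trans sb _; rewrite ge_min lexx orbT.
  have ts0 : 0 <= t - s by rewrite subr_ge0.
  apply: le_trans (S_le _ ts0) _; rewrite -mulrA -mulrDr.
  apply: ler_pM; [exact: kernel_ge0|exact: rnorm_ge0| |].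
    apply: kernel_decr => //.
    have [->|] := posnP (n - j)%N; first by rewrite mul0r.
    rewrite subn_gt0 => jn'; have -> : ((n - j).-1 = n - j.+1)%N by rewrite subnS.
    rewrite natrB// mulrBl; lra.
  by apply: hF; rewrite js.
move=> /le_trans/(_ (leeD2l _ key)); rewrite -EFinD lee_fin => hle.
apply: le_trans hle _; rewrite lerD2r.
rewrite -mulrA mulrC; apply: ler_wpM2l; first by rewrite mulr_ge0// ltW.
exact: kernel_decr.
Qed.

End ConvolutionBlocks.

End BlockPreservation.

(** * Mild solutions *)

Section MildSolutions.
Context {R : realType} {X : completeNormedModType R[i]}.
Variables (h : R) (Kn : nat).
Hypotheses (h_gt0 : 0 < h) (h_le1 : h <= 1) (Kn_ge2 : (2 <= Kn)%N).
Let r : R := Kn%:R * h.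
Variables (alpha m K omega p : R) (S : R -> {linear X -> X}).
Variables (phi : R -> X) (f g : R -> (R -> X) -> X) (Lf Lg : R -> R).
Hypotheses (alpha_gt1 : 1 < alpha) (m_gt0 : 0 < m) (K_ge0 : 0 <= K).
Hypothesis S_le : forall t x, 0 <= t -> rnorm (S t x) <= kernel K m alpha t * rnorm x.
Hypothesis S_cont : forall x, {within `[0, +oo[, continuous (fun t => S t x)}.
Hypothesis S_at0 : forall x, S 0 x = x.
Hypotheses (omega_gt0 : 0 < omega) (p_ge1 : 1 <= p).
Hypothesis phi_hist : hist_space r phi.
Hypotheses (f_psap : PSAPr_hist omega r f) (g_psap : PSAPr_hist omega r g).
Hypotheses (f_zero : Cb 0 (fun t => f t (cst 0))) (g_zero : Cb 0 (fun t => g t (cst 0))).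
Hypotheses (Lg_pos : Cb_pos Lg) (Lf_BS : BS_pos p Lf).
Hypothesis g_lip : forall psi psi' t, hist_space r psi -> hist_space r psi' ->
  0 <= t -> rnorm (g t psi - g t psi') <= Lg t * hist_norm r (psi - psi').
Hypothesis f_lip : forall psi psi' t, hist_space r psi -> hist_space r psi' ->
  0 <= t -> rnorm (f t psi - f t psi') <= Lf t * hist_norm r (psi - psi').
Implicit Types (u v : R -> X) (t s d k : R).

Let q : R := Cb_pos_norm Lg + kernel_mass K m alpha * fine (stepanov_norm p Lf).
Hypothesis q_lt1 : q < 1.

Let r_gt0 : 0 < r.
Proof. by rewrite mulr_gt0// ltr0n; case: Kn Kn_ge2. Qed.

Let q_ge0 : 0 <= q.
Proof.
by rewrite addr_ge0 ?(Cb_pos_norm_ge0 Lg_pos)// mulr_ge0 ?kernel_mass_ge0// stepanov_ge0.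
Qed.

Notation Gamma := (mild_map S phi f g).
Notation adm := (admissible r phi).
Notation small := (block_small h omega).

Let nh0 (n : nat) : 0 <= n%:R * h.
Proof. by rewrite mulr_ge0// ltW. Qed.

Lemma mild_map_block_small u : adm u -> small u -> small (Gamma u).
Proof.
move=> [cu [k k0 uk] _] su; have om0 := omega_gt0.
have [f_cont f_mean] := f_psap; have [g_cont g_mean] := g_psap.
have Lg0 t : 0 <= t -> 0 <= Lg t by move=> /(Cb_pos_norm_ub Lg_pos)/andP[].
have Lf0 t : 0 <= t -> 0 <= Lf t by have [_ + _] := Lf_BS; apply.
have [Dg [Eg [cDg cEg hg]]] := block_small_history_map h_gt0 Kn_ge2 omega_gt0
  g_cont g_mean Lg0 g_lip k0 cu uk su.
have [Df [Ef [cDf cEf hf]]] := block_small_history_map h_gt0 Kn_ge2 omega_gt0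
  f_cont f_mean Lf0 f_lip k0 cu uk su.
have cF : {within `[0, +oo[, continuous (forcing f u)}.
  exact: (continuous_forcing r_gt0 f_cont cu).
have [Dc cDc hc] := block_small_mild_conv h_gt0 h_le1 omega_gt0 alpha_gt1
  m_gt0 K_ge0 S_le S_cont p_ge1 Lf_BS cF cDf cEf hf.
pose x0 := phi 0 - g 0 phi.
exists (fun n => (2 * rnorm x0) * kernel K m alpha (n%:R * h)
    + (Dg n + Cb_pos_norm Lg * Eg n) + Dc n).
  apply: cesaro0D => //; apply: cesaro0D.
    apply: cesaro0Z; first by rewrite mulr_ge0// rnorm_ge0.
    exact: cesaro0_kernel.
  apply: cesaro0D => //; apply: cesaro0Z => //; exact: Cb_pos_norm_ge0.
move=> n t /andP[nt tn]; have t0 : 0 <= t by exact: le_trans nt.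
have tom : 0 <= t + omega by lra.
rewrite /shift_diff !mild_mapE// -/x0.
have hS : rnorm (S (t + omega) x0 - S t x0) <= 2 * rnorm x0 * kernel K m alpha (n%:R * h).
  apply: le_trans (rnormB _ _) _.
  have h1 := S_le x0 t0; have h2 := S_le x0 tom.
  have al0 : 0 <= alpha by have := alpha_gt1; lra.
  have k1 : kernel K m alpha t * rnorm x0 <= kernel K m alpha (n%:R * h) * rnorm x0.
    by apply: ler_wpM2r; [exact: rnorm_ge0|exact: kernel_decr].
  have k2 : kernel K m alpha (t + omega) * rnorm x0
      <= kernel K m alpha (n%:R * h) * rnorm x0.
    by apply: ler_wpM2r; [exact: rnorm_ge0|apply: kernel_decr => //; lra].
  lra.
have hg' : rnorm (g (t + omega) (history u (t + omega)) - g t (history u t))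
    <= Dg n + Cb_pos_norm Lg * Eg n.
  apply: le_trans (hg n t _) _; first by rewrite nt.
  have [Eg0 _] := cEg; have /andP[_ Lgn] := Cb_pos_norm_ub Lg_pos t0.
  by rewrite lerD2l mulrC ler_wpM2r.
have hc' := hc n t; rewrite /shift_diff nt tn in hc'; have {}hc' := hc' isT.
have E (a b c a' b' c' : X) :
    a + b + c - (a' + b' + c') = (a - a') + (b - b') + (c - c').
  by rewrite !opprD addrACA; congr (_ + _); rewrite addrACA.
rewrite E; apply: le_trans (rnormD _ _) _; apply: lerD => //.
by apply: le_trans (rnormD _ _) _; exact: lerD.
Qed.

(** The additional [e] allows for uniform limits of functions with block
    bounds. *)
Lemma block_bounds_PSAPr u : {within `[- r, +oo[, continuous u} ->
  (exists k, forall t, - r <= t -> rnorm (u t) <= k) ->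
  (forall e, 0 < e -> exists2 D, cesaro0 D & forall n t,
     n%:R * h <= t <= n.+1%:R * h -> shift_diff omega u t <= D n + e) ->
  PSAPr omega r u.
Proof.
move=> cu [k uk] su; have r0 := r_gt0.
split; first split.
- split.
    apply: continuous_subspaceW cu => t; rewrite /= !in_itv/= !andbT; lra.
  by exists k => t t0; apply: uk; lra.
- apply: (blocks_vanishing_mean h_gt0) => //.
    by move=> s _; rewrite lee_fin rnorm_ge0.
  move=> e /su[D cD hD]; exists D => // n s _ /andP[ns sn].
  by rewrite lee_fin; apply: hD; rewrite ns ltW.
have rw s : r <= s -> (0 <= ereal_sup [set (rnorm (u (tau + omega) - u tau))%:E
              | tau in `[(s - r)%R, s]])%E.
  move=> rs; apply: (@le_trans _ _ (rnorm (u (s + omega) - u s))%:E).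
    by rewrite lee_fin rnorm_ge0.
  by apply: ereal_sup_ubound; exists s => //=; rewrite in_itv/= lexx andbT; lra.
apply: (blocks_vanishing_mean h_gt0 (ltW r0)) => //.
move=> e /su[D cD hD]; exists (conv (window Kn) D); first exact: cesaro0_window.
have [D0 _] := cD.
move=> n s rs /andP[ns sn]; apply: ub_ereal_sup => _ [tau /= + <-].
rewrite in_itv/= => /andP[stau taus]; rewrite lee_fin.
have tau0 : 0 <= tau by lra.
have taun : tau <= n.+1%:R * h by lra.
have [j [jn hj hj']] := closed_block_exists h_gt0 tau0 taun.
apply: le_trans (hD j tau hj) _; rewrite lerD2r.
apply: window_ge => //; case: hj' => [->|tj]; first exact: leq_addr.
rewrite -ltnS -(ltr_nat R) -(ltr_pM2r h_gt0) -addSn natrD mulrDl -/r; lra.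
Qed.

Let u0 t : X := phi (Num.min t 0).
Let u_ n : R -> X := iter n Gamma u0.

Let adm_u0 : adm u0.
Proof.
have r0 := r_gt0.
have [Mp Mp0 hphi] := bounded_on_itv phi_hist.
split.
- apply: (@within_continuous_glue _ _ (- r) 0); first lra.
    apply: (@eq_within_continuous _ _ _ phi) => // t.
    by rewrite /= in_itv/= => /andP[_ t0]; rewrite /u0 min_l.
  apply: (@eq_within_continuous _ _ _ (cst (phi 0))) => [t|].
    by rewrite /= in_itv/= andbT => t0; rewrite /u0 min_r.
  by apply: continuous_subspaceT => x; exact: cvg_cst.
- exists Mp => // t rt; apply: hphi; rewrite ge_min lexx orbT andbT.
  by rewrite le_min rt/=; lra.
- by move=> th /andP[_ th0]; rewrite /u0 min_l.
Qed.

Let small_u0 : small u0.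
Proof.
exists (fun=> 0).
  by apply: (@cesaro0_summable _ _ 0) => // n; rewrite big1.
move=> n t /andP[nt _]; have om0 := omega_gt0.
have t0 : 0 <= t by exact: le_trans nt.
by rewrite /shift_diff /u0 !min_r ?subrr ?rnorm0//; lra.
Qed.

Let adm_map u : adm u -> adm (Gamma u).
Proof.
have [f_cont _] := f_psap; have [g_cont _] := g_psap.
exact: (mild_map_admissible alpha_gt1 m_gt0 K_ge0 S_le S_cont S_at0 r_gt0 p_ge1
  phi_hist f_cont g_cont f_zero g_zero Lg_pos Lf_BS g_lip f_lip).
Qed.

Let dist_map u v d : 0 <= d -> adm u -> adm v ->
  (forall t, - r <= t -> rnorm (u t - v t) <= d) ->
  forall t, - r <= t -> rnorm (Gamma u t - Gamma v t) <= q * d.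
Proof.
have [f_cont _] := f_psap; have [g_cont _] := g_psap.
move=> d0 [cu _ _] [cv _ _].
exact: (mild_map_dist_le phi alpha_gt1 m_gt0 K_ge0 S_le S_cont r_gt0 p_ge1
  f_cont Lg_pos Lf_BS g_lip f_lip d0 cu cv).
Qed.

Let adm_u n : adm (u_ n).
Proof. by elim: n => [|n IH]; [exact: adm_u0|exact: adm_map]. Qed.

Let small_u n : small (u_ n).
Proof. by elim: n => [|n IH]; [exact: small_u0|exact: mild_map_block_small]. Qed.

Let geometric_small d e : 0 < e -> exists n, q ^+ n * d <= e.
Proof.
move=> e0; have q1 : `|q| < 1 by rewrite ger0_norm.
have d1 : 0 < `|d| + 1 by rewrite ltr_wpDl.
have e1 : 0 < e / (`|d| + 1) by rewrite divr_gt0.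
have /cvgrPdist_lt/(_ _ e1) [N _ hN] := cvg_expr q1.
exists N; have := hN N (leqnn N); rewrite /= sub0r normrN ger0_norm ?exprn_ge0//.
rewrite ltr_pdivlMr// => hh.
have : q ^+ N * d <= q ^+ N * (`|d| + 1).
  by apply: ler_wpM2l; [exact: exprn_ge0|have := ler_norm d; lra].
lra.
Qed.

Let geometric_eq0 (x : X) d : (forall n, rnorm x <= q ^+ n * d) -> x = 0.
Proof.
move=> hx; apply/rnorm_eq0/eqP; rewrite eq_le rnorm_ge0 andbT.
apply/ler_addgt0Pr => e /(geometric_small d)[n hn]; rewrite add0r.
exact: le_trans (hx n) hn.
Qed.

Let dist_adm u v : adm u -> adm v ->
  exists2 d, 0 <= d & forall t, - r <= t -> rnorm (u t - v t) <= d.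
Proof.
move=> [_ [k k0 uk] _] [_ [k' k'0 vk] _]; exists (k + k'); first exact: addr_ge0.
move=> t rt; apply: le_trans (rnormB _ _) _.
by apply: lerD; [exact: uk|exact: vk].
Qed.

Let picard_limit : exists u d, [/\ 0 <= d, adm u &
  forall n t, - r <= t -> rnorm (u t - u_ n t) <= q ^+ n * d].
Proof.
have r0 := r_gt0.
have [d0 d00 hd0] := dist_adm (adm_u 1) (adm_u 0).
have step n : forall t, - r <= t -> rnorm (u_ n.+1 t - u_ n t) <= q ^+ n * d0.
  elim: n => [|n IH] t rt; first by rewrite expr0 mul1r; exact: hd0.
  have qd : 0 <= q ^+ n * d0 by rewrite mulr_ge0// exprn_ge0.
  by rewrite exprS -mulrA; exact: (dist_map qd (adm_u n.+1) (adm_u n) IH rt).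
have q1 : 0 < 1 - q by rewrite subr_gt0.
pose d := d0 / (1 - q); have dge0 : 0 <= d by rewrite divr_ge0// ltW.
have dE : d * (1 - q) = d0 by rewrite /d divfK// gt_eqF.
have far n j t : - r <= t -> rnorm (u_ (n + j)%N t - u_ n t) <= q ^+ n * d * (1 - q ^+ j).
  move=> rt; elim: j => [|j IH]; first by rewrite addn0 subrr rnorm0 expr0 subrr mulr0.
  rewrite addnS; apply: le_trans (rnormBD _ (u_ (n + j)%N t) _) _.
  have := step (n + j)%N t rt; rewrite -dE exprD exprS.
  set a := q ^+ n in IH *; set b := q ^+ j in IH *; lra.
have far' n j t : - r <= t -> rnorm (u_ (n + j)%N t - u_ n t) <= q ^+ n * d.
  move=> rt; apply: le_trans (far n j t rt) _; rewrite ler_piMr//.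
    by rewrite mulr_ge0// exprn_ge0.
  by rewrite gerBl exprn_ge0.
have lim t : - r <= t -> exists l : X, (fun n => u_ n t) @ \oo --> l.
  move=> rt; apply: rnorm_cauchy_cvg => e e0.
  have e3 : 0 < e / 3 by lra.
  have [n0 hn0] := geometric_small d e3; exists n0 => a b na nb.
  have := far' n0 (a - n0)%N t rt; have := far' n0 (b - n0)%N t rt.
  rewrite !subnKC//; have := rnormBD (u_ a t) (u_ n0 t) (u_ b t).
  by rewrite (rnormBC (u_ n0 t)); lra.
pose u t : X := xget 0 [set l : X | (fun n => u_ n t) @ \oo --> l].
have ulim t : - r <= t -> (fun n => u_ n t) @ \oo --> u t.
  by move=> rt; exact: (@xgetPex _ (0 : X) [set l : X | (fun n => u_ n t) @ \oo --> l] (lim t rt)).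
have hu n t : - r <= t -> rnorm (u t - u_ n t) <= q ^+ n * d.
  move=> rt; apply/ler_addgt0Pr => e e0.
  have /cvg_rnormP/(_ _ e0) [n1 _ hn1] := ulim t rt.
  have := hn1 (n + n1)%N (leq_addl _ _); have := far' n n1 t rt.
  by have := rnormBD (u t) (u_ (n + n1)%N t) (u_ n t); rewrite /=; lra.
exists u, d; split; [exact: dge0| |exact: hu]; split.
- apply/within_continuousP => t; rewrite /= in_itv/= andbT => rt e e0.
  have e3 : 0 < e / 3 by lra.
  have [n hn] := geometric_small d e3.
  have [cn _ _] := adm_u n.
  have [|dl dl0 H] := (within_continuousP _ _).1 cn t _ _ e3.
    by rewrite /= in_itv/= andbT.
  exists dl => // s; rewrite /= in_itv/= andbT => rs st.
  have h1 := H s _ st; rewrite /= in_itv/= andbT in h1; have {}h1 := h1 rs.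
  have := rnormBD (u s) (u_ n s) (u t); have := rnormBD (u_ n s) (u_ n t) (u t).
  by have := hu n s rs; have := hu n t rt; rewrite (rnormBC (u t)); lra.
- have [_ [k k0 hk] _] := adm_u 0; exists (k + d); first by rewrite addr_ge0.
  move=> t rt; have := hu 0%N t rt; rewrite expr0 mul1r.
  have := hk t rt; have := rnormD (u t - u_ 0 t) (u_ 0 t); rewrite subrK; lra.
- move=> th thr; apply/eqP; rewrite -subr_eq0; apply/eqP.
  apply: (@geometric_eq0 _ d) => n; have [_ _ hn] := adm_u n.
  by rewrite -(hn th thr); apply: hu; case/andP: thr.
Qed.

Lemma mild_solution_fixed_point u : adm u ->
  (forall t, - r <= t -> u t = Gamma u t) -> mild_solution r S f g phi u.
Proof.
move=> [cu [k k0 uk] uphi] uG; have r0 := r_gt0; split.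
- by split=> //; exists k.
- by move=> th thr; rewrite /history add0r; exact: uphi.
move=> t t0; exists (mild_conv S (forcing f u) t); split.
  have [f_cont _] := f_psap.
  exact: (mild_convP m_gt0 K_ge0 S_le S_cont t0 (continuous_forcing r_gt0 f_cont cu)).
by rewrite uG ?mild_mapE//; lra.
Qed.

Lemma fixed_point_mild_solution v : mild_solution r S f g phi v ->
  adm v /\ forall t, - r <= t -> v t = Gamma v t.
Proof.
move=> [[cv [k vk]] vphi vE]; have r0 := r_gt0; have [f_cont _] := f_psap.
have vphi' th : - r <= th <= 0 -> v th = phi th.
  by move=> /vphi; rewrite /history add0r.
split.
  split=> //; exists `|k| => // t rt.
  by apply: le_trans (vk t rt) _; exact: ler_norm.
move=> t rt; have [t0|t0] := ltP t 0.
  by rewrite /mild_map t0 vphi'// rt ltW.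
rewrite mild_mapE//; have [w [hw ->]] := vE t t0; congr (_ + _).
exact: (mild_conv_unique m_gt0 K_ge0 S_le S_cont t0 (continuous_forcing r_gt0 f_cont cv)).
Qed.

Lemma mild_solution_exists_unique : exists u : R -> X,
  [/\ mild_solution r S f g phi u, PSAPr omega r u
    & forall v : R -> X, mild_solution r S f g phi v ->
        forall t, - r <= t -> v t = u t].
Proof.
have r0 := r_gt0; have om0 := omega_gt0.
have [u [d [d0 au hu]]] := picard_limit.
have within2 (x y z : X) k : rnorm (x - y) <= k -> rnorm (z - y) <= k -> rnorm (x - z) <= 2 * k.
  by rewrite (rnormBC z); have := rnormBD x y z; lra.
have uG t : - r <= t -> u t = Gamma u t.
  move=> rt; apply/eqP; rewrite -subr_eq0; apply/eqP.
  apply: (@geometric_eq0 _ (2 * d)) => n.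
  have qd : 0 <= q ^+ n * d by rewrite mulr_ge0// exprn_ge0.
  have h4 : q * (q ^+ n * d) <= q ^+ n * d := ler_piMl qd (ltW q_lt1).
  have h1 := dist_map qd au (adm_u n) (hu n) rt.
  have h2 : rnorm (u t - Gamma (u_ n) t) <= q * (q ^+ n * d).
    by rewrite mulrA -exprS; exact: (hu n.+1 t rt).
  have h3 : rnorm (u t - Gamma u t) <= 2 * (q * (q ^+ n * d)) := within2 _ _ _ _ h2 h1.
  apply: le_trans h3 _; rewrite (mulrCA (q ^+ n)); apply: ler_wpM2l h4.
  exact: ler0n.
exists u; split.
- exact: mild_solution_fixed_point.
- have [cu [k _ uk] _] := au; apply: block_bounds_PSAPr => //; first by exists k.
  move=> e e0; have e2 : 0 < e / 2 by lra.
  have [n hn] := geometric_small d e2.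
  have [D cD hD] := small_u n; exists D => // n' t /andP[nt tn].
  have t0 : 0 <= t by exact: le_trans nt.
  have := hD n' t; rewrite nt tn => /(_ isT); rewrite /shift_diff.
  have rt : - r <= t by lra.
  have rto : - r <= t + omega by lra.
  have := hu n t rt; have := hu n _ rto.
  have := rnormBD (u (t + omega)) (u_ n (t + omega)) (u t).
  have := rnormBD (u_ n (t + omega)) (u_ n t) (u t).
  by rewrite (rnormBC (u_ n t) (u t)); lra.
move=> v /fixed_point_mild_solution[av vG] t rt.
apply/eqP; rewrite -subr_eq0; apply/eqP.
have [d' d'0 hd'] := dist_adm av au.
apply: (@geometric_eq0 _ d') => n; move: t rt.
elim: n => [|n IH] t rt; first by rewrite expr0 mul1r; exact: hd'.
have qd : 0 <= q ^+ n * d' by rewrite mulr_ge0// exprn_ge0.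
by rewrite vG// uG// exprS -mulrA; exact: (dist_map qd av au IH rt).
Qed.

End MildSolutions.

Theorem theorem3p4 (R : realType) (X : completeNormedModType R[i])
  (alpha r omega p mu theta M C : R)
  (A : operator X) (S : R -> {linear X -> X})
  (phi : R -> X) (f g : R -> (R -> X) -> X) (Lf Lg : R -> R) :
  1 < alpha < 2 -> 0 < r -> 0 < omega -> 1 <= p ->
  hist_space r phi ->
  dense (op_dom A) ->
  mu < 0 -> theta <= pi * (1 - alpha / 2) -> sectorial A mu theta M ->
  solution_operator alpha A S ->
  0 < C ->
  (forall t, 0 <= t ->
    (opnorm (S t) <= (C * M / (1 + `|mu| * t `^ alpha))%:E)%E) ->
  PSAPr_hist omega r f -> PSAPr_hist omega r g ->
  Cb 0 (fun t => f t (cst 0)) -> Cb 0 (fun t => g t (cst 0)) ->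
  Cb_pos Lg -> BS_pos p Lf -> L1loc_pos Lf ->
  (forall psi psi' t, hist_space r psi -> hist_space r psi' -> 0 <= t ->
    rnorm (g t psi - g t psi') <= Lg t * hist_norm r (psi - psi')) ->
  (forall psi psi' t, hist_space r psi -> hist_space r psi' -> 0 <= t ->
    rnorm (f t psi - f t psi') <= Lf t * hist_norm r (psi - psi')) ->
  ((Cb_pos_norm Lg)%:E +
     (C * M * (1 + `|mu| `^ (- alpha^-1) * pi /
                   (alpha * sin (pi / alpha))))%:E * stepanov_norm p Lf
   < 1)%E ->
  exists u : R -> X,
    [/\ mild_solution r S f g phi u, PSAPr omega r u
      & forall v : R -> X, mild_solution r S f g phi v -> PSAPr omega r v ->
          forall t, - r <= t -> v t = u t].
Proof.
move=> /andP[al1 _] r0 om0 p1 hphi dA mu0 _ hA hS C0 S_opnorm fP gP f0 g0 LgP LfP _.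
move=> g_lip f_lip q1.
have [_ _ M0 _ _] := hA; have [_ _ S_cont _] := hS.
have m0 : 0 < `|mu| by rewrite normr_gt0 lt_eqF.
have K0 : 0 <= C * M by rewrite mulr_ge0// ltW.
have S_le t x : 0 <= t -> rnorm (S t x) <= kernel (C * M) `|mu| alpha t * rnorm x.
  by move=> t0; exact: (opnorm_le (S_opnorm t t0)).
have S_at0 x : S 0 x = x.
  apply: (solution_operator_at0 (K := C * M) _ mu0 hA hS dA); first by lra.
  by move=> t y t0; exact: (solution_operator_le m0 K0 S_le).
have q1' : Cb_pos_norm Lg + kernel_mass (C * M) `|mu| alpha
    * fine (stepanov_norm p Lf) < 1.
  by move: q1; rewrite (BS_pos_stepanov_fin LfP) -EFinM -EFinD lte_fin.
pose Kn := (Num.bound r).+2; pose h := r / Kn%:R.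
have Kn0 : 0 < Kn%:R :> R by rewrite ltr0n.
have h0 : 0 < h by rewrite divr_gt0.
have h1 : h <= 1.
  rewrite ler_pdivrMr// mul1r; apply: ltW; apply: lt_le_trans (archi_boundP (ltW r0)) _.
  by rewrite ler_nat /Kn -addn2 leq_addr.
have rE : r = Kn%:R * h by rewrite /h mulrC divfK// gt_eqF.
have Kn2 : (2 <= Kn)%N by [].
clearbody h; clearbody Kn; subst r.
have [u [hu pu uu]] := mild_solution_exists_unique h0 h1 Kn2 al1 m0 K0 S_le
  S_cont S_at0 om0 p1 hphi fP gP f0 g0 LgP LfP g_lip f_lip q1'.
by exists u; split=> // v hv _; exact: uu.
Qed.
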